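(* Let $\mu,\nu\in\mathbb N$ and let $E,F,G\to M$ be hermitian vector bundles with metric preserving connections. Assume that the Riemannian manifold $M$ satisfies the Fréchet finiteness condition (FFC), and let $Z_1,\dots,Z_N\in\mathcal W_b(M)$ be a Fréchet system of generators for $\mathcal W_b(M)$. Then: (i) $\widetilde{\mathrm{Diff}}{}_b^{\nu}(M;F,G)\,\widetilde{\mathrm{Diff}}{}_b^{\mu}(M;E,F)\subset\widetilde{\mathrm{Diff}}{}_b^{\mu+\nu}(M;E,G)$. (ii) $\widetilde{\mathrm{Diff}}{}_b^{\mu}(M;E,F)=\mathrm{Diff}_b^{\mu}(M;E,F)$. (iii) $\mathrm{Diff}_b^\mu(M;E,F)$ is linearly generated by the operators $a\nabla_{X_1}\nabla_{X_2}\cdots\nabla_{X_r}$, where $r\le\mu$, $X_1,\dots,X_r\in\{Z_1,\dots,Z_N\}$ and $a\in C^\infty_b(M;\operatorname{Hom}(E,F))$.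
   Context: $M$ is a smooth Riemannian manifold without boundary. All vector bundles are smooth, complex, of finite rank, hermitian, with metric preserving connections, generically denoted $\nabla$. Tensor products and $\operatorname{Hom}$-bundles carry the induced metrics and connections, and $TM$, $T^*M$ carry the Levi-Civita connection. $\nabla^j$ is the $j$-fold iterated connection, mapping sections of $E$ to sections of $T^{*\otimes j}M\otimes E$. For a bundle $V$ with metric and connection, $C^\infty_b(M;V)=W^{\infty,\infty}(M;V)$ is the space of bounded smooth sections all of whose covariant derivatives are bounded. $\mathcal W_b(M):=C^\infty_b(M;TM)$. $\mathrm{Diff}_b^\mu(M;E,F)$: operators $\sum_{j=0}^\mu a^{[j]}\nabla^j:C^\infty_c(M;E)\to C^\infty_c(M;F)$ with $a^{[j]}\in C^\infty_b(M;\operatorname{Hom}(T^{*\otimes j}M\otimes E;F))$. $\widetilde{\mathrm{Diff}}{}_b^\mu(M;E,F)$ (mixed differential operators of order $\le\mu$ with $C^\infty_b$-coefficients): the linear span of the operators $a\nabla_{X_1}\cdots\nabla_{X_r}$ with $0\le r\le\mu$, $a\in C^\infty_b(M;\operatorname{Hom}(E,F))$ and $X_j\in\mathcal W_b(M)$. (FFC): $(M,g)$ satisfies the Fréchet finiteness condition if there exist $N\in\mathbb N$ and an isometric vector bundle embedding $\Phi:TM\to M\times\mathbb R^N$ with $\Phi\in W^{\infty,\infty}(M;\operatorname{Hom}(TM;\mathbb R^N))$, where the trivial bundle $\mathbb R^N$ has the constant metric and flat connection. The associated Fréchet system of generators of $\mathcal W_b(M)$ is $Z_j:=\Phi^\top(e_j)$,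 $1\le j\le N$, where $(e_j)$ is the standard basis of $\mathbb R^N$ and $\Phi^\top$ is the transpose of $\Phi$; then $\mathcal W_b(M)=\sum_jC^\infty_b(M)Z_j$. *)

(* Defs.v *)
From HB Require Import structures.
From mathcomp Require Import all_boot all_order all_algebra.
From mathcomp Require Import complex.
From mathcomp Require Import all_classical all_reals all_analysis.

Set Implicit Arguments.
Unset Strict Implicit.
Unset Printing Implicit Defensive.

Import Order.TTheory GRing.Theory Num.Theory.
Import numFieldNormedType.Exports.

Local Open Scope classical_set_scope.
Local Open Scope ring_scope.

(* The field of scalars of a bundle, either R or R[i], with its real and
   imaginary parts; the imaginary unit is 0 when the field is R.  Real bundles
   (TM, M x R^N) and complex bundles are thus treated by the same definitions. *)
Record scalars (R : realType) := Scalars {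
  sK :> fieldType;
  sinj : {rmorphism R -> sK};
  sre : sK -> R;
  sim : sK -> R;
  si : sK;
  s_decomp : forall z, z = sinj (sre z) + si * sinj (sim z);
  sre_inj : forall a, sre (sinj a) = a;
  sim_inj : forall a, sim (sinj a) = 0;
  sreD : forall z w, sre (z + w) = sre z + sre w;
  simD : forall z w, sim (z + w) = sim z + sim w;
  sreM : forall z w, sre (z * w) = sre z * sre w - sim z * sim w;
  simM : forall z w, sim (z * w) = sre z * sim w + sim z * sre w }.

Definition sconj (R : realType) (S : scalars R) (z : S) : S :=
  sinj S (sre z) - si S * sinj S (sim z).

Section scalar_instances.
Variable R : realType.
Implicit Types (a b : R) (z w : R[i]).

Fact real_decomp a : a = a + 0 * 0.
Proof. by rewrite mul0r addr0. Qed.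

Fact real_simD a b : 0 = 0 + 0 :> R. Proof. by rewrite addr0. Qed.

Fact real_sreM a b : a * b = a * b - 0 * 0. Proof. by rewrite mul0r subr0. Qed.

Fact real_simM a b : 0 = a * 0 + 0 * b.
Proof. by rewrite mulr0 mul0r addr0. Qed.

Definition real_scalars : scalars R :=
  @Scalars R R idfun id (fun=> 0) 0 real_decomp (fun=> erefl) (fun=> erefl)
    (fun _ _ => erefl) real_simD real_sreM real_simM.

Fact complex_ReD z w : complex.Re (z + w) = complex.Re z + complex.Re w.
Proof. by case: z w => [a b] [c d]. Qed.

Fact complex_ImD z w : complex.Im (z + w) = complex.Im z + complex.Im w.
Proof. by case: z w => [a b] [c d]. Qed.

Fact complex_ReM z w : complex.Re (z * w) =
  complex.Re z * complex.Re w - complex.Im z * complex.Im w.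
Proof. by case: z w => [a b] [c d]. Qed.

Fact complex_ImM z w : complex.Im (z * w) =
  complex.Re z * complex.Im w + complex.Im z * complex.Re w.
Proof. by case: z w => [a b] [c d]. Qed.

Definition complex_scalars : scalars R :=
  @Scalars R R[i] (real_complex R) (@complex.Re R) (@complex.Im R) 'i%C
    (@complexE R) (fun=> erefl) (fun=> erefl)
    complex_ReD complex_ImD complex_ReM complex_ImM.

End scalar_instances.

Section euclidean_smooth.
Variables (R : realType) (n : nat).

(* Meant for open U. *)
Fixpoint Ck (k : nat) (U : set 'rV[R]_n) (f : 'rV[R]_n -> R) : Prop :=
  if k is k'.+1 then
    (forall x, U x -> differentiable f x) /\
    (forall i : 'I_n, Ck k' U (fun x => 'D_(delta_mx 0 i) f x))
  else forall x, U x -> {for x, continuous f}.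

Definition Cinf (U : set 'rV[R]_n) (f : 'rV[R]_n -> R) : Prop :=
  forall k, Ck k U f.

End euclidean_smooth.

Record manifold (R : realType) (n : nat) := Manifold {
  mcar :> topologicalType;
  m_hausdorff : hausdorff_space mcar;
  m_second_countable : @second_countable mcar;
  cidx : Type;
  cdom : cidx -> set mcar;
  chart : cidx -> mcar -> 'rV[R]_n;
  chartV : cidx -> 'rV[R]_n -> mcar;
  (* a preferred chart around each point *)
  chart_at : mcar -> cidx;
  cdom_chart_at : forall x, cdom (chart_at x) x;
  cdom_open : forall i, open (cdom i);
  cimg_open : forall i, open (chart i @` cdom i);
  chartK : forall i x, cdom i x -> chartV i (chart i x) = x;
  chart_cont : forall i x, cdom i x -> {for x, continuous (chart i)};
  chartV_cont : forall i p, (chart i @` cdom i) p ->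
    {for p, continuous (chartV i)};
  chart_smooth : forall i j (k : 'I_n),
    Cinf (chart i @` (cdom i `&` cdom j))
         (fun p => chart j (chartV i p) 0 k) }.

Section functions.
Variables (R : realType) (n : nat) (M : manifold R n).

Definition smooth_fun_on (A : set M) (f : M -> R) : Prop :=
  forall i, Cinf (chart i @` (A `&` cdom i)) (f \o chartV i).

(* The tangent space T_x M is 'rV[R]_n, identified with R^n by means of the
   preferred chart [chart_at x]. *)
Definition dfun (x : M) (v : 'rV[R]_n) (f : M -> R) : R :=
  'D_v (f \o chartV (chart_at x)) (chart (chart_at x) x).

Definition dscal (S : scalars R) (x : M) (v : 'rV[R]_n) (f : M -> S) : S :=
  sinj S (dfun x v (fun y => sre (f y))) +
  si S * sinj S (dfun x v (fun y => sim (f y))).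

End functions.

(* The data (without the axioms) of a vector bundle: the fibres, and local
   trivialisations [triv i] over [tdom i], with fibrewise inverse [trivV i];
   [tat x] is a preferred trivialisation around x.  The rank need not be
   constant. *)
Record vbdata (R : realType) (n : nat) (S : scalars R) (M : manifold R n) :=
  VBData {
  fib :> M -> vectType S;
  tidx : Type;
  tdom : tidx -> set M;
  trk : tidx -> nat;
  triv : forall (i : tidx) (x : M), fib x -> 'rV[S]_(trk i);
  trivV : forall (i : tidx) (x : M), 'rV[S]_(trk i) -> fib x;
  tat : M -> tidx }.

Arguments tdom {R n S M} E i : rename.
Arguments trk {R n S M} E i : rename.
Arguments triv {R n S M} E i x v : rename.
Arguments trivV {R n S M} E i x w : rename.

Definition section (R : realType) (n : nat) (S : scalars R) (M : manifold R n)
  (E : vbdata S M) : Type := forall x : M, E x.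

Section vector_bundles.
Variables (R : realType) (n : nat) (S : scalars R) (M : manifold R n).

Definition smooth_scal_on (A : set M) (f : M -> S) : Prop :=
  smooth_fun_on A (fun x => sre (f x)) /\ smooth_fun_on A (fun x => sim (f x)).

Record is_vector_bundle (E : vbdata S M) : Prop := {
  tdom_tat : forall x, tdom E (tat E x) x;
  tdom_open : forall i : tidx E, open (tdom E i);
  triv_linear : forall (i : tidx E) (x : M), tdom E i x ->
    linear (triv E i x);
  trivK : forall (i : tidx E) (x : M), tdom E i x ->
    cancel (triv E i x) (trivV E i x);
  trivVK : forall (i : tidx E) (x : M), tdom E i x ->
    cancel (trivV E i x) (triv E i x);
  triv_smooth : forall (i j : tidx E) (k : 'I_(trk E i)) (l : 'I_(trk E j)),
    smooth_scal_on (tdom E i `&` tdom E j)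
      (fun x => triv E j x (trivV E i x (delta_mx 0 k)) 0 l) }.

(* Meant for open A. *)
Definition smooth_on (E : vbdata S M) (A : set M) (s : section E) : Prop :=
  forall (i : tidx E) (k : 'I_(trk E i)),
    smooth_scal_on (A `&` tdom E i) (fun x => triv E i x (s x) 0 k).

Definition smooth (E : vbdata S M) (s : section E) : Prop := smooth_on setT s.

Definition smooth_near (E : vbdata S M) (x : M) (s : section E) : Prop :=
  exists A : set M, [/\ open A, A x & smooth_on A s].

(* The section through v which is constant in the preferred trivialisation
   around x (only its germ at x is meaningful). *)
Definition const_section (E : vbdata S M) (x : M) (v : E x) : section E :=
  fun y => trivV E (tat E x) y (triv E (tat E x) x v).

(* TM when S is R, and its complexification when S is R[i].  The components of
   tangent vectors in a chart i are obtained from those in the preferred chart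
   by the differential of the change of charts. *)
Definition tangent_vb : vbdata S M :=
  @VBData R n S M (fun=> 'rV[S]_n) (cidx M) (@cdom _ _ M) (fun=> n)
    (fun i x v =>
       v *m map_mx (sinj S) (jacobian (chart i \o chartV (chart_at x))
                                      (chart (chart_at x) x)))
    (fun i x w =>
       w *m map_mx (sinj S) (jacobian (chart (chart_at x) \o chartV i) (chart i x)))
    (@chart_at _ _ M).

Definition trivial_vb (N : nat) : vbdata S M :=
  @VBData R n S M (fun=> 'rV[S]_N) unit (fun=> setT) (fun=> N)
    (fun _ _ v => v) (fun _ _ v => v) (fun=> tt).

Definition hom_vb (E F : vbdata S M) : vbdata S M :=
  @VBData R n S M (fun x => 'Hom(E x, F x))
    (tidx E * tidx F)%type
    (fun ij => tdom E ij.1 `&` tdom F ij.2)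
    (fun ij => (trk E ij.1 * trk F ij.2)%N)
    (fun ij x (T : 'Hom(E x, F x)) =>
       mxvec (lin1_mx (fun u => triv F ij.2 x (T (trivV E ij.1 x u)))))
    (fun ij x w =>
       linfun (fun u : E x => trivV F ij.2 x (triv E ij.1 x u *m vec_mx w)))
    (fun x => (tat E x, tat F x)).

End vector_bundles.

(* A vector bundle together with the data of a fibre metric (linear in its
   first argument) and of a connection: [conn x v s] is the covariant
   derivative at x of the section s in the direction v of T_x M.  Connections
   act on arbitrary sections; only the values on sections smooth near x are
   meaningful, and only these are constrained below. *)
Record hbdata (R : realType) (n : nat) (S : scalars R) (M : manifold R n) :=
  HBData {
  hvb :> vbdata S M;
  herm : forall x : M, hvb x -> hvb x -> S;
  conn : forall x : M, 'rV[R]_n -> section hvb -> hvb x }.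

Arguments herm {R n S M E x} u v : rename.
Arguments conn {R n S M E} x v s : rename.

Section hermitian_bundles.
Variables (R : realType) (n : nat) (S : scalars R) (M : manifold R n).

Record is_hermitian (E : hbdata S M) : Prop := {
  herm_linear : forall (x : M) (a : S) (u v w : E x),
    herm (a *: u + v) w = a * herm u w + herm v w;
  herm_conj : forall (x : M) (u v : E x), herm v u = sconj (herm u v);
  herm_pos : forall (x : M) (u : E x), u != 0 -> 0 < sre (herm u u);
  herm_smooth : forall (A : set M) (s t : section E), open A ->
    smooth_on A s -> smooth_on A t ->
    smooth_scal_on A (fun x => herm (s x) (t x)) }.

Record is_metric_connection (E : hbdata S M) : Prop := {
  conn_local : forall (x : M) v (s t : section E), smooth_near x s ->
    (\forall y \near x, s y = t y) -> conn x v s = conn x v t;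
  conn_linearl : forall (x : M) (a : R) v w (s : section E), smooth_near x s ->
    conn x (a *: v + w) s = sinj S a *: conn x v s + conn x w s;
  conn_linearr : forall (x : M) (a : S) v (s t : section E),
    smooth_near x s -> smooth_near x t ->
    conn x v (fun y => a *: s y + t y) = a *: conn x v s + conn x v t;
  conn_leibniz : forall (x : M) v (f : M -> R) (s : section E) (A : set M),
    open A -> A x -> smooth_fun_on A f -> smooth_on A s ->
    conn x v (fun y => sinj S (f y) *: s y) =
      sinj S (dfun x v f) *: s x + sinj S (f x) *: conn x v s;
  conn_smooth : forall (A : set M)
      (X : section (tangent_vb (real_scalars R) M)) (s : section E), open A ->
    smooth_on A X -> smooth_on A s -> smooth_on A (fun x => conn x (X x) s);
  conn_metric : forall (x : M) v (s t : section E),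
    smooth_near x s -> smooth_near x t ->
    dscal x v (fun y => herm (s y) (t y)) =
      herm (conn x v s) (t x) + herm (s x) (conn x v t) }.

(* The inner product is tr (B^* A), the sum of <A e, B e> over an orthonormal
   basis; it is expressed in an arbitrary basis b with Gram matrix G. *)
Definition hom_herm (E F : hbdata S M) (x : M) (A B : 'Hom(E x, F x)) : S :=
  let d := \dim (fullv : {vspace E x}) in
  let b : d.-tuple (E x) := vbasis fullv in
  let G : 'M[S]_d := \matrix_(k, l) herm b`_k b`_l in
  \sum_(k < d) \sum_(l < d) invmx G l k * herm (A b`_k) (B b`_l).

(* (nabla_v A) u = nabla_v (A u) - A (nabla_v u), with u extended to a local
   section. *)
Definition hom_bundle (E F : hbdata S M) : hbdata S M :=
  @HBData R n S M (hom_vb E F) (@hom_herm E F)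
    (fun x v A => linfun (fun u : E x =>
       conn x v (fun y => (A y : 'Hom(E y, F y)) (const_section u y))
       - (A x : 'Hom(E x, F x)) (conn x v (const_section u)))).

Definition trivial_bundle (N : nat) : hbdata S M :=
  @HBData R n S M (trivial_vb S M N)
    (fun _ u v => \sum_k u 0 k * sconj (v 0 k))
    (fun x v s => \row_k dscal x v (fun y => (s y : 'rV[S]_N) 0 k)).

(* The tangent bundle with metric g (the Gram matrix in the basis of T_x M
   given by the preferred chart) and connection D, both extended from R to S. *)
Definition tangent_of (g : M -> 'M[R]_n)
    (D : M -> 'rV[R]_n -> (M -> 'rV[R]_n) -> 'rV[R]_n) : hbdata S M :=
  @HBData R n S M (tangent_vb S M)
    (fun x u v =>
       (u *m map_mx (sinj S) (g x) *m (map_mx (@sconj R S) v)^T) 0 0)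
    (fun x v X =>
       map_mx (sinj S) (D x v (fun y => map_mx (@sre R S) (X y)))
       + si S *: map_mx (sinj S) (D x v (fun y => map_mx (@sim R S) (X y)))).

End hermitian_bundles.

(* A Riemannian manifold with its Levi-Civita connection, the torsion-free
   metric connection on TM; torsion-freeness is
   (nabla_X Y - nabla_Y X) f = X (Y f) - Y (X f). *)
Record riemannian (R : realType) (n : nat) := Riemannian {
  rman :> manifold R n;
  gram : rman -> 'M[R]_n;
  levi_civita : rman -> 'rV[R]_n -> (rman -> 'rV[R]_n) -> 'rV[R]_n;
  rman_metric : is_hermitian (tangent_of (real_scalars R) gram levi_civita);
  rman_connection :
    is_metric_connection (tangent_of (real_scalars R) gram levi_civita);
  rman_torsion : forall (x : rman) (A : set rman)
      (X Y : section (tangent_vb (real_scalars R) rman)) (f : rman -> R),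
    open A -> A x -> smooth_on A X -> smooth_on A Y -> smooth_fun_on A f ->
    dfun x (levi_civita x (X x) Y - levi_civita x (Y x) X) f =
      dfun x (X x) (fun y => dfun y (Y y) f)
      - dfun x (Y x) (fun y => dfun y (X y) f) }.

Section bounded_geometry.
Variables (R : realType) (n : nat) (M : riemannian R n).

Definition tangent (S : scalars R) : hbdata S M :=
  tangent_of S (@gram R n M) (@levi_civita R n M).

Section scalar_field.
Variable S : scalars R.

(* T^*M (x) V, as the bundle of S-linear maps from TM (complexified when S is
   R[i]) to V *)
Definition cotensor (V : hbdata S M) : hbdata S M := hom_bundle (tangent S) V.

Definition cotensor_iter (k : nat) (V : hbdata S M) : hbdata S M :=
  iter k cotensor V.

Definition nabla (V : hbdata S M) (s : section V) : section (cotensor V) :=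
  fun x => linfun (fun v : 'rV[S]_n =>
    \sum_l v 0 l *: conn x (delta_mx 0 l) s).

Fixpoint nabla_iter (V : hbdata S M) (k : nat) (s : section V) :
    section (cotensor_iter k V) :=
  if k is k'.+1 then nabla (nabla_iter k' s) else s.

Definition bounded_section (V : hbdata S M) (s : section V) : Prop :=
  exists C : R, forall x, Num.sqrt (sre (herm (s x) (s x))) <= C.

Definition Cb_inf (V : hbdata S M) (s : section V) : Prop :=
  smooth s /\ forall k, bounded_section (nabla_iter k s).

End scalar_field.

Definition vector_field : Type := section (tangent (real_scalars R)).

Definition W_b (X : vector_field) : Prop := Cb_inf X.

Definition ffc_embedding (N : nat)
    (Phi : section (hom_bundle (tangent (real_scalars R))
                               (trivial_bundle (real_scalars R) M N))) : Prop :=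
  Cb_inf Phi /\
  forall (x : M) (u v : 'rV[R]_n),
    \sum_k (Phi x : 'Hom('rV[R]_n, 'rV[R]_N)) u 0 k
         * (Phi x : 'Hom('rV[R]_n, 'rV[R]_N)) v 0 k
    = (u *m gram x *m v^T) 0 0.

Definition FFC : Prop :=
  exists (N : nat) (Phi : section _), @ffc_embedding N Phi.

(* Z j is the image of the j-th basis vector under the transpose of an
   embedding Phi: g (Z j) v = <e_j, Phi v>. *)
Definition frechet_system (N : nat) (Z : 'I_N -> vector_field) : Prop :=
  exists Phi : section _, @ffc_embedding N Phi /\
    forall (j : 'I_N) (x : M) (v : 'rV[R]_n),
      ((Z j x : 'rV[R]_n) *m gram x *m v^T) 0 0
      = (Phi x : 'Hom('rV[R]_n, 'rV[R]_N)) v 0 j.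

Record hermitian_bundle := HermitianBundle {
  hb :> hbdata (complex_scalars R) M;
  hb_vb : is_vector_bundle hb;
  hb_herm : is_hermitian hb;
  hb_conn : is_metric_connection hb }.

Record csection (E : hermitian_bundle) := CSection {
  csec :> section E;
  csec_smooth : smooth csec;
  csec_compact : compact (closure [set x | csec x != 0]) }.

Definition operator (E F : hermitian_bundle) : Type := csection E -> csection F.

Definition Diff_b (mu : nat) (E F : hermitian_bundle) : set (operator E F) :=
  [set P : operator E F | exists a : forall j : nat, section (hom_bundle (cotensor_iter j E) F),
     (forall j, (j <= mu)%N -> Cb_inf (a j)) /\
     forall (u : csection E) (x : M),
       csec (P u) x = \sum_(j < mu.+1)
         (a j x : 'Hom(cotensor_iter j E x, F x)) (nabla_iter j (csec u) x)].

Definition nabla_dir (E : hermitian_bundle) (X : vector_field)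
  (s : section E) : section E := fun x => conn x (X x) s.

(* P is the operator a nabla_(X_0) ... nabla_(X_(r-1)). *)
Definition is_monomial (E F : hermitian_bundle) (r : nat)
    (a : section (hom_bundle E F)) (X : 'I_r -> vector_field)
    (P : operator E F) : Prop :=
  forall (u : csection E) (x : M),
    csec (P u) x = (a x : 'Hom(E x, F x))
      (foldr (fun i s => nabla_dir (X i) s) (csec u) (enum 'I_r) x).

Definition linear_span (E F : hermitian_bundle) (A : set (operator E F)) :
    set (operator E F) :=
  [set P : operator E F | exists (m : nat) (c : 'I_m -> R[i]) (Q : 'I_m -> operator E F),
     (forall i, A (Q i)) /\
     forall (u : csection E) (x : M), csec (P u) x = \sum_i c i *: csec (Q i u) x].

Definition mixed_Diff_b (mu : nat) (E F : hermitian_bundle) :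
    set (operator E F) :=
  linear_span [set P : operator E F | exists (r : nat) (a : section (hom_bundle E F))
                         (X : 'I_r -> vector_field),
    [/\ (r <= mu)%N, Cb_inf a, (forall i, W_b (X i)) & is_monomial a X P]].

End bounded_geometry.

(* Main.v *)
From HB Require Import structures.
Require Import Defs.
From mathcomp Require Import all_boot all_order all_algebra.
From mathcomp Require Import ring lra.
From mathcomp Require Import all_classical all_reals all_analysis.

Set Implicit Arguments.
Unset Strict Implicit.
Unset Printing Implicit Defensive.

Local Open Scope classical_set_scope.

(** All three claims come from moving coefficients across covariant derivatives
    with the Leibniz rule.

    (i) In a nabla_X1 ... nabla_Xr (b nabla_Y1 ... nabla_Ys), each nabla_X is
    pushed to the right by nabla_X (b w) = (nabla_X b) w + b (nabla_X w)
    ([monomial_sum_cov], [monomial_sum_comp]).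

    (ii) and (iii) The inclusions are proved in a cycle.  A monomial is a sum of
    operators a nabla^j, by induction on its length: nabla_X raises the order of
    such a sum by one, since nabla_X = ev_X o nabla where ev_X is evaluation of
    covectors at X, and a nabla_X w = nabla_X (a w) - (nabla_X a) w
    ([covs_jet_sum]).  Conversely, if Phi is the isometric embedding of the
    finiteness condition and Z_k = Phi^T e_k, then Phi^T Phi = id reads
    v = sum_k g(v, Z_k) Z_k, whence nabla w = sum_k Z_k^flat (x) nabla_(Z_k) w
    ([nabla_frechet]).  So a nabla^(j+1) is a sum of operators
    b nabla_(Z_k) nabla^j, with b = a o (Z_k^flat (x) -), and induction on j
    turns it into a sum of monomials in the Z_k ([nabla_iter_monomial_sum]).
    These fields lie in W_b ([frechet_W_b]), which closes the cycle.

    The analytic content is that the coefficients stay in C_b^infinity, and it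
    is concentrated in [Cb_inf_bil]: let B be a bilinear bundle map with
    nabla (B(s, t)) = B(nabla s, t) + B(s, nabla t) and
    |B(u, w)|^2 <= C |u|^2 |w|^2.  Then B(s, t) is in C_b^infinity whenever s
    and t are.  Indeed nabla (B(s, t)) is the sum of the extensions of B to
    covectors in the first and in the second argument, applied to (nabla s, t)
    and (s, nabla t); these extensions satisfy the same hypotheses with the same
    constant, so that induction on the order bounds all derivatives.  Everything
    needed is of this form: composition of homomorphisms, (X, s) |-> nabla_X s
    through the contraction of nabla s with X, (a, X) |-> a o ev_X,
    (a, Z) |-> a o (Z^flat (x) -), and (Phi, e) |-> Phi^T e.

    The rank of a bundle may be unbounded over M, and then the Hilbert-Schmidt
    norm of ev_X or of Z^flat (x) - is unbounded as well.  For this reason these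
    two maps occur only composed with a coefficient a, where Bessel's inequality
    and Parseval's identity give bounds independent of the rank. *)

Import Order.TTheory GRing.Theory Num.Theory.
Import numFieldNormedType.Exports.

(** * Smooth functions on open subsets of R^n *)

Section euclidean.
Local Open Scope ring_scope.
Variables (R : realType).

Lemma near_eq_differentiable (V W : normedModType R) (f g : V -> W) (x : V) :
  (\forall y \near x, f y = g y) -> differentiable f x -> differentiable g x.
Proof.
move=> fg /[dup] df /diff_locallyP[dfc dff].
have dfg : g \o shift x = cst (g x) + 'd f x +o_ 0 id.
  have nfg : \forall y \near 0, f (y + x) = g (y + x).
    by rewrite (near_shift x 0) sub0r; apply: filterS fg => z /=; rewrite addrNK.
  move/eqaddoP: dff => dff; apply/eqaddoP => e e0.
  apply: filterS2 nfg (dff e e0) => y /= fgy.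
  by rewrite -![(_ - _) y]/(_ y - _ y) /= -![(_ + _) y]/(_ y + _ y) /= fgy /cst (nbhs_singleton fg).
apply/diff_locallyP; rewrite (diff_unique dfc dfg); split => //.
Qed.

Variable n : nat.
Implicit Types (U V : set 'rV[R]_n) (f g : 'rV[R]_n -> R).

(** The conditions defining [Ck] are imposed point by point. *)
Lemma Ck_cover k U f :
  (forall x, U x -> exists V, V x /\ Ck k V f) -> Ck k U f.
Proof.
elim: k f => [|k IH] f h /=.
  by move=> x /h[V [Vx]]; apply.
split=> [x /h[V [Vx [+ _]]]|i]; first exact.
by apply: IH => x /h[V [Vx [_ DV]]]; exists V; split => //; exact: DV.
Qed.

Lemma Ck_sub k U V f : U `<=` V -> Ck k V f -> Ck k U f.
Proof. by move=> UV h; apply: Ck_cover => x /UV Vx; exists V. Qed.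

Lemma open_near_eq U f g x : open U -> U x -> {in U, f =1 g} ->
  \forall y \near x, f y = g y.
Proof.
move=> oU Ux fg; have : \near x, U x by exact: open_nbhs_nbhs.
by apply: filterS => y Uy; apply: fg; rewrite inE.
Qed.

Lemma Ck_ext k U f g : open U -> {in U, f =1 g} -> Ck k U f -> Ck k U g.
Proof.
move=> oU; elim: k f g => [|k IH] f g fg /=.
  move=> cf x Ux; have nfg := open_near_eq oU Ux fg.
  rewrite /prop_for /continuous_at -(nbhs_singleton nfg).
  apply: cvg_trans (cf x Ux).
  exact: (near_eq_cvg nfg).
move=> [df Df]; split=> [x Ux|i].
  apply: near_eq_differentiable (df x Ux); exact: open_near_eq oU Ux fg.
apply: IH (Df i) => x; rewrite inE => Ux.
by apply: near_eq_derive; apply: open_near_eq oU Ux fg.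
Qed.

Lemma CkS k U f : Ck k.+1 U f -> Ck k U f.
Proof.
elim: k f => [|k IH] f [df Df]; first by move=> x /df /differentiable_continuous.
by split=> // i; apply: IH; exact: Df.
Qed.

Lemma Ck_cst k U (c : R) : open U -> Ck k U (fun=> c).
Proof.
move=> oU; elim: k c => [|k IH] c /=; first by move=> x _; exact: (@cst_continuous _ _ c x).
split=> [x _|i]; first exact: differentiable_cst.
apply: Ck_ext (IH 0) => // x _.
by rewrite deriveE ?diff_cst//; exact: differentiable_cst.
Qed.

Lemma Ck_add k U f g : open U -> Ck k U f -> Ck k U g ->
  Ck k U (fun x => f x + g x).
Proof.
move=> oU; elim: k f g => [|k IH] f g /=.
  by move=> cf cg x Ux; exact: (cvgD (cf x Ux) (cg x Ux)).
move=> [df Df] [dg Dg]; split=> [x Ux|i].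
  by apply: differentiableD; [exact: df|exact: dg].
apply: Ck_ext (IH _ _ (Df i) (Dg i)) => // x; rewrite inE => Ux.
by rewrite deriveD //; apply: diff_derivable; [exact: df|exact: dg].
Qed.

Lemma Ck_mul k U f g : open U -> Ck k U f -> Ck k U g ->
  Ck k U (fun x => f x * g x).
Proof.
move=> oU; elim: k f g => [|k IH] f g.
  by move=> cf cg x Ux; exact: (cvgM (cf x Ux) (cg x Ux)).
move=> Cf Cg; have [Cf' Cg'] := (CkS Cf, CkS Cg).
case: Cf Cg => [df Df] [dg Dg]; split=> [x Ux|i].
  by apply: differentiableM; [exact: df|exact: dg].
have := Ck_add oU (IH _ _ Cf' (Dg i)) (IH _ _ Cg' (Df i)).
apply: Ck_ext => // x; rewrite inE => Ux.
by rewrite deriveM //; apply: diff_derivable; [exact: df|exact: dg].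
Qed.

Lemma Ck_inv k U f : open U -> (forall x, U x -> f x != 0) -> Ck k U f ->
  Ck k U (fun x => (f x)^-1).
Proof.
move=> oU f0; elim: k => [|k IH].
  by move=> cf x Ux; exact: (cvgV (f0 x Ux) (cf x Ux)).
move=> Cf; have Cf' := CkS Cf; case: Cf => df Df; split=> [x Ux|i].
  by apply: differentiableV; [exact: df|exact: f0].
have Cv := IH Cf'.
have := Ck_mul oU (Ck_mul oU (Ck_mul oU Cv Cv) (Df i)) (Ck_cst k (-1) oU).
apply: Ck_ext => // x; rewrite inE => Ux.
rewrite [RHS]deriveV ?f0//; last by apply: diff_derivable; exact: df.
by rewrite -[RHS]/(- _ * _) mulrN1 -invfM -expr2 -mulNr.
Qed.

Lemma Cinf_partial U f i : Cinf U f -> Cinf U (fun x => 'D_(delta_mx 0 i) f x).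
Proof. by move=> h k; have [_] := h k.+1; apply. Qed.

Lemma Cinf_differentiable U f x : Cinf U f -> U x -> differentiable f x.
Proof. by move=> /(_ 1%N)[df _] /df. Qed.

End euclidean.

(** * Real and complex scalars *)

Section scalars_theory.
Local Open Scope ring_scope.
Variables (R : realType) (S : scalars R).
Implicit Types (z w : S) (a b : R).

Lemma scal_eq z w : sre z = sre w -> sim z = sim w -> z = w.
Proof. by move=> e1 e2; rewrite [z]s_decomp [w]s_decomp e1 e2. Qed.

Lemma sre0 : sre (0 : S) = 0.
Proof. by rewrite -(rmorph0 (sinj S)) sre_inj. Qed.

Lemma sim0 : sim (0 : S) = 0.
Proof. by rewrite -(rmorph0 (sinj S)) sim_inj. Qed.

Lemma sreN z : sre (- z) = - sre z.
Proof. by apply/eqP; rewrite -addr_eq0 -sreD addNr sre0. Qed.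

Lemma simN z : sim (- z) = - sim z.
Proof. by apply/eqP; rewrite -addr_eq0 -simD addNr sim0. Qed.

Lemma sre_sum (I : Type) (r : seq I) (P : pred I) (F : I -> S) :
  sre (\sum_(i <- r | P i) F i) = \sum_(i <- r | P i) sre (F i).
Proof. exact: (big_morph _ (@sreD _ _) sre0). Qed.

Lemma sim_sum (I : Type) (r : seq I) (P : pred I) (F : I -> S) :
  sim (\sum_(i <- r | P i) F i) = \sum_(i <- r | P i) sim (F i).
Proof. exact: (big_morph _ (@simD _ _) sim0). Qed.

Lemma sre_injM a z : sre (sinj S a * z) = a * sre z.
Proof. by rewrite sreM sre_inj sim_inj mul0r subr0. Qed.

Lemma sim_injM a z : sim (sinj S a * z) = a * sim z.
Proof. by rewrite simM sre_inj sim_inj mul0r addr0. Qed.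

Lemma sre_siM a : sre (si S * sinj S a) = sre (si S) * a.
Proof. by rewrite mulrC sre_injM mulrC. Qed.

Lemma sim_siM a : sim (si S * sinj S a) = sim (si S) * a.
Proof. by rewrite mulrC sim_injM mulrC. Qed.

Lemma sre_si_sim z : sre (si S) * sim z = 0.
Proof.
have := congr1 (@sre R S) (s_decomp z); rewrite sreD sre_inj sre_siM.
by rewrite -[X in X = _]addr0 => /addrI <-.
Qed.

Lemma sim_si_sim z : sim (si S) * sim z = sim z.
Proof.
by have := congr1 (@sim R S) (s_decomp z); rewrite simD sim_inj sim_siM add0r.
Qed.

(** Applying re and im to the decomposition of z gives re(i) im(z) = 0 and
    im(i) im(z) = im(z), so that a single z with im(z) <> 0 determines i. *)
Lemma scal_real_or_complex :
  (forall z, sim z = 0) \/ (sre (si S) = 0 /\ sim (si S) = 1).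
Proof.
have [h|/existsNP[z /eqP z0]] := pselect (forall z, sim z = 0); first by left.
right; split.
  by apply: (mulIf z0); rewrite sre_si_sim mul0r.
by apply: (mulIf z0); rewrite sim_si_sim mul1r.
Qed.

Lemma sre_conj z : sre (sconj z) = sre z.
Proof. by rewrite /sconj sreD sreN sre_inj sre_siM sre_si_sim subr0. Qed.

Lemma sim_conj z : sim (sconj z) = - sim z.
Proof. by rewrite /sconj simD simN sim_inj sim_siM sim_si_sim add0r. Qed.

Lemma sconjD : {morph @sconj R S : z w / z + w}.
Proof.
move=> z w; apply: scal_eq; rewrite !(sreD, simD, sre_conj, sim_conj)//.
by rewrite opprD.
Qed.

Lemma sconjM : {morph @sconj R S : z w / z * w}.
Proof.
move=> z w; apply: scal_eq; rewrite !(sreM, simM, sre_conj, sim_conj).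
  by rewrite mulrNN.
by rewrite opprD mulrN mulNr.
Qed.

Lemma sconj_inj a : sconj (sinj S a) = sinj S a.
Proof.
by apply: scal_eq; rewrite !(sre_conj, sim_conj, sim_inj) ?oppr0.
Qed.

Lemma sconjK : involutive (@sconj R S).
Proof.
by move=> z; apply: scal_eq; rewrite !(sre_conj, sim_conj) ?opprK.
Qed.

Lemma sconj_zmod : zmod_morphism (@sconj R S).
Proof.
move=> z w; rewrite sconjD; congr (_ + _).
by apply: scal_eq; rewrite !(sreN, simN, sre_conj, sim_conj).
Qed.

Lemma sconj_monoid : monoid_morphism (@sconj R S).
Proof. by split; [rewrite -(rmorph1 (sinj S)) sconj_inj|exact: sconjM]. Qed.

HB.instance Definition _ := GRing.isZmodMorphism.Build S S (@sconj R S) sconj_zmod.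
HB.instance Definition _ := GRing.isMonoidMorphism.Build S S (@sconj R S) sconj_monoid.

Lemma mul_conj z : z * sconj z = sinj S (sre z ^+ 2 + sim z ^+ 2).
Proof.
apply: scal_eq; rewrite ?sreM ?simM sre_conj sim_conj ?sre_inj ?sim_inj.
  by rewrite mulrN opprK !expr2.
by rewrite mulrN [sim z * _]mulrC addNr.
Qed.

End scalars_theory.

(** * Smooth functions and derivations on a manifold *)

Section smooth_functions.
Local Open Scope ring_scope.
Variables (R : realType) (n : nat) (M : manifold R n).
Implicit Types (A B : set M) (f g : M -> R).

Lemma chart_img_open A i : open A -> open (chart i @` (A `&` cdom i)).
Proof.
move=> oA; rewrite openE => p [x [Ax dx] <-]; rewrite /interior.
have px : (chart i @` cdom i) (chart i x) by exists x.
have n1 : \forall q \near chart i x, (chart i @` cdom i) q.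
  by apply: open_nbhs_nbhs; split => //; exact: cimg_open.
have n2 : \forall q \near chart i x, A (chartV i q).
  apply: (chartV_cont px); rewrite chartK//; exact: open_nbhs_nbhs.
apply: filterS2 n1 n2 => q [y dy <-]; rewrite chartK// => Ay.
by exists y.
Qed.

Lemma smooth_fun_cover A f :
  (forall x, A x -> exists B, B x /\ smooth_fun_on B f) -> smooth_fun_on A f.
Proof.
move=> h i k; apply: Ck_cover => p [x [Ax dx] <-].
have [B [Bx sB]] := h x Ax.
by exists (chart i @` (B `&` cdom i)); split; [exists x|exact: sB].
Qed.

Lemma smooth_fun_sub A B f : A `<=` B -> smooth_fun_on B f -> smooth_fun_on A f.
Proof. by move=> AB h; apply: smooth_fun_cover => x /AB; exists B. Qed.

Lemma smooth_fun_ext A f g : open A -> (forall x, A x -> f x = g x) ->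
  smooth_fun_on A f -> smooth_fun_on A g.
Proof.
move=> oA fg sf i k; apply: Ck_ext (sf i k); first exact: chart_img_open.
by move=> p; rewrite inE => -[x [Ax dx] <-] /=; rewrite chartK// fg.
Qed.

Lemma smooth_fun_cst A (c : R) : open A -> smooth_fun_on A (fun=> c).
Proof. by move=> oA i k; apply: Ck_cst; exact: chart_img_open. Qed.

Lemma smooth_funD A f g : open A -> smooth_fun_on A f -> smooth_fun_on A g ->
  smooth_fun_on A (fun x => f x + g x).
Proof. by move=> oA sf sg i k; exact: (Ck_add (@chart_img_open A i oA) (sf i k) (sg i k)). Qed.

Lemma smooth_funM A f g : open A -> smooth_fun_on A f -> smooth_fun_on A g ->
  smooth_fun_on A (fun x => f x * g x).
Proof. by move=> oA sf sg i k; exact: (Ck_mul (@chart_img_open A i oA) (sf i k) (sg i k)). Qed.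

Lemma smooth_funN A f : open A -> smooth_fun_on A f ->
  smooth_fun_on A (fun x => - f x).
Proof.
move=> oA sf; apply: smooth_fun_ext (smooth_funM oA (smooth_fun_cst (-1) oA) sf) => //.
by move=> x _; rewrite mulN1r.
Qed.

Lemma smooth_funV A f : open A -> (forall x, A x -> f x != 0) ->
  smooth_fun_on A f -> smooth_fun_on A (fun x => (f x)^-1).
Proof.
move=> oA f0 sf i k; apply: (Ck_inv (@chart_img_open A i oA) _ (sf i k)).
by move=> p [x [Ax dx] <-] /=; rewrite chartK// f0.
Qed.

Lemma smooth_fun_diff A f x : smooth_fun_on A f -> open A -> A x ->
  differentiable (f \o chartV (chart_at x)) (chart (chart_at x) x).
Proof.
move=> sf oA Ax; apply: Cinf_differentiable (sf (chart_at x)) _.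
by exists x => //; split => //; exact: cdom_chart_at.
Qed.

Lemma dfun_near f g x v : (\forall y \near x, f y = g y) ->
  dfun x v f = dfun x v g.
Proof.
move=> fg; apply: near_eq_derive.
have dx := cdom_chart_at x.
have px : (chart (chart_at x) @` cdom (chart_at x)) (chart (chart_at x) x).
  by exists x.
by move: (chartV_cont px); rewrite /prop_for /continuous_at chartK// => /(_ _ fg).
Qed.

Lemma dfun_cst (x : M) v (c : R) : dfun x v (fun=> c) = 0.
Proof. by rewrite /dfun deriveE; [rewrite diff_cst|exact: differentiable_cst]. Qed.

Section at_point.
Variables (A : set M) (x : M).
Hypotheses (oA : open A) (Ax : A x).

Lemma dfunD v f g : smooth_fun_on A f -> smooth_fun_on A g ->
  dfun x v (fun y => f y + g y) = dfun x v f + dfun x v g.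
Proof.
move=> sf sg; rewrite /dfun -deriveD//; apply: diff_derivable.
  exact: smooth_fun_diff sf oA Ax.
exact: smooth_fun_diff sg oA Ax.
Qed.

Lemma dfunM v f g : smooth_fun_on A f -> smooth_fun_on A g ->
  dfun x v (fun y => f y * g y) = f x * dfun x v g + g x * dfun x v f.
Proof.
move=> sf sg.
have df := smooth_fun_diff sf oA Ax; have dg := smooth_fun_diff sg oA Ax.
have := deriveM (diff_derivable df (v := v)) (diff_derivable dg (v := v)).
by rewrite /= chartK; [exact|exact: cdom_chart_at].
Qed.

Lemma dfun_linear f a v w : smooth_fun_on A f ->
  dfun x (a *: v + w) f = a * dfun x v f + dfun x w f.
Proof.
move=> sf; have df := smooth_fun_diff sf oA Ax.
by rewrite /dfun !deriveE// linearP.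
Qed.

End at_point.
End smooth_functions.

Section smooth_scalars.
Local Open Scope ring_scope.
Variables (R : realType) (n : nat) (S : scalars R) (M : manifold R n).
Implicit Types (A B : set M) (f g : M -> S).

Lemma smooth_scal_cover A f :
  (forall x, A x -> exists B, B x /\ smooth_scal_on B f) -> smooth_scal_on A f.
Proof. by move=> h; split; apply: smooth_fun_cover => x /h[B [Bx []]]; exists B. Qed.

Lemma smooth_scal_sub A B f : A `<=` B -> smooth_scal_on B f -> smooth_scal_on A f.
Proof. by move=> AB h; apply: smooth_scal_cover => x /AB; exists B. Qed.

Lemma smooth_scal_ext A f g : open A -> (forall x, A x -> f x = g x) ->
  smooth_scal_on A f -> smooth_scal_on A g.
Proof.
move=> oA fg [sf1 sf2]; split; [apply: smooth_fun_ext sf1|apply: smooth_fun_ext sf2] => //;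
by move=> x /fg ->.
Qed.

Lemma smooth_scal_cst A (c : S) : open A -> smooth_scal_on A (fun=> c).
Proof. by move=> oA; split; exact: smooth_fun_cst. Qed.

Lemma smooth_scal_inj A (f : M -> R) : open A -> smooth_fun_on A f ->
  smooth_scal_on A (fun x => sinj S (f x)).
Proof.
move=> oA sf; split; first by apply: smooth_fun_ext sf => // x _; rewrite sre_inj.
by apply: smooth_fun_ext (smooth_fun_cst 0 oA) => // x _; rewrite sim_inj.
Qed.

Lemma smooth_scalD A f g : open A -> smooth_scal_on A f -> smooth_scal_on A g ->
  smooth_scal_on A (fun x => f x + g x).
Proof.
move=> oA [f1 f2] [g1 g2]; split.
  by apply: smooth_fun_ext (smooth_funD oA f1 g1) => // x _; rewrite sreD.
by apply: smooth_fun_ext (smooth_funD oA f2 g2) => // x _; rewrite simD.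
Qed.

Lemma smooth_scalM A f g : open A -> smooth_scal_on A f -> smooth_scal_on A g ->
  smooth_scal_on A (fun x => f x * g x).
Proof.
move=> oA [f1 f2] [g1 g2]; split.
  apply: smooth_fun_ext (smooth_funD oA (smooth_funM oA f1 g1)
    (smooth_funN oA (smooth_funM oA f2 g2))) => // x _; by rewrite sreM.
apply: smooth_fun_ext (smooth_funD oA (smooth_funM oA f1 g2)
    (smooth_funM oA f2 g1)) => // x _; by rewrite simM.
Qed.

Lemma smooth_scal_sum A (I : Type) (r : seq I) (F : I -> M -> S) : open A ->
  (forall i, smooth_scal_on A (F i)) ->
  smooth_scal_on A (fun x => \sum_(i <- r) F i x).
Proof.
move=> oA sF; elim: r => [|i r IH].
  by apply: smooth_scal_ext (smooth_scal_cst 0 oA) => // x _; rewrite big_nil.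
by apply: smooth_scal_ext (smooth_scalD oA (sF i) IH) => // x _; rewrite big_cons.
Qed.

Lemma smooth_scal_prod A (I : Type) (r : seq I) (F : I -> M -> S) : open A ->
  (forall i, smooth_scal_on A (F i)) ->
  smooth_scal_on A (fun x => \prod_(i <- r) F i x).
Proof.
move=> oA sF; elim: r => [|i r IH].
  by apply: smooth_scal_ext (smooth_scal_cst 1 oA) => // x _; rewrite big_nil.
by apply: smooth_scal_ext (smooth_scalM oA (sF i) IH) => // x _; rewrite big_cons.
Qed.

Lemma dscal_near f g x v : (\forall y \near x, f y = g y) ->
  dscal x v f = dscal x v g.
Proof.
move=> fg; congr (sinj S _ + si S * sinj S _); apply: dfun_near;
by apply: filterS fg => y ->.
Qed.

Lemma dscal_cst (x : M) v (c : S) : dscal x v (fun=> c) = 0.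
Proof. by rewrite /dscal !dfun_cst rmorph0 mulr0 addr0. Qed.

(** For real scalars [si S] is arbitrary, but then all imaginary parts vanish. *)
Lemma sre_dscal x v f : sre (dscal x v f) = dfun x v (fun y => sre (f y)).
Proof.
rewrite sreD sre_inj sre_siM.
have [h|[-> _]] := scal_real_or_complex S; last by rewrite mul0r addr0.
rewrite (_ : (fun y => sim (f y)) = fun=> 0); first by rewrite dfun_cst mulr0 addr0.
by apply/funext.
Qed.

Lemma sim_dscal x v f : sim (dscal x v f) = dfun x v (fun y => sim (f y)).
Proof.
rewrite simD sim_inj sim_siM add0r.
have [h|[_ ->]] := scal_real_or_complex S; last by rewrite mul1r.
rewrite (_ : (fun y => sim (f y)) = fun=> 0); first by rewrite dfun_cst mulr0.
by apply/funext.
Qed.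

Lemma dscal_inj x v (f : M -> R) :
  dscal x v (fun y => sinj S (f y)) = sinj S (dfun x v f).
Proof.
rewrite /dscal; under eq_fun do rewrite sre_inj.
under [X in _ + _ * sinj S (dfun _ _ X)]eq_fun do rewrite sim_inj.
by rewrite dfun_cst rmorph0 mulr0 addr0.
Qed.

Section at_point.
Variables (A : set M) (x : M).
Hypotheses (oA : open A) (Ax : A x).

Lemma dscalD v f g : smooth_scal_on A f -> smooth_scal_on A g ->
  dscal x v (fun y => f y + g y) = dscal x v f + dscal x v g.
Proof.
move=> [f1 f2] [g1 g2]; apply: scal_eq.
  rewrite [RHS]sreD !sre_dscal -(dfunD oA Ax)//; congr dfun; apply/funext => y.
  by rewrite sreD.
rewrite [RHS]simD !sim_dscal -(dfunD oA Ax)//; congr dfun; apply/funext => y.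
by rewrite simD.
Qed.

Lemma dscalM v f g : smooth_scal_on A f -> smooth_scal_on A g ->
  dscal x v (fun y => f y * g y) = f x * dscal x v g + g x * dscal x v f.
Proof.
move=> [f1 f2] [g1 g2].
have N1 : forall h : M -> R, (fun y => - h y) = (fun y => (-1) * h y).
  by move=> h; apply/funext => y; rewrite mulN1r.
apply: scal_eq.
  rewrite [RHS]sreD !sreM !sre_dscal !sim_dscal.
  have -> : (fun y => sre (f y * g y)) =
     (fun y => sre (f y) * sre (g y) + (-1) * (sim (f y) * sim (g y))).
    by apply/funext => y; rewrite sreM mulN1r.
  rewrite (dfunD oA Ax) ?(dfunM oA Ax) ?dfun_cst //.
  - by rewrite mulr0 addr0 mulN1r opprD addrACA.
  - exact: smooth_fun_cst.
  - exact: smooth_funM.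
  - exact: smooth_funM.
  - apply: smooth_funM => //; first exact: smooth_fun_cst.
    exact: smooth_funM.
rewrite [RHS]simD !simM !sre_dscal !sim_dscal.
have -> : (fun y => sim (f y * g y)) =
   (fun y => sre (f y) * sim (g y) + sim (f y) * sre (g y)).
  by apply/funext => y; rewrite simM.
rewrite (dfunD oA Ax) ?(dfunM oA Ax) //; try exact: smooth_funM.
by rewrite addrACA [X in _ = _ + X]addrC addrACA.
Qed.

Lemma dscal_linear f (a : R) v w : smooth_scal_on A f ->
  dscal x (a *: v + w) f = sinj S a * dscal x v f + dscal x w f.
Proof.
move=> [f1 f2]; apply: scal_eq.
  by rewrite [RHS]sreD sre_injM !sre_dscal (dfun_linear oA Ax).
by rewrite [RHS]simD sim_injM !sim_dscal (dfun_linear oA Ax).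
Qed.

Lemma dscal_sum v (I : Type) (r : seq I) (F : I -> M -> S) :
  (forall i, smooth_scal_on A (F i)) ->
  dscal x v (fun y => \sum_(i <- r) F i y) = \sum_(i <- r) dscal x v (F i).
Proof.
move=> sF; elim: r => [|i r IH].
  by under eq_fun do rewrite big_nil; rewrite big_nil dscal_cst.
under eq_fun do rewrite big_cons.
by rewrite big_cons dscalD ?IH//; exact: smooth_scal_sum.
Qed.

End at_point.
End smooth_scalars.

(** * Smooth sections and local frames *)

Section bundles.
Local Open Scope ring_scope.
Variables (R : realType) (n : nat) (S : scalars R) (M : manifold R n).
Variables (E : vbdata S M) (hE : is_vector_bundle E).
Implicit Types (A B : set M) (s t : section E).

Section on_domain.
Variables (i : tidx E) (x : M).
Hypothesis dx : tdom E i x.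

Lemma trivD u v : triv E i x (u + v) = triv E i x u + triv E i x v.
Proof. by have := triv_linear hE dx 1 u v; rewrite !scale1r. Qed.

Lemma triv0 : triv E i x 0 = 0.
Proof. by apply: (addrI (triv E i x 0)); rewrite -trivD !addr0. Qed.

Lemma trivZ a u : triv E i x (a *: u) = a *: triv E i x u.
Proof. by have := triv_linear hE dx a u 0; rewrite triv0 !addr0. Qed.

Lemma trivV_linear : linear (trivV E i x).
Proof.
move=> a u v; apply: (can_inj (trivK hE dx)).
by rewrite (triv_linear hE dx) !(trivVK hE dx).
Qed.

Lemma trivVD u v : trivV E i x (u + v) = trivV E i x u + trivV E i x v.
Proof. by have := trivV_linear 1 u v; rewrite !scale1r. Qed.

Lemma trivV0 : trivV E i x 0 = 0.
Proof. by apply: (addrI (trivV E i x 0)); rewrite -trivVD !addr0. Qed.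

Lemma trivVZ a u : trivV E i x (a *: u) = a *: trivV E i x u.
Proof. by have := trivV_linear a u 0; rewrite trivV0 !addr0. Qed.

Lemma trivV_sum (I : Type) (r : seq I) (F : I -> 'rV[S]_(trk E i)) :
  trivV E i x (\sum_(j <- r) F j) = \sum_(j <- r) trivV E i x (F j).
Proof. exact: (big_morph _ trivVD trivV0). Qed.

End on_domain.

Definition frame (i : tidx E) (k : 'I_(trk E i)) : section E :=
  fun x => trivV E i x (delta_mx 0 k).

Lemma frame_decomp i x (v : E x) : tdom E i x ->
  v = \sum_k triv E i x v 0 k *: frame k x.
Proof.
move=> dx; rewrite -{1}(trivK hE dx v) {1}[triv E i x v]row_sum_delta.
by rewrite trivV_sum//; apply: eq_bigr => k _; rewrite trivVZ.
Qed.

Lemma smooth_cover A s :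
  (forall x, A x -> exists B, B x /\ smooth_on B s) -> smooth_on A s.
Proof.
move=> h i k; apply: smooth_scal_cover => x [/h[B [Bx sB]] dx].
by exists (B `&` tdom E i); split => //; exact: sB.
Qed.

Lemma smooth_sub A B s : A `<=` B -> smooth_on B s -> smooth_on A s.
Proof. by move=> AB h; apply: smooth_cover => x /AB; exists B. Qed.

Lemma opentd A i : open A -> open (A `&` tdom E i).
Proof. by move=> oA; apply: openI => //; exact: (tdom_open hE). Qed.

Lemma smooth_ext A s t : open A -> (forall x, A x -> s x = t x) ->
  smooth_on A s -> smooth_on A t.
Proof.
move=> oA st hs i k; apply: smooth_scal_ext (hs i k); first exact: opentd.
by move=> x [/st -> _].
Qed.

Lemma smoothD A s t : open A -> smooth_on A s -> smooth_on A t ->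
  smooth_on A (fun x => s x + t x).
Proof.
move=> oA hs ht i k; have oAi := @opentd A i oA.
apply: smooth_scal_ext (smooth_scalD oAi (hs i k) (ht i k)) => //.
by move=> x [_ dx]; rewrite trivD// mxE.
Qed.

Lemma smoothZ A (f : M -> S) s : open A -> smooth_scal_on A f -> smooth_on A s ->
  smooth_on A (fun x => f x *: s x).
Proof.
move=> oA hf hs i k; have oAi := @opentd A i oA.
have hf' : smooth_scal_on (A `&` tdom E i) f by apply: smooth_scal_sub hf => x [].
apply: smooth_scal_ext (smooth_scalM oAi hf' (hs i k)) => //.
by move=> x [_ dx]; rewrite trivZ// mxE.
Qed.

Lemma smoothZc A (c : S) s : open A -> smooth_on A s ->
  smooth_on A (fun x => c *: s x).
Proof. by move=> oA hs; apply: smoothZ => //; exact: smooth_scal_cst. Qed.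

Lemma smooth0 A : open A -> smooth_on A (fun x => 0 : E x).
Proof.
move=> oA i k; apply: smooth_scal_ext (smooth_scal_cst 0 (@opentd A i oA)).
  exact: opentd.
by move=> x [_ dx]; rewrite triv0// mxE.
Qed.

Lemma smooth_sum A (I : Type) (r : seq I) (F : I -> section E) : open A ->
  (forall i, smooth_on A (F i)) ->
  smooth_on A (fun x => \sum_(i <- r) F i x).
Proof.
move=> oA sF; elim: r => [|i r IH].
  by apply: smooth_ext (smooth0 oA) => // x _; rewrite big_nil.
by apply: smooth_ext (smoothD oA (sF i) IH) => // x _; rewrite big_cons.
Qed.

Lemma smoothB A s t : open A -> smooth_on A s -> smooth_on A t ->
  smooth_on A (fun x => s x - t x).
Proof.
move=> oA hs ht; apply: smooth_ext (smoothD oA hs (smoothZc (-1) oA ht)) => //.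
by move=> x _; rewrite scaleN1r.
Qed.

Lemma smooth_frame i (k : 'I_(trk E i)) : smooth_on (tdom E i) (frame k).
Proof. by move=> j l; exact: (triv_smooth hE). Qed.

Lemma smooth_nearI A s x : open A -> A x -> smooth_on A s -> smooth_near x s.
Proof. by move=> *; exists A. Qed.

Lemma smooth_near_eq s t x : (\forall y \near x, s y = t y) ->
  smooth_near x s -> smooth_near x t.
Proof.
move=> st0 [A [oA Ax sA]].
have [B [oB Bx] st] : exists2 B, open_nbhs x B & B `<=` [set y | s y = t y].
  by have : nbhs x [set y | s y = t y] by []; rewrite nbhsE.
exists (A `&` B); split => //; first exact: openI.
have AB : A `&` B `<=` A by move=> y [].
apply: smooth_ext (smooth_sub AB sA) => //; first exact: openI.
by move=> y [_ /st].
Qed.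

Lemma const_sectionE x (v : E x) : const_section v x = v.
Proof. by rewrite /const_section trivK//; exact: (tdom_tat hE). Qed.

Lemma const_section_frame x (v : E x) y : tdom E (tat E x) y ->
  const_section v y = \sum_k triv E (tat E x) x v 0 k *: frame k y.
Proof.
move=> dy; rewrite /const_section {1}[triv _ _ _ v]row_sum_delta.
by rewrite trivV_sum//; apply: eq_bigr => k _; rewrite trivVZ.
Qed.

Lemma smooth_const_section x (v : E x) :
  smooth_on (tdom E (tat E x)) (const_section v).
Proof.
have oT := tdom_open hE (tat E x).
apply: smooth_ext (smooth_sum (index_enum _)
  (F := fun k y => triv E (tat E x) x v 0 k *: frame k y) oT _) => //.
  by move=> y dy; rewrite const_section_frame.
by move=> k; apply: smoothZc => //; exact: smooth_frame.
Qed.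

Lemma smooth_near_const x (v : E x) : smooth_near x (const_section v).
Proof.
apply: smooth_nearI (smooth_const_section v); first exact: (tdom_open hE).
exact: (tdom_tat hE).
Qed.

End bundles.

Lemma smooth_near2 (R : realType) (n : nat) (S S' : scalars R) (M : manifold R n)
    (E : vbdata S M) (E' : vbdata S' M) (s : section E) (t : section E') (x : M) :
  smooth_near x s -> smooth_near x t ->
  exists A, [/\ open A, A x, smooth_on A s & smooth_on A t].
Proof.
move=> [A [oA Ax sA]] [B [oB Bx sB]]; exists (A `&` B); split => //.
- exact: openI.
- by apply: smooth_sub sA => y [].
- by apply: smooth_sub sB => y [].
Qed.

(** * Inner products and Hilbert-Schmidt norms *)

Record is_ip (R : realType) (S : scalars R) (V : vectType S) (h : V -> V -> S) : Prop := {
  ip_linear : forall a u v w, h (a *: u + v)%R w = (a * h u w + h v w)%R;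
  ip_conj : forall u v, h v u = sconj (h u v);
  ip_pos : forall u, u != 0%R -> (0 < sre (h u u))%R }.

Section inner_products.
Local Open Scope ring_scope.
Variables (R : realType) (S : scalars R) (V : vectType S) (h : V -> V -> S).
Hypothesis hh : is_ip h.
Implicit Types (u v w : V).

Definition orthonormal_family (I : finType) (e : I -> V) : Prop :=
  forall i j, h (e i) (e j) = (i == j)%:R.

Definition onb (I : finType) (e : I -> V) : Prop :=
  orthonormal_family e /\ forall v, v = \sum_i h v (e i) *: e i.

Lemma ipDl u v w : h (u + v) w = h u w + h v w.
Proof. by have := ip_linear hh 1 u v w; rewrite scale1r mul1r. Qed.

Lemma ip0l w : h 0 w = 0.
Proof. by apply: (addrI (h 0 w)); rewrite -ipDl !addr0. Qed.

Lemma ipZl a u w : h (a *: u) w = a * h u w.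
Proof. by have := ip_linear hh a u 0 w; rewrite ip0l !addr0. Qed.

Lemma ipDr u v w : h w (u + v) = h w u + h w v.
Proof. by rewrite ip_conj // ipDl sconjD -!ip_conj. Qed.

Lemma ip0r w : h w 0 = 0.
Proof. by apply: (addrI (h w 0)); rewrite -ipDr !addr0. Qed.

Lemma ipZr a u w : h w (a *: u) = sconj a * h w u.
Proof. by rewrite ip_conj // ipZl sconjM -ip_conj. Qed.

Lemma ip_suml (I : Type) (r : seq I) (F : I -> V) w :
  h (\sum_(i <- r) F i) w = \sum_(i <- r) h (F i) w.
Proof. exact: (big_morph (h^~ w) (fun u v => ipDl u v w) (ip0l w)). Qed.

Lemma ip_sumr (I : Type) (r : seq I) (F : I -> V) w :
  h w (\sum_(i <- r) F i) = \sum_(i <- r) h w (F i).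
Proof. exact: (big_morph (h w) (fun u v => ipDr u v w) (ip0r w)). Qed.

Lemma ip_sim u : sim (h u u) = 0.
Proof.
have := congr1 (@sim R S) (ip_conj hh u u); rewrite sim_conj => /eqP.
by rewrite -addr_eq0 -mulr2n mulrn_eq0 => /eqP.
Qed.

Lemma ip_real u : h u u = sinj S (sre (h u u)).
Proof. by apply: scal_eq; rewrite ?sre_inj// sim_inj ip_sim. Qed.

Lemma ip_ge0 u : 0 <= sre (h u u).
Proof.
have [->|u0] := eqVneq u 0; first by rewrite ip0l sre0.
exact/ltW/(ip_pos hh).
Qed.

Lemma ip_eq0 u : sre (h u u) = 0 -> u = 0.
Proof. by move=> u0; apply/eqP/negP => /negP /(ip_pos hh); rewrite u0 ltxx. Qed.

Lemma ip_parallelogram u v :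
  sre (h (u + v) (u + v)) <= 2 * sre (h u u) + 2 * sre (h v v).
Proof.
have := ip_ge0 (u - v); rewrite -scaleN1r !(ipDl, ipDr, ipZl, ipZr) rmorphN rmorph1.
by rewrite !(mulN1r, sreD, sreN) => ?; lra.
Qed.

Lemma ip_normZ a u :
  sre (h (a *: u) (a *: u)) = (sre a ^+ 2 + sim a ^+ 2) * sre (h u u).
Proof. by rewrite ipZl ipZr mulrA mul_conj sre_injM. Qed.

Lemma orthonormal_coord (I : finType) (e : I -> V) (a : I -> S) j :
  orthonormal_family e -> h (\sum_i a i *: e i) (e j) = a j.
Proof.
move=> eo; rewrite ip_suml (bigD1 j)//= ipZl eo eqxx mulr1.
rewrite big1 ?addr0// => i /negbTE ij.
by rewrite ipZl eo ij mulr0.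
Qed.

Lemma orthonormal_card (I : finType) (e : I -> V) :
  orthonormal_family e -> (#|I| <= \dim {: V})%N.
Proof.
move=> eo; pose X := [tuple e (enum_val i) | i < #|I|].
have Xi (i : 'I_#|I|) : X`_i = e (enum_val i) by rewrite -tnth_nth tnth_mktuple.
have Xf : free X.
  apply/freeP => k k0 i.
  have := congr1 (h^~ (e (enum_val i))) k0; rewrite ip0l ip_suml (bigD1 i)//=.
  rewrite big1 => [|j ji]; first by rewrite ipZl Xi eo eqxx mulr1 addr0.
  by rewrite ipZl Xi eo (inj_eq enum_val_inj) (negbTE ji) mulr0.
have /eqP := Xf; rewrite size_tuple => <-; exact/dimvS/subvf.
Qed.

Lemma ip_normalize u : u != 0 ->
  h (sinj S (Num.sqrt (sre (h u u)))^-1 *: u) (sinj S (Num.sqrt (sre (h u u)))^-1 *: u) = 1.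
Proof.
move=> u0; have p := ip_pos hh u0.
rewrite ip_real ip_normZ sre_inj sim_inj expr0n addr0 exprVn sqr_sqrtr ?ltW//.
by rewrite mulVf ?rmorph1// gt_eqF.
Qed.

(** Gram-Schmidt: as long as the family does not span, the normalised component
    of some vector orthogonal to it can be added. *)
Lemma onb_extend (I : finType) (e : I -> V) : orthonormal_family e ->
  exists (J : finType) (f : J -> V) (t : I -> J),
    [/\ onb f, injective t & forall i, f (t i) = e i].
Proof.
have [m] := ubnP (\dim {: V} - #|I|)%N.
elim: m I e => // m IH I e mI eo.
have [sp|/existsNP[v vN]] := pselect (forall v, v = \sum_i h v (e i) *: e i).
  by exists I, e, id; split => //; split.
pose w := v - \sum_i h v (e i) *: e i.
have w0 : w != 0 by rewrite subr_eq0; apply/eqP.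
have we i : h w (e i) = 0.
  by rewrite ipDl -scaleN1r ipZl orthonormal_coord// mulN1r subrr.
have ew i : h (e i) w = 0 by rewrite ip_conj// we rmorph0.
pose e' (o : option I) := if o is Some i then e i
  else sinj S (Num.sqrt (sre (h w w)))^-1 *: w.
have eo' : orthonormal_family e'.
  move=> [i|] [j|]; rewrite /e' /= ?ip_normalize//.
  - by rewrite ipZr ew mulr0.
  - by rewrite ipZl we mulr0.
have := orthonormal_card eo'; rewrite card_option => cI.
have [|J [f [t [fo ti ft]]]] := IH _ e' _ eo'.
  rewrite card_option; move: mI; rewrite ltnS => mI.
  by apply: leq_trans mI; rewrite ltn_sub2l.
exists J, f, (t \o Some); split => //; first by move=> i j /ti [].
by move=> i; rewrite /= ft.
Qed.

Lemma onb_exists : exists (J : finType) (f : J -> V), onb f.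
Proof.
have [|J [f [_ [fo _ _]]]] := @onb_extend void (fun z : void => match z return V with end).
  by case.
by exists J, f.
Qed.

End inner_products.

Section hilbert_schmidt.
Local Open Scope ring_scope.
Variables (R : realType) (n : nat) (S : scalars R) (M : manifold R n).
Variables (E F : hbdata S M) (x : M).
Hypotheses (hE : is_ip (@herm _ _ _ _ E x)) (hF : is_ip (@herm _ _ _ _ F x)).
Implicit Types A B : 'Hom(E x, F x).

(** Let C be the matrix of the products of the basis b with the family e, and m
    the matrix of the coordinates of e in b.  Then m C = 1 and C m = 1, so the
    Gram matrix G = C C^* has the inverse m^* m, and summing against it replaces
    b by e. *)
Lemma hom_hermE (I : finType) (e : I -> E x) A B :
  onb (@herm _ _ _ _ E x) e ->
  hom_herm A B = \sum_i herm (A (e i)) (B (e i)).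
Proof.
move=> [eo esp]; rewrite /hom_herm.
set d := \dim _; set b := vbasis _; set G := \matrix_(_, _) _.
have bf : free b by have := vbasisP (fullv : {vspace E x}) => /basis_free.
pose c (k : 'I_d) i : S := herm b`_k (e i).
pose m i (k : 'I_d) : S := coord b k (e i).
have em i : e i = \sum_k m i k *: b`_k by rewrite -coord_vbasis ?memvf.
have mc i j : \sum_k m i k * c k j = (i == j)%:R.
  rewrite -eo [in RHS](em i) (ip_suml hE); apply: eq_bigr => k _.
  by rewrite (ipZl hE).
have cm k l : \sum_i c k i * m i l = (k == l)%:R.
  have : coord b l b`_k = (k == l)%:R by rewrite coord_free// eq_sym.
  move=> <-; rewrite [in RHS](esp b`_k) linear_sum; apply: eq_bigr => i _.
  by rewrite linearZ.
have Gc k l : G k l = \sum_i c k i * sconj (c l i).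
  rewrite mxE [in LHS](esp b`_k) (ip_suml hE); apply: eq_bigr => i _.
  by rewrite (ipZl hE) -(ip_conj hE).
pose P : 'M[S]_d := \matrix_(l, k) \sum_j sconj (m j l) * m j k.
have GP : G *m P = 1%:M.
  apply/matrixP => k k'; rewrite !mxE -cm.
  under eq_bigr do rewrite Gc mxE mulr_suml.
  rewrite exchange_big /=; apply: eq_bigr => i _.
  transitivity (\sum_j c k i * (m j k' * sconj (\sum_l m j l * c l i))).
    under eq_bigr do rewrite mulr_sumr.
    rewrite exchange_big /=; apply: eq_bigr => j _.
    rewrite rmorph_sum /= !mulr_sumr; apply: eq_bigr => l _.
    rewrite rmorphM /= -!mulrA; congr (_ * _).
    by rewrite mulrCA [RHS]mulrC -mulrA mulrCA.
  rewrite (bigD1 i)//= mc eqxx rmorph1 mulr1 big1 ?addr0// => j /negbTE ji.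
  by rewrite mc ji rmorph0 !mulr0.
have GI : invmx G = P.
  by have [Gu _] := mulmx1_unit GP; rewrite -[LHS]mulmx1 -GP mulKmx.
transitivity (\sum_i \sum_k \sum_l m i k * sconj (m i l) * herm (A b`_k) (B b`_l)).
  rewrite GI exchange_big /=.
  rewrite [RHS]exchange_big /=; rewrite exchange_big /=.
  apply: eq_bigr => k _; rewrite [RHS]exchange_big /=; apply: eq_bigr => l _.
  rewrite mxE mulr_suml; apply: eq_bigr => i _.
  by rewrite [sconj _ * _]mulrC.
apply: eq_bigr => i _; rewrite [in RHS](em i) !linear_sum (ip_suml hF).
apply: eq_bigr => k _; rewrite (ip_sumr hF); apply: eq_bigr => l _.
by rewrite !linearZ (ipZl hF) (ipZr hF) mulrA.
Qed.

Lemma hom_ip : is_ip (@hom_herm _ _ _ _ E F x).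
Proof.
have [I [e eb]] := onb_exists hE; split=> [a A B C|A B|A A0].
- rewrite !(hom_hermE _ _ eb) mulr_sumr -big_split /=; apply: eq_bigr => i _.
  by rewrite !lfunE /= !lfunE /= (ip_linear hF).
- rewrite !(hom_hermE _ _ eb) rmorph_sum; apply: eq_bigr => i _.
  exact: (ip_conj hF).
rewrite (hom_hermE _ _ eb) sre_sum lt_neqAle sumr_ge0 ?andbT; last first.
  by move=> i _; exact: (ip_ge0 hF).
apply: contra_neq A0 => /esym /eqP; rewrite psumr_eq0; last first.
  by move=> i _; exact: (ip_ge0 hF).
move=> /allP A0; apply/lfunP => v; rewrite lfunE /= (eb.2 v) linear_sum big1// => i _.
have /= /eqP /(ip_eq0 hF) Ae := A0 i (mem_index_enum _).
by rewrite linearZ /= Ae scaler0.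
Qed.

(** The family extends to an orthonormal basis, over which the squared norm of A
    is a sum of squares. *)
Lemma hom_bessel (I : finType) (e : I -> E x) A :
  orthonormal_family (@herm _ _ _ _ E x) e ->
  \sum_i sre (herm (A (e i)) (A (e i))) <= sre (hom_herm A A).
Proof.
move=> /(onb_extend hE)[J [f [t [fb ti ft]]]].
rewrite (hom_hermE _ _ fb) sre_sum.
under eq_bigr do rewrite -ft.
rewrite -(big_imset (fun j => sre (herm (A (f j)) (A (f j))))) /=; last by move=> i j _ _ /ti.
rewrite [leRHS](bigID (mem (t @: I))) /= lerDl sumr_ge0// => i _.
exact: (ip_ge0 hF).
Qed.

(** Bessel's inequality for the one-element family v / |v|. *)
Lemma hom_apply_bound A v :
  sre (herm (A v) (A v)) <= sre (hom_herm A A) * sre (herm v v).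
Proof.
have [->|v0] := eqVneq v 0.
  by rewrite linear0 (ip0l hF) (ip0l hE) sre0 mulr0.
have p := ip_pos hE v0; set c := (Num.sqrt (sre (herm v v)))^-1.
have := @hom_bessel unit (fun=> sinj S c *: v) A.
rewrite (big_pred1 tt); last by case.
rewrite linearZ /= (ip_normZ hF) sre_inj sim_inj expr0n addr0 exprVn (sqr_sqrtr (ltW p)).
rewrite ler_pdivrMl// [leRHS]mulrC; apply=> -[] [].
exact: (ip_normalize hE).
Qed.

End hilbert_schmidt.

Lemma section_ext (R : realType) (n : nat) (S : scalars R) (M : manifold R n)
  (E : vbdata S M) (s t : section E) : (forall x, s x = t x) -> s = t.
Proof. exact: functional_extensionality_dep. Qed.

(** * Bundles with connection, and their Hom bundles *)

Section linear_functions.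
Local Open Scope ring_scope.

Lemma linfunE (K : fieldType) (U V : vectType K) (f : U -> V) u :
  linear f -> linfun f u = f u.
Proof.
move=> lf; pose fM := GRing.isLinear.Build _ _ _ _ _ lf.
pose fL : {linear U -> V} := HB.pack f fM.
by rewrite (lfunE fL).
Qed.

Lemma mul_lin1_mx (K : fieldType) p q (f : 'rV[K]_p -> 'rV[K]_q) u :
  linear f -> u *m lin1_mx f = f u.
Proof.
move=> lf; pose fM := GRing.isLinear.Build _ _ _ _ _ lf.
pose fL : {linear 'rV[K]_p -> 'rV[K]_q} := HB.pack f fM.
by rewrite (mul_rV_lin1 fL).
Qed.

End linear_functions.

(** The class of bundles to which the calculus applies.  It contains the given
    bundles, the (complexified) tangent bundle and the bundles M x R^N, and is
    closed under Hom, hence contains all the bundles in which iterated covariant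
    derivatives live.  Metric connections are called upon for TM and M x R^N only. *)
Record good_bundle (R : realType) (n : nat) (S : scalars R) (M : manifold R n)
    (E : hbdata S M) : Prop := {
  good_vb :> is_vector_bundle E;
  good_ip : forall x, is_ip (@herm _ _ _ _ E x);
  good_local : forall (x : M) v (s t : section E), smooth_near x s ->
    (\forall y \near x, s y = t y) -> conn x v s = conn x v t;
  good_linearl : forall (x : M) (a : R) v w (s : section E), smooth_near x s ->
    (conn x (a *: v + w) s = sinj S a *: conn x v s + conn x w s)%R;
  good_linearr : forall (x : M) (a : S) v (s t : section E),
    smooth_near x s -> smooth_near x t ->
    (conn x v (fun y => a *: s y + t y) = a *: conn x v s + conn x v t)%R;
  good_leibniz : forall (x : M) v (f : M -> R) (s : section E) (A : set M),
    open A -> A x -> smooth_fun_on A f -> smooth_on A s ->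
    (conn x v (fun y => sinj S (f y) *: s y) =
      sinj S (dfun x v f) *: s x + sinj S (f x) *: conn x v s)%R;
  good_smooth : forall (A : set M)
      (X : section (tangent_vb (real_scalars R) M)) (s : section E), open A ->
    smooth_on A X -> smooth_on A s -> smooth_on A (fun x => conn x (X x) s) }.

Section good_theory.
Local Open Scope ring_scope.
Variables (R : realType) (n : nat) (S : scalars R) (M : manifold R n).
Variables (E : hbdata S M) (hE : good_bundle E).
Implicit Types (s t : section E) (x : M).

Lemma connD x v s t : smooth_near x s -> smooth_near x t ->
  conn x v (fun y => s y + t y) = conn x v s + conn x v t.
Proof.
move=> hs ht; have := good_linearr hE 1 v hs ht; rewrite scale1r => <-; congr conn.
by apply: section_ext => y; rewrite scale1r.
Qed.

Lemma smooth_near0 x : smooth_near x (fun y => 0 : E y).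
Proof.
by apply: (@smooth_nearI _ _ _ _ _ setT) => //; [exact: openT|apply: (smooth0 hE openT)].
Qed.

Lemma conn0 x v : conn x v (fun y => 0 : E y) = 0.
Proof.
have := connD v (smooth_near0 x) (smooth_near0 x).
rewrite (_ : (fun y => 0 + 0) = (fun y => 0 : E y)); last first.
  by apply: section_ext => y; rewrite addr0.
by rewrite -[X in X = _]addr0 => /addrI.
Qed.

Lemma connZ x v (a : S) s : smooth_near x s ->
  conn x v (fun y => a *: s y) = a *: conn x v s.
Proof.
move=> hs; have := good_linearr hE a v hs (smooth_near0 x); rewrite conn0 addr0 => <-.
by congr conn; apply: section_ext => y; rewrite addr0.
Qed.

Section at_point.
Variables (A : set M) (x : M).
Hypotheses (oA : open A) (Ax : A x).

Let near_of s : smooth_on A s -> smooth_near x s.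
Proof. by move=> sA; exists A. Qed.

Lemma conn_sum v (I : Type) (r : seq I) (F : I -> section E) :
  (forall i, smooth_on A (F i)) ->
  conn x v (fun y => \sum_(i <- r) F i y) = \sum_(i <- r) conn x v (F i).
Proof.
move=> sF; elim: r => [|i r IH].
  rewrite big_nil -[RHS](conn0 x v); congr conn.
  by apply: section_ext => y; rewrite big_nil.
rewrite big_cons -IH -connD; last 2 first.
- exact: near_of.
- by apply: near_of; exact: (smooth_sum hE).
by congr conn; apply: section_ext => y; rewrite big_cons.
Qed.

Lemma conn_scal v (f : M -> S) s : smooth_scal_on A f -> smooth_on A s ->
  conn x v (fun y => f y *: s y) = dscal x v f *: s x + f x *: conn x v s.
Proof.
move=> [f1 f2] hs.
have -> : (fun y => f y *: s y) =
    (fun y => si S *: (sinj S (sim (f y)) *: s y) + sinj S (sre (f y)) *: s y).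
  by apply: section_ext => y; rewrite {1}[f y]s_decomp scalerDl scalerA addrC.
have s1 : smooth_on A (fun y => sinj S (sim (f y)) *: s y).
  by apply: (smoothZ hE) => //; exact: smooth_scal_inj.
have s2 : smooth_on A (fun y => sinj S (sre (f y)) *: s y).
  by apply: (smoothZ hE) => //; exact: smooth_scal_inj.
rewrite (good_linearr hE) ?(good_leibniz hE v oA Ax)//; try exact: near_of.
rewrite /dscal [X in _ = _ + X *: _]s_decomp !scalerDr !scalerDl !scalerA.
by rewrite [LHS]addrACA [X in X + _ = _]addrC [X in _ + X = _]addrC.
Qed.

End at_point.

Lemma conn_vlinear x v s : smooth_near x s ->
  conn x v s = \sum_l sinj S (v 0 l) *: conn x (delta_mx 0 l) s.
Proof.
move=> hs; have cD u w : conn x (u + w) s = conn x u s + conn x w s.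
  by have := good_linearl hE 1 u w hs; rewrite !scale1r rmorph1 scale1r.
have c0 : conn x 0 s = 0.
  by apply: (addrI (conn x 0 s)); rewrite -cD !addr0.
rewrite {1}[v]row_sum_delta (big_morph (fun u => conn x u s) cD c0).
apply: eq_bigr => l _; have := good_linearl hE (v 0 l) (delta_mx 0 l) 0 hs.
by rewrite !addr0 c0 addr0.
Qed.

End good_theory.

Section hom_bundle_theory.
Local Open Scope ring_scope.
Variables (R : realType) (n : nat) (S : scalars R) (M : manifold R n).

Section vb.
Variables (E F : vbdata S M) (hE : is_vector_bundle E) (hF : is_vector_bundle F).
Implicit Types (T : section (hom_vb E F)) (A : set M).

Lemma triv_homE i j x (T : 'Hom(E x, F x)) k l :
  triv (hom_vb E F) (i, j) x T 0 (mxvec_index k l) =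
  triv F j x (T (frame k x)) 0 l.
Proof. by rewrite /= mxvecE mxE. Qed.

(** The matrix entries of a section of Hom(E, F) are the coordinates of its
    values on the local frames of E. *)
Lemma hom_smoothP A T : open A ->
  smooth_on A T <-> forall i (k : 'I_(trk E i)),
    smooth_on (A `&` tdom E i) (fun x => (T x : 'Hom(E x, F x)) (frame k x)).
Proof.
move=> oA; split=> [sT i k j l|sT [i j] kl].
  have := sT (i, j) (mxvec_index k l).
  rewrite (_ : A `&` tdom (hom_vb E F) (i, j) = A `&` tdom E i `&` tdom F j); last by rewrite /= setIA.
  apply: smooth_scal_ext; first by apply: (opentd hF); exact: (opentd hE).
  by move=> x _; rewrite triv_homE.
case/mxvec_indexP: kl => k l.
rewrite (_ : A `&` tdom (hom_vb E F) (i, j) = A `&` tdom E i `&` tdom F j); last by rewrite /= setIA.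
apply: smooth_scal_ext (sT i k j l); first by apply: (opentd hF); exact: (opentd hE).
by move=> x _; rewrite triv_homE.
Qed.

(** Expand s in a local frame of E. *)
Lemma hom_apply_smooth A T (s : section E) : open A ->
  smooth_on A T -> smooth_on A s ->
  smooth_on A (fun x => (T x : 'Hom(E x, F x)) (s x)).
Proof.
move=> oA /(hom_smoothP _ oA) sT sS; apply: smooth_cover => x Ax.
pose i := tat E x; exists (A `&` tdom E i).
split; first by split => //; exact: (tdom_tat hE).
have oAi : open (A `&` tdom E i) by exact: (opentd hE).
have := @smooth_sum _ _ _ _ F hF _ _ (index_enum 'I_(trk E i))
  (fun k y => triv E i y (s y) 0 k *: (T y : 'Hom(E y, F y)) (frame k y)) oAi _.
move=> H; apply: (smooth_ext hF _ _ (H _)) => //.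
  move=> y [Ay dy]; rewrite {2}(frame_decomp hE (s y) dy) linear_sum.
  by apply: eq_bigr => k _; rewrite linearZ.
by move=> k; apply: (smoothZ hF) => //; exact: sT.
Qed.

Lemma trivV_homE i j x w (u : E x) : tdom E i x -> tdom F j x ->
  (trivV (hom_vb E F) (i, j) x w : 'Hom(E x, F x)) u =
  trivV F j x (triv E i x u *m vec_mx w).
Proof.
move=> dE dF; rewrite /= linfunE// => a u1 u2.
by rewrite (triv_linear hE dE) mulmxDl -scalemxAl (trivV_linear hF dF).
Qed.

Lemma hom_is_vector_bundle : is_vector_bundle (hom_vb E F).
Proof.
split.
- by move=> x; split; [exact: (tdom_tat hE)|exact: (tdom_tat hF)].
- by move=> [i j]; apply: openI; [exact: (tdom_open hE)|exact: (tdom_open hF)].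
- move=> [i j] x [dE dF] a T1 T2; apply/rowP => kl; case/mxvec_indexP: kl => k l.
  rewrite [LHS]triv_homE [RHS]mxE [in RHS]mxE !triv_homE.
  by rewrite !lfunE /= lfunE /= (triv_linear hF dF) !mxE.
- move=> [i j] x [dE dF] T; apply/lfunP => u; rewrite trivV_homE//= mxvecK.
  rewrite mul_lin1_mx ?(trivK hE) ?(trivK hF)//.
  by move=> a u1 u2; rewrite (trivV_linear hE dE) linearP (triv_linear hF dF).
- move=> [i j] x [dE dF] w; apply/rowP => kl; case/mxvec_indexP: kl => k l.
  rewrite triv_homE trivV_homE// (trivVK hF)// (trivVK hE)//.
  by rewrite -rowE mxE -[in RHS](vec_mxK w) mxvecE.
move=> [i j] ij' kl kl'.
have oij : open (tdom E i `&` tdom F j).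
  by apply: openI; [exact: (tdom_open hE)|exact: (tdom_open hF)].
suff : smooth_on (tdom E i `&` tdom F j) (@frame _ _ _ _ (hom_vb E F) (i, j) kl).
  exact.
apply/(hom_smoothP _ oij) => i' k'.
have oij' : open (tdom E i `&` tdom F j `&` tdom E i') by exact: (opentd hE).
have := @smooth_sum _ _ _ _ F hF _ _ (index_enum 'I_(trk F j))
  (fun l y => ((triv E i y (frame k' y) *m vec_mx (delta_mx 0 kl)) 0 l) *: frame l y) oij' _.
move=> H; apply: (smooth_ext hF _ _ (H _)) => //.
  move=> y [[dE dF] _]; rewrite [in RHS]/frame trivV_homE//.
  rewrite [X in trivV F j y X]row_sum_delta trivV_sum//.
  by apply: eq_bigr => l _; rewrite trivVZ.
move=> l; apply: (smoothZ hF) => //; last first.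
  by apply: smooth_sub (smooth_frame hF l) => y [[]].
have H' : forall m, smooth_scal_on (tdom E i `&` tdom F j `&` tdom E i')
   (fun y => triv E i y (frame k' y) 0 m * vec_mx (delta_mx 0 kl) m l).
  move=> m; apply: smooth_scalM => //; last exact: smooth_scal_cst.
  by apply: smooth_scal_sub (smooth_frame hE k' m) => y [[]].
apply: smooth_scal_ext (smooth_scal_sum (index_enum _) oij' H') => //.
by move=> y _; rewrite mxE.
Qed.

End vb.

Section conn.
Variables (E F : hbdata S M) (hE : good_bundle E) (hF : good_bundle F).
Implicit Types (T : section (hom_bundle E F)) (A : set M) (s : section E).

Let app T s : section F := fun y => (T y : 'Hom(E y, F y)) (s y).

Lemma hom_apply_smooth_near x T s : smooth_near x T -> smooth_near x s ->
  smooth_near x (fun y => (T y : 'Hom(E y, F y)) (s y)).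
Proof.
move=> [A [oA Ax sA]] [B [oB Bx sB]]; exists (A `&` B); split => //.
  exact: openI.
apply: (hom_apply_smooth hE hF); first exact: openI.
  by apply: smooth_sub sA => y [].
by apply: smooth_sub sB => y [].
Qed.

(** The defect of the Leibniz rule is tensorial in s: writing s = sum_k f_k e_k
    in a local frame, the derivatives of the f_k cancel.  In particular it does
    not depend on the extension of a vector to a local section by which the
    connection of Hom(E, F) is defined. *)
Lemma hom_defect_frame x v T s : smooth_near x T -> smooth_near x s ->
  conn x v (app T s) - (T x : 'Hom(E x, F x)) (conn x v s) =
  \sum_k triv E (tat E x) x (s x) 0 k *:
     (conn x v (app T (frame k)) - (T x : 'Hom(E x, F x)) (conn x v (frame k))).
Proof.
move=> [B [oB Bx sT]] [A [oA Ax sS]]; set c := tat E x.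
pose C := A `&` B `&` tdom E c.
have oC : open C by apply: (opentd hE); exact: openI.
have Cx : C x by split => //; exact: (tdom_tat hE).
pose f k y : S := triv E c y (s y) 0 k.
have hf k : smooth_scal_on C (f k) by apply: smooth_scal_sub (sS c k) => y [[]].
have he k : smooth_on C (frame (E := E) (i := c) k).
  by apply: smooth_sub (smooth_frame hE k) => y [[]].
have hT : smooth_on C T by apply: smooth_sub sT => y [[]].
have hTe k : smooth_on C (app T (frame (E := E) (i := c) k)).
  by apply: (hom_apply_smooth hE hF) => //; exact: he.
have hs : smooth_on C s by apply: smooth_sub sS => y [[]].
have nC : \forall y \near x, C y by exact: open_nbhs_nbhs.
have -> : conn x v s = \sum_k (dscal x v (f k) *: frame k x + f k x *: conn x v (frame k)).
  rewrite (@good_local _ _ _ _ _ hE x v s (fun y => \sum_k f k y *: frame k y)).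
  - rewrite (conn_sum hE oC Cx); last by move=> k; exact: (smoothZ hE).
    by apply: eq_bigr => k _; rewrite (conn_scal hE oC).
  - by exists C.
  - by apply: filterS nC => y [_ dy]; exact: (frame_decomp hE).
have -> : conn x v (app T s) = \sum_k (dscal x v (f k) *: app T (frame k) x
     + f k x *: conn x v (app T (frame k))).
  rewrite (@good_local _ _ _ _ _ hF x v (app T s) (fun y => \sum_k f k y *: app T (frame k) y)).
  - rewrite (conn_sum hF oC Cx); last by move=> k; exact: (smoothZ hF).
    by apply: eq_bigr => k _; rewrite (conn_scal hF oC).
  - by apply: hom_apply_smooth_near; exists C.
  - apply: filterS nC => y [_ dy]; rewrite /app {1}(frame_decomp hE (s y) dy) linear_sum.
    by apply: eq_bigr => k _; rewrite linearZ.
rewrite linear_sum -sumrB; apply: eq_bigr => k _.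
by rewrite linearD !linearZ /= opprD addrACA subrr add0r scalerBr.
Qed.

Lemma hom_connE x v T u : smooth_near x T ->
  (conn x v T : 'Hom(E x, F x)) u =
  conn x v (app T (const_section u)) - (T x : 'Hom(E x, F x)) (conn x v (const_section u)).
Proof.
move=> hT; rewrite /= linfunE// => a u1 u2.
have nc (w : E x) : smooth_near x (const_section w) by exact: (smooth_near_const hE).
rewrite !(hom_defect_frame v hT (nc _)) scaler_sumr -big_split /=.
apply: eq_bigr => k _; rewrite !(const_sectionE hE).
by rewrite (triv_linear hE (tdom_tat hE x)) !mxE scalerDl scalerA.
Qed.

Lemma hom_leibniz x v T s : smooth_near x T -> smooth_near x s ->
  conn x v (app T s) =
  (conn x v T : 'Hom(E x, F x)) (s x) + (T x : 'Hom(E x, F x)) (conn x v s).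
Proof.
move=> hT hs; apply/eqP; rewrite -subr_eq; apply/eqP.
rewrite hom_connE// !hom_defect_frame//; last exact: (smooth_near_const hE).
by rewrite (const_sectionE hE).
Qed.

Lemma hom_good : good_bundle (hom_bundle E F).
Proof.
have vbH := hom_is_vector_bundle hE hF.
have nc x (w : E x) := smooth_near_const hE w.
split.
- exact: vbH.
- by move=> x; apply: hom_ip; [exact: (good_ip hE)|exact: (good_ip hF)].
- move=> x v T T' hT TT'; apply/lfunP => u.
  rewrite !hom_connE//; last exact: (smooth_near_eq vbH TT' hT).
  rewrite (nbhs_singleton TT'); congr (_ - _); apply: (good_local hF).
    exact: hom_apply_smooth_near.
  by apply: filterS TT' => y e; rewrite /app e.
- move=> x a v w T hT; apply/lfunP => u.
  rewrite !lfunE /= lfunE /= !hom_connE//.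
  rewrite (good_linearl hE)//; rewrite (good_linearl hF); last exact: hom_apply_smooth_near.
  by rewrite linearP scalerBr addrACA opprD.
- move=> x a v T T' hT hT'; apply/lfunP => u.
  have [A [oA Ax sA sA']] := smooth_near2 hT hT'.
  have hTT' : smooth_near x (fun y => a *: T y + T' y).
    by exists A; split => //; apply: (smoothD vbH) => //; exact: (smoothZc vbH).
  rewrite !lfunE /= lfunE /= !hom_connE//.
  rewrite (_ : app _ _ = fun y => a *: app T (const_section u) y + app T' (const_section u) y); last first.
    by apply: section_ext => y; rewrite /app !lfunE /= lfunE.
  rewrite (good_linearr hF); try exact: hom_apply_smooth_near.
  by rewrite !lfunE /= lfunE /= scalerBr addrACA opprD.
- move=> x v f T A oA Ax hf hT'; apply/lfunP => u.
  have hT : smooth_near x T by exists A.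
  have hfT : smooth_near x (fun y => sinj S (f y) *: T y).
    by exists A; split => //; apply: (smoothZ vbH) => //; exact: smooth_scal_inj.
  rewrite !lfunE /= !lfunE /= !hom_connE//.
  rewrite (_ : app _ _ = fun y => sinj S (f y) *: app T (const_section u) y); last first.
    by apply: section_ext => y; rewrite /app !lfunE.
  have [B [oB Bx sB]] := nc x u.
  have oAB := openI oA oB.
  have hAB : smooth_on (A `&` B) (app T (const_section u)).
    apply: (hom_apply_smooth hE hF) => //.
      by move=> i k; apply: smooth_scal_sub (hT' i k) => y [[]].
    by apply: smooth_sub sB => y [].
  rewrite (good_leibniz hF v oAB)//; last by apply: smooth_fun_sub hf => y [].
  by rewrite !lfunE /= /app (const_sectionE hE) scalerBr addrA.
move=> A X T oA hX hT; apply/(hom_smoothP hE hF _ oA) => i k.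
have oAi : open (A `&` tdom E i) by exact: (opentd hE).
have hT' : smooth_on (A `&` tdom E i) T.
  by apply: smooth_sub hT => y [].
have he : smooth_on (A `&` tdom E i) (frame (E := E) k).
  by apply: smooth_sub (smooth_frame hE k) => y [].
have hX' : smooth_on (A `&` tdom E i) X.
  by apply: smooth_sub hX => y [].
have h1 := good_smooth hF oAi hX' (hom_apply_smooth hE hF oAi hT' he).
have h2 := hom_apply_smooth hE hF oAi hT' (good_smooth hE oAi hX' he).
apply: (smooth_ext hF oAi _ (smoothB hF oAi h1 h2)) => y [Ay dy].
rewrite hom_leibniz ?addrK//; first by exists A.
by exists (A `&` tdom E i).
Qed.

End conn.
End hom_bundle_theory.

(** * The tangent bundle as a vector bundle *)

Section composition.
Local Open Scope ring_scope.
Variables (R : realType) (n : nat).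
Implicit Types (U V : set 'rV[R]_n).

Lemma Ck_sum k U (I : Type) (r : seq I) (F : I -> 'rV[R]_n -> R) : open U ->
  (forall i, Ck k U (F i)) -> Ck k U (fun x => \sum_(i <- r) F i x).
Proof.
move=> oU sF; elim: r => [|i r IH].
  by apply: Ck_ext (Ck_cst k 0 oU) => // x _; rewrite big_nil.
by apply: Ck_ext (Ck_add oU (sF i) IH) => // x _; rewrite big_cons.
Qed.

Lemma differentiable_row m (f : 'rV[R]_n -> 'rV[R]_m) p :
  (forall l, differentiable (fun q => f q 0 l) p) -> differentiable f p.
Proof.
move=> df.
have -> : f = \sum_(l < m) (fun q => f q 0 l *: (delta_mx 0 l : 'rV[R]_m)).
  by apply/funext => q; rewrite fct_sumE {1}[f q]row_sum_delta.
by apply: differentiable_sum => l; apply: differentiableZl.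
Qed.

Lemma diff_entry m (f : 'rV[R]_n -> 'rV[R]_m) p v l : differentiable f p ->
  'd f p v 0 l = 'D_v (fun q => f q 0 l) p.
Proof.
move=> df; pose c (q : 'rV[R]_m) : R := q 0 l.
have lc : linear c by move=> a u w; rewrite /c !mxE.
pose cM := GRing.isLinear.Build _ _ _ _ _ lc.
pose cL : {linear 'rV[R]_m -> R} := HB.pack c cM.
have dc q : differentiable c q by exact: differentiable_coord.
have cc : continuous cL by move=> q; exact: coord_continuous.
rewrite deriveE; last exact: (differentiable_comp df (dc _)).
by rewrite (diff_comp df (dc _)) /= (diff_lin (f := cL) _ cc).
Qed.

(** Induction on k, since the partial derivatives of g o phi are
    sum_l (D_l g o phi) D_i phi_l. *)
Lemma Ck_comp k U V (g : 'rV[R]_n -> R) (phi : 'rV[R]_n -> 'rV[R]_n) :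
  open U -> (forall p, U p -> V (phi p)) ->
  (forall l, Cinf U (fun p => phi p 0 l)) -> Ck k V g -> Ck k U (g \o phi).
Proof.
move=> oU UV sphi.
have dphi p : U p -> differentiable phi p.
  by move=> Up; apply: differentiable_row => l; exact: Cinf_differentiable (sphi l) Up.
elim: k g => [|k IH] g.
  move=> cg p Up; apply: continuous_comp; last exact: cg (UV _ Up).
  exact: differentiable_continuous (dphi _ Up).
move=> [dg Dg]; split=> [p Up|i].
  by apply: differentiable_comp; [exact: dphi|exact: dg (UV _ Up)].
have H l : Ck k U (fun p => 'D_(delta_mx 0 i) (fun q => phi q 0 l) p *
                     ('D_(delta_mx 0 l) g \o phi) p).
  by apply: Ck_mul => //; [exact: Cinf_partial (sphi l) k|exact: IH (Dg l)].
apply: Ck_ext (Ck_sum (index_enum _) oU H) => // p; rewrite inE => Up.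
have dgp := dg _ (UV _ Up).
rewrite deriveE; last by apply: differentiable_comp => //; exact: dphi.
rewrite (diff_comp (dphi _ Up) dgp) /= [X in _ = 'd _ _ X]row_sum_delta linear_sum.
apply: eq_bigr => l _; rewrite linearZ /= diff_entry; last exact: dphi.
by rewrite [LHS]mulrC (deriveE _ dgp) mulrC.
Qed.

Lemma near_eq_diff m (f g : 'rV[R]_n -> 'rV[R]_m) p :
  (\forall q \near p, f q = g q) -> differentiable f p ->
  'd f p =1 'd g p.
Proof.
move=> fg df v; have dg := near_eq_differentiable fg df.
by have := near_eq_derive v fg; rewrite (deriveE v df) (deriveE v dg).
Qed.

Lemma diff_chain (f g h : 'rV[R]_n -> 'rV[R]_n) p q v : f p = q ->
  differentiable f p -> differentiable g q ->
  (\forall y \near p, g (f y) = h y) -> 'd g q ('d f p v) = 'd h p v.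
Proof.
move=> <- df dg gf.
apply: etrans (near_eq_diff gf (differentiable_comp df dg) v).
exact: (esym (congr1 (fun F => F v) (diff_comp df dg))).
Qed.

End composition.

Section tangent_vector_bundle.
Local Open Scope ring_scope.
Variables (R : realType) (n : nat) (M : manifold R n).
Implicit Types (x : M).

Local Notation jac i j x := (jacobian (chart j \o @chartV _ _ M i) (chart i x)).

Lemma chart_change_diff i j x : cdom i x -> cdom j x ->
  differentiable (chart j \o @chartV _ _ M i) (chart i x).
Proof.
move=> di dj; apply: differentiable_row => l.
by apply: Cinf_differentiable (@chart_smooth _ _ M i j l) _; exists x.
Qed.

Lemma near_chart i x (P : M -> Prop) : cdom i x -> (\forall y \near x, P y) ->
  \forall p \near chart i x, cdom i (chartV i p) /\ chart i (chartV i p) = p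
     /\ P (chartV i p).
Proof.
move=> dx nP.
have px : (chart i @` cdom i) (chart i x) by exists x.
have n1 : \forall q \near chart i x, (chart i @` cdom i) q.
  by apply: open_nbhs_nbhs; split => //; exact: cimg_open.
have n2 : \forall q \near chart i x, P (chartV i q).
  by move: (chartV_cont px); rewrite /prop_for /continuous_at chartK// => /(_ _ nP).
by apply: filterS2 n1 n2 => q [y dy <-]; rewrite chartK.
Qed.

Lemma mul_jac i j x (v : 'rV[R]_n) :
  v *m jac i j x = 'd (chart j \o @chartV _ _ M i) (chart i x) v.
Proof. exact: mul_rV_lin1. Qed.

(** Used to read the chain rule for differentials, which are functions of vectors,
    as an identity between Jacobian matrices. *)
Lemma mulmx_comp (A B C : 'M[R]_n) (f g h : 'rV[R]_n -> 'rV[R]_n) :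
  (forall v, v *m A = f v) -> (forall v, v *m B = g v) ->
  (forall v, v *m C = h v) -> (forall v, g (f v) = h v) -> A *m B = C.
Proof.
move=> fA gB hC gf; apply/row_matrixP => l.
by rewrite [LHS]rowE [RHS]rowE mulmxA fA gB hC.
Qed.

Lemma jac_chain i j k x : cdom i x -> cdom j x -> cdom k x ->
  jac i j x *m jac j k x = jac i k x.
Proof.
move=> di dj dk.
apply: (mulmx_comp (@mul_jac i j x) (@mul_jac j k x) (@mul_jac i k x)) => v.
have nj : \forall y \near x, cdom j y.
  by apply: open_nbhs_nbhs; split => //; exact: cdom_open.
apply: diff_chain (chart_change_diff di dj) (chart_change_diff dj dk) _.
  by rewrite /= chartK.
by apply: filterS (near_chart di nj) => p [_ [_ dp]]; rewrite /= chartK.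
Qed.

Lemma jac_id i x : cdom i x -> jac i i x = 1%:M.
Proof.
move=> di; apply/row_matrixP => l; rewrite [LHS]rowE [RHS]rowE mulmx1.
apply: (etrans (mul_jac i i x _)).
have ni : \forall y \near x, cdom i y.
  by apply: open_nbhs_nbhs; split => //; exact: cdom_open.
have nE : \forall p \near chart i x, (chart i \o chartV i) p = id p.
  by apply: filterS (near_chart di ni) => p [_ [+ _]].
have := near_eq_diff nE (chart_change_diff di di) (delta_mx 0 l).
by rewrite [in RHS]diff_val.
Qed.

(** In the other charts the function is g composed with a change of charts. *)
Lemma smooth_fun_chart i (A : set M) (g : 'rV[R]_n -> R) : A `<=` cdom i -> open A ->
  Cinf (chart i @` A) g -> smooth_fun_on A (g \o chart i).
Proof.
move=> Ai oA sg j k.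
apply: (@Ck_comp _ _ k _ (chart i @` A) g (chart i \o chartV j)) => //.
- exact: chart_img_open.
- by move=> _ [x [Ax dx] <-]; exists x => //=; rewrite chartK.
- move=> l k'; apply: Ck_sub (@chart_smooth _ _ M j i l k').
  by move=> _ [x [Ax dx] <-]; exists x => //; split => //; exact: Ai.
Qed.

Lemma tangent_is_vector_bundle (S : scalars R) :
  is_vector_bundle (tangent_vb S M).
Proof.
split.
- by move=> x; exact: cdom_chart_at.
- by move=> i; exact: cdom_open.
- by move=> i x dx a u v /=; rewrite mulmxDl scalemxAl.
- move=> i x dx v /=; rewrite -mulmxA -map_mxM jac_chain ?jac_id ?map_mx1 ?mulmx1//;
  exact: cdom_chart_at.
- move=> i x dx v /=; rewrite -mulmxA -map_mxM jac_chain ?jac_id ?map_mx1 ?mulmx1//;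
  exact: cdom_chart_at.
move=> i j k l.
have oA : open (cdom i `&` @cdom _ _ M j) by apply: openI; exact: cdom_open.
pose g := 'D_(delta_mx 0 k) (fun p => chart j (@chartV _ _ M i p) 0 l).
have sg : smooth_fun_on (cdom i `&` cdom j) (g \o chart i).
  apply: smooth_fun_chart => //; apply: Cinf_partial; exact: chart_smooth.
apply: smooth_scal_ext (smooth_scal_inj S oA sg) => // x [di dj].
rewrite /= -mulmxA -map_mxM jac_chain//; last exact: cdom_chart_at.
rewrite -rowE !mxE; congr (sinj S _).
by rewrite diff_entry//; exact: chart_change_diff.
Qed.

End tangent_vector_bundle.

(** * The connections of the tangent and trivial bundles *)

Section tangent_good.
Local Open Scope ring_scope.
Variables (R : realType) (n : nat) (M : riemannian R n).
Let S0 := real_scalars R.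
Local Notation D x v X := (@conn _ _ _ _ (tangent M S0) x v X).

Lemma sconj_real (a : real_scalars R) : sconj a = a.
Proof. by rewrite /sconj /= mul0r subr0. Qed.

Lemma tangent_real_herm (x : M) (u v : 'rV[R]_n) :
  herm (u : tangent M S0 x) (v : tangent M S0 x) = (u *m gram x *m v^T) 0 0.
Proof.
rewrite /=; congr ((_ *m _ *m _^T) 0 0); apply/matrixP => i j; rewrite !mxE//.
exact: sconj_real.
Qed.

(** For real scalars the real and imaginary parts in the complexified connection
    are the identity and 0. *)
Lemma conn_real (x : M) v (X : section (tangent M S0)) :
  conn x v X = levi_civita x v X.
Proof.
rewrite /= scale0r addr0; apply/matrixP => i j; rewrite mxE.
congr (levi_civita x v _ i j).
by apply/funext => y; apply/matrixP => ? ?; rewrite mxE.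
Qed.

Lemma tangent_real_good : good_bundle (tangent M (real_scalars R)).
Proof.
have [h1 h2 h3 h4] := rman_metric M; have [c1 c2 c3 c4 c5 c6] := rman_connection M.
split => //; first exact: (tangent_is_vector_bundle M S0).
by move=> x; split => //; exact: h3.
Qed.

Let hT := tangent_real_good.

Lemma gram_sym (x : M) k l : gram x k l = gram x l k.
Proof.
have e (u v : tangent M S0 x) : herm v u = sconj (herm u v).
  exact: (herm_conj (rman_metric M)).
have := e (delta_mx 0 k) (delta_mx 0 l).
rewrite sconj_real !tangent_real_herm.
by rewrite -!rowE !trmx_delta -!colE !mxE.
Qed.

Variable S : scalars R.

Definition re_field (X : section (tangent M S)) : section (tangent M S0) :=
  fun x => map_mx (@sre R S) (X x : 'rV[S]_n).
Definition im_field (X : section (tangent M S)) : section (tangent M S0) :=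
  fun x => map_mx (@sim R S) (X x : 'rV[S]_n).
Definition lift_field (X : section (tangent M S0)) : section (tangent M S) :=
  fun x => map_mx (sinj S) (X x : 'rV[R]_n).

Lemma mx_scal_eq p q (A B : 'M[S]_(p, q)) :
  map_mx (@sre R S) A = map_mx (@sre R S) B ->
  map_mx (@sim R S) A = map_mx (@sim R S) B -> A = B.
Proof.
move=> /matrixP e1 /matrixP e2; apply/matrixP => i j.
by apply: scal_eq; [have := e1 i j|have := e2 i j]; rewrite !mxE.
Qed.

Lemma re_lift p q (A : 'M[R]_(p, q)) : map_mx (@sre R S) (map_mx (sinj S) A) = A.
Proof. by apply/matrixP => i j; rewrite !mxE sre_inj. Qed.

Lemma im_lift p q (A : 'M[R]_(p, q)) : map_mx (@sim R S) (map_mx (sinj S) A) = 0.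
Proof. by apply/matrixP => i j; rewrite !mxE sim_inj. Qed.

Lemma tangent_smooth_re (A : set M) (X : section (tangent M S)) : open A ->
  smooth_on A X <-> smooth_on A (re_field X) /\ smooth_on A (im_field X).
Proof.
move=> oA; have oAi i : open (A `&` @cdom _ _ M i) by apply: openI => //; exact: cdom_open.
have E1 i x k : sre (triv (tangent M S) i x (X x) 0 k) =
    triv (tangent M S0) i x (re_field X x) 0 k.
  rewrite /= !mxE sre_sum; apply: eq_bigr => l _.
  by rewrite !mxE mulrC sre_injM mulrC.
have E2 i x k : sim (triv (tangent M S) i x (X x) 0 k) =
    triv (tangent M S0) i x (im_field X x) 0 k.
  rewrite /= !mxE sim_sum; apply: eq_bigr => l _.
  by rewrite !mxE mulrC sim_injM mulrC.
split=> [sX|[sX1 sX2] i k].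
  split=> i k; (split; last by apply: smooth_fun_cst; exact: oAi).
    by apply: smooth_fun_ext (sX i k).1; [exact: oAi|move=> x _; rewrite E1].
  by apply: smooth_fun_ext (sX i k).2; [exact: oAi|move=> x _; rewrite E2].
split.
  by apply: smooth_fun_ext (sX1 i k).1; [exact: oAi|move=> x _; rewrite E1].
by apply: smooth_fun_ext (sX2 i k).1; [exact: oAi|move=> x _; rewrite E2].
Qed.

Lemma tangent_near_re x (X : section (tangent M S)) : smooth_near x X ->
  smooth_near x (re_field X) /\ smooth_near x (im_field X).
Proof.
move=> [A [oA Ax]] /(tangent_smooth_re _ oA)[s1 s2].
by split; exists A.
Qed.

(** The term with the derivative of the imaginary part of X carries the factor
    re(i), which is 0 unless all imaginary parts are. *)
Lemma re_conn x v (X : section (tangent M S)) :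
  re_field (fun y => conn y v X) x = D x v (re_field X).
Proof.
have E : re_field (fun y => conn y v X) x =
    D x v (re_field X) + sre (si S) *: D x v (im_field X).
  by rewrite !conn_real; apply/matrixP => i j; rewrite !mxE sreD sre_inj sre_siM.
rewrite E; have [h|[-> _]] := scal_real_or_complex S; last by rewrite scale0r addr0.
rewrite (_ : im_field X = fun=> 0); first by rewrite [X in _ *: X](conn0 hT) scaler0 addr0.
by apply: section_ext => y; apply/matrixP => i j; rewrite !mxE h.
Qed.

Lemma im_conn x v (X : section (tangent M S)) :
  im_field (fun y => conn y v X) x = D x v (im_field X).
Proof.
have E : im_field (fun y => conn y v X) x = sim (si S) *: D x v (im_field X).
  by rewrite !conn_real; apply/matrixP => i j; rewrite !mxE simD sim_inj sim_siM add0r.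
rewrite E; have [h|[_ ->]] := scal_real_or_complex S; last by rewrite scale1r.
rewrite (_ : im_field X = fun=> 0); first by rewrite [X in _ *: X](conn0 hT) [RHS](conn0 hT) scaler0.
by apply: section_ext => y; apply/matrixP => i j; rewrite !mxE h.
Qed.

Lemma conn_lift x v (X : section (tangent M S0)) :
  conn x v (lift_field X) = lift_field (fun y => conn y v X) x.
Proof.
apply: mx_scal_eq.
  rewrite [LHS](re_conn x v (lift_field X)) re_lift.
  by rewrite (_ : re_field _ = X)//; apply: section_ext => y; exact: re_lift.
rewrite [LHS](im_conn x v (lift_field X)) im_lift.
rewrite (_ : im_field _ = fun=> 0); last by apply: section_ext => y; exact: im_lift.
exact: (conn0 hT).
Qed.

Lemma lift_smooth A (X : section (tangent M S0)) : open A -> smooth_on A X ->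
  smooth_on A (lift_field X).
Proof.
move=> oA sX; apply/(tangent_smooth_re _ oA).
rewrite (_ : re_field _ = X); last by apply: section_ext => y; exact: re_lift.
rewrite (_ : im_field _ = fun=> 0); last by apply: section_ext => y; exact: im_lift.
by split => //; exact: (smooth0 hT).
Qed.

Lemma tangent_hermE (x : M) (u v : 'rV[S]_n) :
  herm (u : tangent M S x) (v : tangent M S x) =
  \sum_k \sum_l u 0 k * sinj S (gram x k l) * sconj (v 0 l).
Proof.
rewrite /= mxE exchange_big /=; apply: eq_bigr => l _; rewrite !mxE mulr_suml.
by apply: eq_bigr => k _; rewrite !mxE.
Qed.

Lemma tangent_sre_herm (x : M) (u : 'rV[S]_n) :
  sre (herm (u : tangent M S x) (u : tangent M S x)) =
  herm (map_mx (@sre R S) u : tangent M S0 x) (map_mx (@sre R S) u : tangent M S0 x) +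
  herm (map_mx (@sim R S) u : tangent M S0 x) (map_mx (@sim R S) u : tangent M S0 x).
Proof.
rewrite !tangent_real_herm tangent_hermE sre_sum !mxE.
under eq_bigr do rewrite sre_sum.
rewrite exchange_big -big_split /=; apply: eq_bigr => l _.
rewrite !mxE !mulr_suml -big_split /=; apply: eq_bigr => k _.
rewrite !mxE (mulrC (u 0 k)) -(mulrA (sinj S _)) sre_injM sreM sre_conj sim_conj; ring.
Qed.

Lemma tangent_ip (x : M) : is_ip (@herm _ _ _ _ (tangent M S) x).
Proof.
split.
- move=> a u v w; rewrite !tangent_hermE mulr_sumr -big_split /=.
  apply: eq_bigr => k _; rewrite mulr_sumr -big_split /=; apply: eq_bigr => l _.
  by rewrite !mxE !mulrDl !mulrA.
- move=> u v; rewrite !tangent_hermE rmorph_sum exchange_big /=.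
  apply: eq_bigr => k _; rewrite rmorph_sum; apply: eq_bigr => l _.
  rewrite !rmorphM /= sconj_inj sconjK gram_sym; ring.
move=> u u0; rewrite tangent_sre_herm.
have [r0|r0] := eqVneq (map_mx (@sre R S) u) 0; last first.
  apply: ltr_pwDl; first exact: (ip_pos (good_ip hT x)).
  exact: (ip_ge0 (good_ip hT x)).
rewrite r0 [X in X + _](ip0l (good_ip hT x)) add0r.
apply: (ip_pos (good_ip hT x)); apply: contra_neq u0 => i0.
by apply: mx_scal_eq; [rewrite r0|rewrite i0]; apply/matrixP => i j;
  rewrite !mxE ?sre0 ?sim0.
Qed.

(** A complex vector field is differentiated through its real and imaginary parts,
    so each axiom reduces to the same one for the Levi-Civita connection. *)
Lemma tangent_good : good_bundle (tangent M S).
Proof.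
have vbT := tangent_is_vector_bundle M S.
have cl x v (s : section (tangent M S)) (u : tangent M S x) :
    D x v (re_field s) = map_mx (@sre R S) u ->
    D x v (im_field s) = map_mx (@sim R S) u -> conn x v s = u.
  by rewrite -re_conn -im_conn => e1 e2; apply: mx_scal_eq.
split.
- exact: vbT.
- exact: tangent_ip.
- move=> x v s t hs st; have [h1 h2] := tangent_near_re hs.
  apply: cl.
    rewrite -[RHS]/(re_field (fun y => conn y v t) x) re_conn.
    apply: (good_local hT) h1 _; apply: filterS st => y e.
    by rewrite /re_field e.
  rewrite -[RHS]/(im_field (fun y => conn y v t) x) im_conn.
  apply: (good_local hT) h2 _; apply: filterS st => y e.
  by rewrite /im_field e.
- move=> x a v w s hs; have [h1 h2] := tangent_near_re hs.
  apply: cl; [rewrite [LHS](good_linearl hT a v w h1)|rewrite [LHS](good_linearl hT a v w h2)].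
    rewrite -!re_conn.
    by apply/matrixP => i j; rewrite !mxE [RHS]sreD sre_injM.
  rewrite -!im_conn.
  by apply/matrixP => i j; rewrite !mxE [RHS]simD sim_injM.
- move=> x a v s t hs ht; have [s1 s2] := tangent_near_re hs.
  have [t1 t2] := tangent_near_re ht.
  have nz (c : R) (X : section (tangent M S0)) : smooth_near x X ->
      smooth_near x ((fun y => c *: X y) : section (tangent M S0)).
    by move=> [A [oA Ax sA]]; exists A; split => //; exact: (smoothZc hT).
  have nD (X Y : section (tangent M S0)) : smooth_near x X -> smooth_near x Y ->
      smooth_near x ((fun y => X y + Y y) : section (tangent M S0)).
    by move=> hX hY; have [A [oA Ax sA sB]] := smooth_near2 hX hY; exists A;
      split => //; exact: (smoothD hT).
  apply: cl.
    rewrite (_ : re_field _ = fun y => sre a *: re_field s y +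
       (- sim a *: im_field s y + re_field t y)); last first.
      apply: section_ext => y; apply/matrixP => i j.
      by rewrite !mxE sreD sreM mulNr addrA.
    rewrite [LHS](good_linearr hT)//; last by apply: nD => //; exact: nz.
    rewrite [X in _ + X = _](good_linearr hT)//.
    rewrite -(re_conn x v s) -(im_conn x v s) -(re_conn x v t).
    by apply/matrixP => i j; rewrite !mxE [RHS]sreD sreM mulNr addrA.
  rewrite (_ : im_field _ = fun y => sre a *: im_field s y +
       (sim a *: re_field s y + im_field t y)); last first.
    apply: section_ext => y; apply/matrixP => i j.
    by rewrite !mxE simD simM addrA.
  rewrite [LHS](good_linearr hT)//; last by apply: nD => //; exact: nz.
  rewrite [X in _ + X = _](good_linearr hT)//.
  rewrite -(re_conn x v s) -(im_conn x v s) -(im_conn x v t).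
  by apply/matrixP => i j; rewrite !mxE [RHS]simD simM addrA.
- move=> x v f s A oA Ax sf sA; have [s1 s2] := (tangent_smooth_re s oA).1 sA.
  apply: cl.
    rewrite (_ : re_field _ = fun y => f y *: re_field s y); last first.
      by apply: section_ext => y; apply/matrixP => i j; rewrite !mxE sre_injM.
    rewrite [LHS](good_leibniz hT v oA)// -re_conn.
    by apply/matrixP => i j; rewrite !mxE [RHS]sreD !sre_injM.
  rewrite (_ : im_field _ = fun y => f y *: im_field s y); last first.
    by apply: section_ext => y; apply/matrixP => i j; rewrite !mxE sim_injM.
  rewrite [LHS](good_leibniz hT v oA)// -im_conn.
  by apply/matrixP => i j; rewrite !mxE [RHS]simD !sim_injM.
move=> A X s oA sX sA; have [s1 s2] := (tangent_smooth_re s oA).1 sA.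
apply/(tangent_smooth_re _ oA); split.
  rewrite (_ : re_field _ = fun x => D x (X x) (re_field s)); last first.
    by apply: section_ext => y; rewrite -re_conn.
  exact: (good_smooth hT oA sX s1).
rewrite (_ : im_field _ = fun x => D x (X x) (im_field s)); last first.
  by apply: section_ext => y; rewrite -im_conn.
exact: (good_smooth hT oA sX s2).
Qed.

(** The Leibniz rule X(f) Y = nabla_X (f Y) - f nabla_X Y, applied to the
    vector fields Y of a local frame, shows that X(f) is smooth. *)
Lemma dfun_smooth (A : set M) (X : section (tangent M S0)) (f : M -> R) :
  open A -> smooth_on A X -> smooth_fun_on A f ->
  smooth_fun_on A (fun x => dfun x (X x) f).
Proof.
move=> oA sX sf; have [k _|n0] := pickP 'I_n; last first.
  (* In dimension 0 there are no frame fields, but X vanishes. *)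
  apply: smooth_fun_ext (smooth_fun_cst 0 oA) => // x _.
  rewrite (_ : X x = 0); first by rewrite /dfun derive0.
  by apply/rowP => i; have := n0 i.
apply: smooth_fun_cover => x Ax; pose i := @chart_at _ _ M x.
pose B := A `&` @cdom _ _ M i; have oB : open B by apply: openI => //; exact: cdom_open.
exists B; split; first by split => //; exact: cdom_chart_at.
pose Y : section (tangent M S0) := @frame _ _ _ _ (tangent M S0) i k.
have sY : smooth_on B Y by apply: smooth_sub (smooth_frame hT k) => y [].
have sfB : smooth_fun_on B f by apply: smooth_fun_sub sf => y [].
have sXB : smooth_on B X by apply: smooth_sub sX => y [].
have sfY : smooth_on B (fun y => sinj S0 (f y) *: Y y).
  by apply: (smoothZ hT) => //; apply: smooth_scal_inj.
have sfC : smooth_on B (fun y => sinj S0 (f y) *: conn y (X y) Y).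
  apply: (smoothZ hT) => //; first exact: smooth_scal_inj.
  exact: (good_smooth hT).
have := smoothB hT oB (good_smooth hT oB sXB sfY) sfC.
have BB : B `&` @cdom _ _ M i = B by rewrite /B -setIA setIid.
move=> /(_ i k)[+ _]; rewrite [X in smooth_fun_on X]BB.
apply: smooth_fun_ext => // y By.
rewrite (good_leibniz hT _ oB)// addrK (trivZ hT); last by case: By.
have dy : tdom (tangent M S0) i y by case: By.
by rewrite /Y /frame (trivVK hT dy) !mxE !eqxx mulr1.
Qed.

Lemma dscal_smooth (A : set M) (X : section (tangent M S0)) (f : M -> S) :
  open A -> smooth_on A X -> smooth_scal_on A f ->
  smooth_scal_on A (fun x => dscal x (X x) f).
Proof.
move=> oA sX [s1 s2]; split.
  by apply: smooth_fun_ext (dfun_smooth oA sX s1) => // x _; rewrite sre_dscal.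
by apply: smooth_fun_ext (dfun_smooth oA sX s2) => // x _; rewrite sim_dscal.
Qed.

Lemma trivial_smoothP N (A : set M) (s : section (trivial_bundle S M N)) :
  smooth_on A s <-> forall k, smooth_scal_on A (fun x => (s x : 'rV[S]_N) 0 k).
Proof.
split=> [h k|h [] k]; first by have := h tt k; rewrite /= setIT.
by have := h k; rewrite /= setIT.
Qed.

Lemma trivial_good N : good_bundle (trivial_bundle S M N).
Proof.
have vbT : is_vector_bundle (trivial_bundle S M N).
  split=> [//|i|//|//|//|i j k l]; first exact: openT.
  by apply: smooth_scal_cst; rewrite /= setIT; exact: openT.
have entry x (s : section (trivial_bundle S M N)) k : smooth_near x s ->
    exists A, [/\ open A, A x & smooth_scal_on A (fun y => (s y : 'rV[S]_N) 0 k)].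
  by move=> [A [oA Ax /trivial_smoothP sA]]; exists A.
split.
- exact: vbT.
- move=> x; split.
  + move=> a u v w; rewrite /= mulr_sumr -big_split /=; apply: eq_bigr => k _.
    by rewrite !mxE mulrDl mulrA.
  + move=> u v; rewrite /= rmorph_sum; apply: eq_bigr => k _.
    by rewrite rmorphM /= sconjK mulrC.
  move=> u /rV0Pn[k uk] /=; rewrite sre_sum.
  have nn (z : S) : 0 <= sre (z * sconj z).
    by rewrite mul_conj sre_inj addr_ge0// sqr_ge0.
  rewrite (bigD1 k)//=; apply: ltr_pwDl; last by apply: sumr_ge0.
  rewrite lt_neqAle nn andbT eq_sym mul_conj sre_inj paddr_eq0 ?sqr_ge0// !sqrf_eq0.
  apply: contra_neqN uk => /andP[/eqP e1 /eqP e2]; apply: scal_eq.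
    by rewrite e1 sre0.
  by rewrite e2 sim0.
- move=> x v s t _ st; apply/rowP => k; rewrite !mxE; apply: dscal_near.
  by apply: filterS st => y ->.
- move=> x a v w s hs; apply/rowP => k; rewrite !mxE.
  by have [A [oA Ax sA]] := entry _ _ k hs; rewrite (dscal_linear oA Ax).
- move=> x a v s t hs ht; apply/rowP => k; rewrite !mxE.
  have [A [oA Ax /trivial_smoothP sA /trivial_smoothP sB]] := smooth_near2 hs ht.
  under eq_fun do rewrite !mxE.
  have sC := smooth_scal_cst a oA.
  rewrite (dscalD oA Ax) ?(dscalM oA Ax) ?dscal_cst ?mulr0 ?addr0//.
  exact: smooth_scalM.
- move=> x v f s A oA Ax sf /trivial_smoothP sA; apply/rowP => k; rewrite !mxE.
  under eq_fun do rewrite !mxE.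
  have sC := smooth_scal_inj S oA sf.
  by rewrite (dscalM oA Ax)// dscal_inj addrC [_ * sinj _ _]mulrC.
move=> A X s oA sX /trivial_smoothP sA; apply/trivial_smoothP => k.
apply: smooth_scal_ext (dscal_smooth oA sX (sA k)) => // x _.
by rewrite mxE.
Qed.

End tangent_good.

(** * Covariant derivatives and C_b^infinity *)

Section covariant_derivatives.
Local Open Scope ring_scope.
Variables (R : realType) (n : nat) (M : riemannian R n).
Let S0 := real_scalars R.

Section one_bundle.
Variable S : scalars R.

Definition cplx (r : 'rV[R]_n) : 'rV[S]_n := map_mx (sinj S) r.

Lemma cplx_delta l : cplx (delta_mx 0 l) = delta_mx 0 l.
Proof. exact: map_delta_mx. Qed.

Lemma cplx_herm (x : M) (u v : 'rV[R]_n) :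
  herm (cplx u : tangent M S x) (cplx v : tangent M S x) =
  sinj S (herm (u : tangent M S0 x) (v : tangent M S0 x)).
Proof.
rewrite !tangent_hermE rmorph_sum; apply: eq_bigr => k _.
rewrite rmorph_sum; apply: eq_bigr => l _.
by rewrite !mxE sconj_inj sconj_real !rmorphM.
Qed.

Lemma cplx_norm (x : M) (u : 'rV[R]_n) :
  sre (herm (cplx u : tangent M S x) (cplx u : tangent M S x)) =
  herm (u : tangent M S0 x) (u : tangent M S0 x).
Proof. by rewrite cplx_herm sre_inj. Qed.

Lemma cplx_onb (x : M) (J : finType) (f : J -> tangent M S0 x) :
  onb (@herm _ _ _ _ (tangent M S0) x) f ->
  onb (@herm _ _ _ _ (tangent M S) x) (fun j => cplx (f j)).
Proof.
move=> [fo fs]; split; first by move=> i j; rewrite cplx_herm fo rmorph_nat.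
have hr (r : 'rV[R]_n) : cplx r =
    \sum_j herm (cplx r : tangent M S x) (cplx (f j) : tangent M S x) *: cplx (f j).
  rewrite {1}(fs r) /cplx (raddf_sum (map_mx (sinj S))); apply: eq_bigr => j _.
  rewrite cplx_herm; exact: (map_mxZ (sinj S) _ (f j : 'rV[R]_n)).
move=> v.
have -> : v = cplx (map_mx (@sre R S) v) + si S *: cplx (map_mx (@sim R S) v).
  by apply/matrixP => i j; rewrite !mxE -s_decomp.
have ipT := tangent_ip S x.
set a := map_mx _ v; set b := map_mx (@sim R S) v.
rewrite {1}(hr a) {1}(hr b) scaler_sumr -big_split.
apply: eq_bigr => j _; pose c := cplx (f j).
transitivity ((herm (cplx a : tangent M S x) (c : tangent M S x)
   + si S * herm (cplx b : tangent M S x) (c : tangent M S x)) *: c).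
  by rewrite [RHS]scalerDl -[X in _ = _ + X]scalerA.
congr (_ *: c); rewrite -(ipZl ipT); symmetry; exact: (ipDl ipT).
Qed.

(** Real tangent vectors span the complexified tangent space. *)
Lemma hom_cplx_ext (V : vectType S) (a b : 'Hom('rV[S]_n, V)) :
  (forall r, a (cplx r) = b (cplx r)) -> a = b.
Proof.
move=> ab; apply/lfunP => u; rewrite [u]row_sum_delta !linear_sum.
by apply: eq_bigr => l _; rewrite !linearZ /= -cplx_delta ab.
Qed.

Lemma frame_cplx (i : cidx M) (k : 'I_n) (x : M) :
  @frame _ _ _ _ (tangent_vb S M) i k x = cplx (@frame _ _ _ _ (tangent_vb S0 M) i k x).
Proof.
rewrite /frame /= -(map_delta_mx (sinj S)) -map_mxM; congr map_mx; congr mulmx.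
by apply/matrixP => a b; rewrite !mxE.
Qed.

Variables (V : hbdata S M) (hV : good_bundle V).
Implicit Types (s t : section V).

Definition N2 (E : hbdata S M) (x : M) (u : E x) : R := sre (herm u u).

Lemma cotensor_good : good_bundle (cotensor V).
Proof. exact: hom_good (tangent_good M S) hV. Qed.

Lemma N2_cotensor (x : M) (J : finType) (f : J -> tangent M S0 x) (a : cotensor V x) :
  onb (@herm _ _ _ _ (tangent M S0) x) f ->
  N2 a = \sum_j N2 ((a : 'Hom('rV[S]_n, V x)) (cplx (f j))).
Proof.
move=> /cplx_onb fo; rewrite /N2 -sre_sum; congr sre.
exact: (hom_hermE (tangent_ip S x) (good_ip hV x) _ _ fo).
Qed.

Lemma nablaE s x v :
  (nabla s x : 'Hom('rV[S]_n, V x)) v = \sum_l v 0 l *: conn x (delta_mx 0 l) s.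
Proof.
rewrite /nabla linfunE// => a u w; rewrite scaler_sumr -big_split /=.
by apply: eq_bigr => l _; rewrite !mxE scalerDl scalerA.
Qed.

(** By linearity of the connection in the direction. *)
Lemma nabla_cplx s x r : smooth_near x s ->
  (nabla s x : 'Hom('rV[S]_n, V x)) (cplx r) = conn x r s.
Proof.
move=> hs; rewrite nablaE (conn_vlinear hV _ hs).
by apply: eq_bigr => l _; rewrite mxE.
Qed.

Lemma nabla_smooth A s : open A -> smooth_on A s -> smooth_on A (nabla s).
Proof.
move=> oA sA; apply/(hom_smoothP (tangent_good M S) hV _ oA) => i k.
have oAi : open (A `&` @cdom _ _ M i) by apply: openI => //; exact: cdom_open.
have sX : smooth_on (A `&` @cdom _ _ M i) (@frame _ _ _ _ (tangent_vb S0 M) i k).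
  by apply: smooth_sub (smooth_frame (tangent_good M S0) k) => y [].
have sAi : smooth_on (A `&` @cdom _ _ M i) s by apply: smooth_sub sA => y [].
apply: (smooth_ext hV oAi) (good_smooth hV oAi sX sAi) => x Ax.
by rewrite frame_cplx nabla_cplx//; exists (A `&` @cdom _ _ M i).
Qed.

Lemma nablaD s t : smooth s -> smooth t ->
  nabla (fun x => s x + t x) = (fun x => nabla s x + nabla t x).
Proof.
move=> ss st; apply: section_ext => x; apply/lfunP => v.
have hs : smooth_near x s by exists setT; split => //; exact: openT.
have ht : smooth_near x t by exists setT; split => //; exact: openT.
rewrite lfunE /= !nablaE -big_split /=; apply: eq_bigr => l _.
by rewrite (connD hV)// scalerDr.
Qed.

Lemma nablaZ (c : S) s : smooth s ->
  nabla (fun x => c *: s x) = (fun x => c *: nabla s x).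
Proof.
move=> ss; apply: section_ext => x; apply/lfunP => v.
have hs : smooth_near x s by exists setT; split => //; exact: openT.
rewrite lfunE /= !nablaE scaler_sumr; apply: eq_bigr => l _.
by rewrite (connZ hV)// scalerA mulrC -scalerA.
Qed.

End one_bundle.

Section derivative_bounds.
Variable S : scalars R.

Definition bounded2 (V : hbdata S M) (s : section V) : Prop :=
  exists C : R, forall x, N2 (s x) <= C.

(** Bounds on the covariant derivatives up to order k, iterated from the
    inside: the derivatives of s of positive order are those of nabla s. *)
Fixpoint Cbk (k : nat) (V : hbdata S M) (s : section V) : Prop :=
  bounded2 s /\ (if k is k'.+1 then @Cbk k' (cotensor V) (nabla s) else True).

Lemma bounded_sectionE (V : hbdata S M) (s : section V) : good_bundle V ->
  bounded_section s <-> bounded2 s.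
Proof.
move=> hV; split=> -[C hC].
  exists (C ^+ 2) => x; have n0 := ip_ge0 (good_ip hV x) (s x).
  rewrite -[N2 _]sqr_sqrtr//; apply: (lerXn2r 2 _ _ (hC x)); rewrite nnegrE.
    exact: sqrtr_ge0.
  by apply: le_trans (hC x); exact: sqrtr_ge0.
by exists (Num.sqrt C) => x; exact: (ler_wsqrtr (hC x)).
Qed.

Lemma iter_cotensor_good (V : hbdata S M) k : good_bundle V ->
  good_bundle (cotensor_iter k V).
Proof. by move=> hV; elim: k => //= k IH; exact: cotensor_good. Qed.

Let pack := {V : hbdata S M & section V}.
Let step (p : pack) : pack := existT _ (cotensor (projT1 p)) (nabla (projT2 p)).
Let bdd (p : pack) : Prop := bounded2 (projT2 p).

Let pack_iter (V : hbdata S M) (s : section V) j :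
  existT (fun V : hbdata S M => section V) (cotensor_iter j V) (nabla_iter j s) =
  iter j step (existT _ V s).
Proof. by elim: j => //= j <-. Qed.

(** The successive derivatives live in different bundles.  Pairing each bundle with
    a section makes nabla an endofunction, whose iterates may be unfolded from
    either end. *)
Lemma CbkP (V : hbdata S M) (s : section V) k : good_bundle V ->
  Cbk k s <-> forall j, (j <= k)%N -> bounded_section (nabla_iter j s).
Proof.
move=> hV.
have E j : bounded_section (nabla_iter j s) <-> bdd (iter j step (existT _ V s)).
  rewrite -pack_iter; apply: bounded_sectionE; exact: iter_cotensor_good.
suff H : Cbk k s <-> forall j, (j <= k)%N -> bdd (iter j step (existT _ V s)).
  by split=> [/H h j /h /E|h]; last by apply/H => j /h /E.
elim: k V s {hV E} => [|k IH] V s.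
  split=> [[h _] [|//] _ //|h]; split => //; exact: (h 0%N).
split=> [[h /IH h'] [|j] jk //|h].
  by rewrite iterSr; exact: h'.
split; first exact: (h 0%N).
by apply/IH => j jk; have := h j.+1 jk; rewrite iterSr.
Qed.

Lemma Cb_infP (V : hbdata S M) (s : section V) : good_bundle V ->
  Cb_inf s <-> smooth s /\ forall k, Cbk k s.
Proof.
move=> hV; split=> -[ss h]; split => // k; first by apply/CbkP => // j _.
by have /(CbkP s k hV) := h k; apply.
Qed.

Lemma CbkS k (V : hbdata S M) (s : section V) : Cbk k.+1 s -> Cbk k s.
Proof.
elim: k V s => [|k IH] V s [h h']; first by split.
by split => //; exact: IH.
Qed.

Lemma CbkD k (V : hbdata S M) (s t : section V) : good_bundle V ->
  smooth s -> smooth t -> Cbk k s -> Cbk k t -> Cbk k (fun x => s x + t x).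
Proof.
elim: k V s t => [|k IH] V s t hV ss st [[C hC] hs] [[C' hC'] ht].
  split => //; exists (2 * C + 2 * C') => x.
  apply: le_trans (ip_parallelogram (good_ip hV x) _ _) _.
  by apply: lerD; rewrite ler_pM2l//; [exact: hC|exact: hC'].
split.
  exists (2 * C + 2 * C') => x.
  apply: le_trans (ip_parallelogram (good_ip hV x) _ _) _.
  by apply: lerD; rewrite ler_pM2l//; [exact: hC|exact: hC'].
rewrite nablaD//; apply: IH => //.
- exact: cotensor_good.
- exact: (nabla_smooth hV openT).
- exact: (nabla_smooth hV openT).
Qed.

Lemma CbkZ k (V : hbdata S M) (c : S) (s : section V) : good_bundle V ->
  smooth s -> Cbk k s -> Cbk k (fun x => c *: s x).
Proof.
have b (V' : hbdata S M) (s' : section V') : good_bundle V' -> bounded2 s' -> bounded2 (fun x => c *: s' x).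
  move=> hV [C hC]; exists ((sre c ^+ 2 + sim c ^+ 2) * C) => x.
  rewrite /N2 (ip_normZ (good_ip hV x)); apply: ler_wpM2l; last exact: hC.
  by rewrite addr_ge0// sqr_ge0.
elim: k V s => [|k IH] V s hV ss [h hs].
  by split => //; exact: b.
split; first exact: b.
rewrite nablaZ//; apply: IH => //; first exact: cotensor_good.
exact: (nabla_smooth hV openT).
Qed.

Section closure.
Variables (V : hbdata S M) (hV : good_bundle V).

Lemma Cb_infD (s t : section V) : Cb_inf s -> Cb_inf t -> Cb_inf (fun x => s x + t x).
Proof.
move=> /(Cb_infP _ hV)[ss hs] /(Cb_infP _ hV)[st ht]; apply/(Cb_infP _ hV); split.
  exact: (smoothD hV openT).
by move=> k; exact: CbkD.
Qed.

Lemma Cb_infZ (c : S) (s : section V) : Cb_inf s -> Cb_inf (fun x => c *: s x).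
Proof.
move=> /(Cb_infP _ hV)[ss hs]; apply/(Cb_infP _ hV); split.
  exact: (smoothZc hV c openT).
by move=> k; exact: CbkZ.
Qed.

(** All derivatives of positive order vanish. *)
Lemma Cbk_parallel k (s : section V) : bounded2 s ->
  (forall x v, conn x v s = 0) -> Cbk k s.
Proof.
have z0 (W : hbdata S M) : good_bundle W -> bounded2 (fun x => 0 : W x).
  by move=> hW; exists 0 => x; rewrite /N2 (ip0l (good_ip hW x)) sre0.
have nz (W : hbdata S M) (t : section W) : (forall x v, conn x v t = 0) ->
    nabla t = fun x => 0 : cotensor W x.
  move=> h; apply: section_ext => x; apply/lfunP => v; rewrite nablaE lfunE /=.
  by rewrite big1// => l _; rewrite h scaler0.
have Z j (W : hbdata S M) : good_bundle W -> Cbk j (fun x => 0 : W x).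
  elim: j W => [|j IH] W hW; split; try exact: z0; first by [].
  rewrite nz; last by move=> x v; exact: (conn0 hW).
  exact/IH/cotensor_good.
case: k => [|k] bs h; split => //.
by rewrite nz//; exact/Z/cotensor_good.
Qed.

Lemma Cb_inf_parallel (s : section V) : smooth s -> bounded2 s ->
  (forall x v, conn x v s = 0) -> Cb_inf s.
Proof. by move=> ss bs ps; apply/(Cb_infP _ hV); split => // k; exact: Cbk_parallel. Qed.

Lemma Cb_inf0 : Cb_inf (fun x => 0 : V x).
Proof.
apply: Cb_inf_parallel; first exact: (smooth0 hV openT).
  by exists 0 => x; rewrite /N2 (ip0l (good_ip hV x)) sre0.
by move=> x v; exact: (conn0 hV).
Qed.

End closure.
End derivative_bounds.
End covariant_derivatives.

(** * Parallel bilinear bundle maps *)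

(** Only real linearity is required, because a bundle with complex scalars is paired
    with the real tangent bundle, whose sections are the vector fields. *)
Record parallel_bilinear (R : realType) (n : nat) (M : riemannian R n)
    (S1 S2 S3 : scalars R) (V1 : hbdata S1 M) (V2 : hbdata S2 M) (V3 : hbdata S3 M)
    (B : forall x : M, V1 x -> V2 x -> V3 x) : Prop := {
  pb_linl : forall x (a : R) u u' w,
    (B x (sinj S1 a *: u + u') w = sinj S3 a *: B x u w + B x u' w)%R;
  pb_linr : forall x (a : R) u w w',
    (B x u (sinj S2 a *: w + w') = sinj S3 a *: B x u w + B x u w')%R;
  pb_smooth : forall (A : set M) (s : section V1) (t : section V2), open A ->
    smooth_on A s -> smooth_on A t ->
    smooth_on A ((fun x => B x (s x) (t x)) : section V3);
  pb_conn : forall x v (s : section V1) (t : section V2),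
    smooth_near x s -> smooth_near x t ->
    conn x v ((fun y => B y (s y) (t y)) : section V3) =
    (B x (conn x v s) (t x) + B x (s x) (conn x v t))%R;
  pb_bounded : exists C : R, (0 <= C)%R /\
    forall x (u : V1 x) (w : V2 x), (N2 (B x u w) <= C * N2 u * N2 w)%R }.

Section parallel_bilinear_maps.
Local Open Scope ring_scope.
Variables (R : realType) (n : nat) (M : riemannian R n).
Let S0 := real_scalars R.

Section extension.
Variables (S1 S2 S3 : scalars R).
Variables (V1 : hbdata S1 M) (V2 : hbdata S2 M) (V3 : hbdata S3 M).
Variables (B : forall x : M, V1 x -> V2 x -> V3 x).

Definition bil_flip : forall x : M, V2 x -> V1 x -> V3 x := fun x w u => B u w.

(** The extension of B to V1-valued covectors, complex linear in the tangent
    vector even when V1 is real. *)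
Definition bil_ext (x : M) (a : cotensor V1 x) (w : V2 x) : cotensor V3 x :=
  linfun (fun v : 'rV[S3]_n =>
    \sum_l v 0 l *: B ((a : 'Hom('rV[S1]_n, V1 x)) (delta_mx 0 l)) w).

Hypotheses (h1 : good_bundle V1) (h2 : good_bundle V2) (h3 : good_bundle V3).
Hypothesis hB : parallel_bilinear B.

Lemma bil_flip_parallel : parallel_bilinear bil_flip.
Proof.
case: hB => b1 b2 b3 b4 [C [C0 b5]]; split.
- by move=> x a w w' u; exact: b2.
- by move=> x a w u u'; exact: b1.
- by move=> A s t oA hs ht; exact: b3.
- by move=> x v s t hs ht; rewrite addrC; exact: b4.
- by exists C; split => // x w u; rewrite -mulrA [N2 w * _]mulrC mulrA; exact: b5.
Qed.

Lemma pbDl x u u' w : B (x := x) (u + u') w = B u w + B u' w.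
Proof. by have := pb_linl hB 1 u u' w; rewrite !rmorph1 !scale1r. Qed.

Lemma pb0l x w : B (x := x) 0 w = 0.
Proof. by apply: (addrI (B (x := x) 0 w)); rewrite -pbDl !addr0. Qed.

Lemma pbZl x (a : R) u w : B (x := x) (sinj S1 a *: u) w = sinj S3 a *: B u w.
Proof. by have := pb_linl hB a u 0 w; rewrite pb0l !addr0. Qed.

Lemma bil_extE x a w v :
  (bil_ext (x := x) a w : 'Hom('rV[S3]_n, V3 x)) v =
  \sum_l v 0 l *: B ((a : 'Hom('rV[S1]_n, V1 x)) (delta_mx 0 l)) w.
Proof.
rewrite /bil_ext linfunE// => c u u'; rewrite scaler_sumr -big_split /=.
by apply: eq_bigr => l _; rewrite !mxE scalerDl scalerA.
Qed.

Lemma bil_ext_cplx x a w r :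
  (bil_ext (x := x) a w : 'Hom('rV[S3]_n, V3 x)) (cplx S3 r) =
  B ((a : 'Hom('rV[S1]_n, V1 x)) (cplx S1 r)) w.
Proof.
rewrite bil_extE [cplx S1 r]row_sum_delta linear_sum.
rewrite (big_morph (fun u => B u w) (fun u u' => pbDl u u' w) (pb0l w)).
by apply: eq_bigr => l _; rewrite linearZ !mxE pbZl.
Qed.

Lemma bil_ext_smooth A (a : section (cotensor V1)) (t : section V2) : open A ->
  smooth_on A a -> smooth_on A t ->
  smooth_on A ((fun x => bil_ext (a x) (t x)) : section (cotensor V3)).
Proof.
move=> oA sa st; apply/(hom_smoothP (tangent_good M S3) h3 _ oA) => i k.
have oAi : open (A `&` @cdom _ _ M i) by apply: openI => //; exact: cdom_open.
have st' : smooth_on (A `&` @cdom _ _ M i) t.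
  by apply: smooth_sub st => y [].
have sa' := (hom_smoothP (tangent_good M S1) h1 a oA).1 sa i k.
apply: (smooth_ext h3 oAi) (pb_smooth hB oAi sa' st') => x _.
by rewrite (frame_cplx S1) (frame_cplx S3) bil_ext_cplx.
Qed.

Lemma bil_smooth_near x (s : section V1) (t : section V2) :
  smooth_near x s -> smooth_near x t ->
  smooth_near x ((fun y => B (s y) (t y)) : section V3).
Proof.
move=> hs ht; have [A [oA Ax sA sA']] := smooth_near2 hs ht.
by exists A; split => //; exact: (pb_smooth hB).
Qed.

Lemma const_lift x r (S : scalars R) : exists X : section (tangent M S0),
  [/\ X x = r, smooth_near x X & smooth_near x (lift_field S X)].
Proof.
exists (const_section (r : tangent M S0 x)).
have hT := tangent_good M S0.
split; first exact: (const_sectionE hT).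
  exact: (smooth_near_const hT).
have [A [oA Ax sA]] := smooth_near_const hT (r : tangent M S0 x).
by exists A; split => //; exact: lift_smooth.
Qed.

(** To differentiate an extended map along real vectors, test it on lifts of
    real vector fields, where it is given by B itself. *)
Lemma bil_ext_parallel : parallel_bilinear bil_ext.
Proof.
split.
- move=> x a u u' w; apply: hom_cplx_ext => r.
  rewrite !lfunE /= lfunE /= !bil_ext_cplx.
  by rewrite lfunE /= lfunE /= (pb_linl hB).
- move=> x a u w w'; apply: hom_cplx_ext => r.
  rewrite !lfunE /= lfunE /= !bil_ext_cplx.
  by rewrite (pb_linr hB).
- exact: bil_ext_smooth.
- move=> x v a t ha ht; apply: hom_cplx_ext => r.
  have [X [Xx sX _]] := const_lift (r : tangent M S0 x) S0.
  have [A [oA Ax sA]] := sX.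
  have sX1 : smooth_near x (lift_field S1 X) by exists A; split => //; exact: lift_smooth.
  have sX3 : smooth_near x (lift_field S3 X) by exists A; split => //; exact: lift_smooth.
  have hb : smooth_near x ((fun y => bil_ext (a y) (t y)) : section (cotensor V3)).
    have [A' [oA' Ax' sA1 sA2]] := smooth_near2 ha ht.
    by exists A'; split => //; exact: bil_ext_smooth.
  have L1 := hom_leibniz (tangent_good M S1) h1 v ha sX1.
  have L3 := hom_leibniz (tangent_good M S3) h3 v hb sX3.
  rewrite !conn_lift in L1 L3.
  have sa1 := hom_apply_smooth_near (tangent_good M S1) h1 ha sX1.
  have P := pb_conn hB v sa1 ht.
  rewrite L1 pbDl in P.
  have E : (fun y : M => (bil_ext (a y) (t y) : 'Hom('rV[S3]_n, V3 y)) (lift_field S3 X y)) =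
    (fun y => B ((a y : 'Hom('rV[S1]_n, V1 y)) (lift_field S1 X y)) (t y)).
    by apply: section_ext => y; exact: bil_ext_cplx.
  rewrite [in LHS]E {}P in L3.
  rewrite lfunE /= !bil_ext_cplx.
  have Er S : lift_field S X x = cplx S r by rewrite /lift_field Xx.
  rewrite !Er [X in _ = _ + X]bil_ext_cplx in L3.
  by apply: (addIr (B ((a x : 'Hom('rV[S1]_n, V1 x)) (cplx S1 (conn x v X))) (t x)));
    rewrite -L3 addrAC.
have [C [C0 hC]] := pb_bounded hB; exists C; split => // x u w.
(* A real orthonormal basis of T_x M serves the covectors of both bundles. *)
have [J [f fo]] := onb_exists (tangent_ip S0 x).
rewrite (N2_cotensor h3 _ fo) (N2_cotensor h1 _ fo) mulr_sumr mulr_suml.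
by apply: ler_sum => j _; rewrite bil_ext_cplx; exact: hC.
Qed.

End extension.

Lemma nabla_bil S1 S2 S3 (V1 : hbdata S1 M) (V2 : hbdata S2 M) (V3 : hbdata S3 M)
    (B : forall x : M, V1 x -> V2 x -> V3 x) (s : section V1) (t : section V2) :
  good_bundle V1 -> good_bundle V2 -> good_bundle V3 -> parallel_bilinear B ->
  smooth s -> smooth t ->
  nabla ((fun x => B x (s x) (t x)) : section V3) =
  (fun x => bil_ext B (nabla s x) (t x) +
            bil_flip (bil_ext (bil_flip B)) (s x) (nabla t x)).
Proof.
move=> h1 h2 h3 hB ss st; apply: section_ext => x; apply: hom_cplx_ext => r.
have ns : smooth_near x s by exists setT; split => //; exact: openT.
have nt : smooth_near x t by exists setT; split => //; exact: openT.
rewrite lfunE /= (nabla_cplx h3); last exact: (bil_smooth_near hB).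
rewrite (bil_ext_cplx hB) (bil_ext_cplx (bil_flip_parallel hB)).
by rewrite (nabla_cplx h1 r ns) (nabla_cplx h2 r nt) (pb_conn hB).
Qed.

Lemma bounded2_bil S1 S2 S3 (V1 : hbdata S1 M) (V2 : hbdata S2 M) (V3 : hbdata S3 M)
    (B : forall x : M, V1 x -> V2 x -> V3 x) (s : section V1) (t : section V2) :
  good_bundle V1 -> good_bundle V2 -> parallel_bilinear B ->
  bounded2 s -> bounded2 t -> bounded2 ((fun x => B x (s x) (t x)) : section V3).
Proof.
move=> h1 h2 hB [D hD] [D' hD']; have [C [C0 hC]] := pb_bounded hB.
exists (C * D * D') => x; apply: le_trans (hC x _ _) _; apply: ler_pM.
- by apply: mulr_ge0 => //; exact: (ip_ge0 (good_ip h1 x)).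
- exact: (ip_ge0 (good_ip h2 x)).
- exact: ler_wpM2l.
- exact: hD'.
Qed.

(** Induction on k for all B at once: by [nabla_bil], the derivative of B(s, t) is
    a sum of two values of extensions of B, which are again parallel and
    bounded. *)
Lemma Cbk_bil k S1 S2 S3 (V1 : hbdata S1 M) (V2 : hbdata S2 M) (V3 : hbdata S3 M)
    (B : forall x : M, V1 x -> V2 x -> V3 x) (s : section V1) (t : section V2) :
  good_bundle V1 -> good_bundle V2 -> good_bundle V3 -> parallel_bilinear B ->
  smooth s -> smooth t -> Cbk k s -> Cbk k t ->
  Cbk k ((fun x => B x (s x) (t x)) : section V3).
Proof.
elim: k V1 V2 V3 B s t => [|k IH] V1 V2 V3 B s t h1 h2 h3 hB ss st cs ct.
  by split => //; exact: (bounded2_bil h1 h2 hB cs.1 ct.1).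
split; first exact: (bounded2_bil h1 h2 hB cs.1 ct.1).
rewrite (nabla_bil h1 h2 h3 hB ss st).
have sB1 : parallel_bilinear (bil_ext B) by exact: bil_ext_parallel.
have sB2 : parallel_bilinear (bil_flip (bil_ext (bil_flip B))).
  apply: bil_flip_parallel; apply: bil_ext_parallel => //; exact: bil_flip_parallel.
have ns := nabla_smooth h1 openT ss; have nt := nabla_smooth h2 openT st.
have gs := cotensor_good h1; have gt := cotensor_good h2; have g3 := cotensor_good h3.
apply: CbkD => //.
- by apply: (pb_smooth sB1) => //; exact: openT.
- by apply: (pb_smooth sB2) => //; exact: openT.
- by apply: (IH (cotensor V1) V2 (cotensor V3)) => //; [exact: cs.2|exact: CbkS].
- by apply: (IH V1 (cotensor V2) (cotensor V3)) => //; [exact: CbkS|exact: ct.2].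
Qed.

Lemma Cb_inf_bil S1 S2 S3 (V1 : hbdata S1 M) (V2 : hbdata S2 M) (V3 : hbdata S3 M)
    (B : forall x : M, V1 x -> V2 x -> V3 x) (s : section V1) (t : section V2) :
  good_bundle V1 -> good_bundle V2 -> good_bundle V3 -> parallel_bilinear B ->
  Cb_inf s -> Cb_inf t -> Cb_inf ((fun x => B x (s x) (t x)) : section V3).
Proof.
move=> h1 h2 h3 hB /(Cb_infP _ h1)[ss cs] /(Cb_infP _ h2)[st ct].
apply/(Cb_infP _ h3); split; first by apply: (pb_smooth hB) => //; exact: openT.
by move=> k; exact: Cbk_bil.
Qed.

End parallel_bilinear_maps.

(** * Composition, evaluation and tensor product with a vector field *)

Section tensor_operations.
Local Open Scope ring_scope.
Variables (R : realType) (n : nat) (M : riemannian R n) (S : scalars R).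
Let S0 := real_scalars R.
Local Notation TR := (tangent M S0).
Let hT := tangent_good M S0.

Section composition.
Variables (E F G : hbdata S M).
Hypotheses (hE : good_bundle E) (hF : good_bundle F) (hG : good_bundle G).

Definition hom_comp (x : M) (a : hom_bundle F G x) (b : hom_bundle E F x) :
    hom_bundle E G x :=
  ((a : 'Hom(F x, G x)) \o (b : 'Hom(E x, F x)))%VF.

Lemma hom_compE x a b v :
  (hom_comp (x := x) a b : 'Hom(E x, G x)) v = (a : 'Hom(F x, G x)) ((b : 'Hom(E x, F x)) v).
Proof. exact: comp_lfunE. Qed.

Lemma hom_comp_parallel : parallel_bilinear hom_comp.
Proof.
split.
- move=> x a u u' w; apply/lfunP => v; rewrite add_lfunE scale_lfunE !hom_compE.
  by rewrite add_lfunE scale_lfunE.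
- move=> x a u w w'; apply/lfunP => v.
  by rewrite add_lfunE scale_lfunE !hom_compE add_lfunE scale_lfunE linearP.
- move=> A s t oA sA tA; apply/(hom_smoothP hE hG _ oA) => i k.
  have oAi : open (A `&` tdom E i) by exact: (opentd hE).
  have sAi : smooth_on (A `&` tdom E i) s.
    by apply: smooth_sub sA => y [].
  have := hom_apply_smooth hF hG oAi sAi ((hom_smoothP hE hF _ oA).1 tA i k).
  by apply: (smooth_ext hG oAi) => x _; rewrite hom_compE.
- move=> x v s t hs ht; apply/lfunP => u.
  have hu := smooth_near_const hE u; set ut := const_section u in hu.
  have ux : ut x = u by exact: (const_sectionE hE).
  have hst : smooth_near x ((fun y => hom_comp (s y) (t y)) : section (hom_bundle E G)).
    have [A [oA Ax sA tA]] := smooth_near2 hs ht.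
    exists A; split => //; apply/(hom_smoothP hE hG _ oA) => i k.
    have oAi : open (A `&` tdom E i) by exact: (opentd hE).
    have sAi : smooth_on (A `&` tdom E i) s.
      by apply: smooth_sub sA => y [].
    have := hom_apply_smooth hF hG oAi sAi ((hom_smoothP hE hF _ oA).1 tA i k).
    by apply: (smooth_ext hG oAi) => y _; rewrite hom_compE.
  have L := hom_leibniz hE hG v hst hu.
  have htu := hom_apply_smooth_near hE hF ht hu.
  have L1 := hom_leibniz hF hG v hs htu.
  have L2 := hom_leibniz hE hF v ht hu.
  rewrite L2 linearD ux in L1.
  have e : (fun y => (hom_comp (s y) (t y) : 'Hom(E y, G y)) (ut y)) =
     (fun y => (s y : 'Hom(F y, G y)) ((t y : 'Hom(E y, F y)) (ut y))).
    by apply: section_ext => y; rewrite hom_compE.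
  rewrite e L1 ux [X in _ = _ + X]hom_compE addrA in L.
  by rewrite add_lfunE !hom_compE; apply/esym; exact: (addIr _ L).
exists 1; split => // x a b; rewrite mul1r.
have [J [f fo]] := onb_exists (good_ip hE x).
rewrite /N2 [X in sre X <= _](hom_hermE (good_ip hE x) (good_ip hG x) _ _ fo).
rewrite [X in _ <= _ * sre X](hom_hermE (good_ip hE x) (good_ip hF x) _ _ fo).
rewrite sre_sum [X in _ <= _ * X]sre_sum mulr_sumr; apply: ler_sum => j _; rewrite hom_compE.
exact: (hom_apply_bound (good_ip hF x) (good_ip hG x)).
Qed.

End composition.

Section tangent_operations.
Variables (V : hbdata S M).
Hypothesis hV : good_bundle V.

Definition ev_field (x : M) (X : TR x) (a : cotensor V x) : V x :=
  (a : 'Hom('rV[S]_n, V x)) (cplx S X).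

Lemma cplxP x (a : R) (X Y : TR x) :
  cplx S (a *: X + Y) = sinj S a *: cplx S X + cplx S Y.
Proof. by apply/matrixP => i j; rewrite !mxE rmorphD rmorphM. Qed.

Lemma N2_cplx x (X : TR x) : N2 (cplx S X : tangent M S x) = N2 X.
Proof. exact: cplx_norm. Qed.

Lemma ev_field_parallel : parallel_bilinear ev_field.
Proof.
split.
- by move=> x a u u' w; rewrite /ev_field cplxP linearP.
- by move=> x a u w w'; rewrite /ev_field add_lfunE scale_lfunE.
- move=> A s t oA sA tA.
  exact: (hom_apply_smooth (tangent_good M S) hV oA tA (lift_smooth oA sA)).
- move=> x v s t hs ht.
  have hs' : smooth_near x (lift_field S s).
    by have [A [oA Ax sA]] := hs; exists A; split => //; exact: lift_smooth.
  have := hom_leibniz (tangent_good M S) hV v ht hs'.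
  by rewrite conn_lift addrC.
exists 1; split => // x X a; rewrite mul1r mulrC -N2_cplx.
exact: (hom_apply_bound (tangent_ip S x) (good_ip hV x)).
Qed.

(** The covector v |-> g(v, Z) with coefficient u, for complex Z; it is conjugate
    linear in Z. *)
Definition tens_op (x : M) (Z : tangent M S x) (u : V x) : cotensor V x :=
  linfun (fun v : 'rV[S]_n => herm (v : tangent M S x) Z *: u).

Lemma tens_opE x Z u v :
  (tens_op (x := x) Z u : 'Hom('rV[S]_n, V x)) v = herm (v : tangent M S x) Z *: u.
Proof.
rewrite /tens_op linfunE// => a v1 v2.
by rewrite [X in X *: u = _](ip_linear (tangent_ip S x)) scalerDl scalerA.
Qed.

(** Parseval's identity for Z' in an orthonormal basis of the tangent space. *)
Lemma tens_op_herm x Z Z' (u u' : V x) :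
  herm (tens_op (x := x) Z u) (tens_op Z' u') = herm Z' Z * herm u u'.
Proof.
have ipT := tangent_ip S x; have ipV := good_ip hV x.
have [J [f fo]] := onb_exists ipT.
rewrite [LHS](hom_hermE ipT ipV _ _ fo) [in RHS](fo.2 Z') (ip_suml ipT) mulr_suml.
apply: eq_bigr => j _; rewrite !tens_opE (ipZl ipV) (ipZr ipV) (ipZl ipT).
by rewrite -(ip_conj ipT) mulrA [herm (f j) Z * _]mulrC.
Qed.

(** The tensor Z^flat (x) u. *)
Definition tens (x : M) (Z : TR x) (u : V x) : cotensor V x :=
  tens_op (cplx S Z : tangent M S x) u.

Lemma tens_cplx x Z u r :
  (tens (x := x) Z u : 'Hom('rV[S]_n, V x)) (cplx S r) = sinj S (herm (r : TR x) Z) *: u.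
Proof. by rewrite tens_opE cplx_herm. Qed.

Lemma tens_smooth A (Z : section TR) (u : section V) : open A ->
  smooth_on A Z -> smooth_on A u ->
  smooth_on A ((fun x => tens (Z x) (u x)) : section (cotensor V)).
Proof.
move=> oA sZ su; apply/(hom_smoothP (tangent_good M S) hV _ oA) => i k.
have oAi : open (A `&` @cdom _ _ M i) by apply: openI => //; exact: cdom_open.
have sZi : smooth_on (A `&` @cdom _ _ M i) Z.
  by apply: smooth_sub sZ => y [].
have sui : smooth_on (A `&` @cdom _ _ M i) u.
  by apply: smooth_sub su => y [].
have sf : smooth_on (A `&` @cdom _ _ M i) (@frame _ _ _ _ (tangent_vb S0 M) i k).
  by apply: smooth_sub (smooth_frame hT k) => y [].
have [sh _] := herm_smooth (rman_metric M) oAi sf sZi.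
have := smoothZ hV oAi (smooth_scal_inj S oAi sh) sui.
by apply: (smooth_ext hV oAi) => x _; rewrite (frame_cplx S) tens_cplx.
Qed.

Lemma herm_conn x v (X Y : section TR) : smooth_near x X -> smooth_near x Y ->
  dfun x v (fun y => herm (X y) (Y y)) =
  herm (conn x v X) (Y x) + herm (X x) (conn x v Y).
Proof.
move=> hX hY; rewrite -[RHS](conn_metric (rman_connection M) v hX hY).
by rewrite -[LHS](dscal_inj S0).
Qed.

(** The metric is parallel for the Levi-Civita connection. *)
Lemma tens_parallel : parallel_bilinear tens.
Proof.
have ipT (x : M) := tangent_ip S x.
split.
- move=> x a u u' w; apply: hom_cplx_ext => r.
  rewrite add_lfunE scale_lfunE !tens_cplx.
  rewrite [X in sinj S X](ipDr (tangent_ip S0 x)) [X in sinj S (X + _)](ipZr (tangent_ip S0 x)).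
  by rewrite sconj_real rmorphD rmorphM scalerDl scalerA.
- move=> x a u w w'; apply: hom_cplx_ext => r.
  rewrite add_lfunE scale_lfunE !tens_cplx scalerDr !scalerA; congr (_ *: _ + _).
  exact: mulrC.
- exact: tens_smooth.
- move=> x v Z u hZ hu; apply: hom_cplx_ext => r.
  have [X [Xx sX _]] := const_lift (r : TR x) S0.
  have [A [oA Ax sA]] := sX.
  have sXS : smooth_near x (lift_field S X) by exists A; split => //; exact: lift_smooth.
  have [A' [oA' Ax' sZ su]] := smooth_near2 hZ hu.
  have ht : smooth_near x ((fun y => tens (Z y) (u y)) : section (cotensor V)).
    by exists A'; split => //; exact: tens_smooth.
  have L := hom_leibniz (tangent_good M S) hV v ht sXS.
  have E : (fun y : M => (tens (Z y) (u y) : 'Hom('rV[S]_n, V y)) (lift_field S X y)) =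
    (fun y => sinj S (herm (X y) (Z y)) *: u y).
    by apply: section_ext => y; exact: tens_cplx.
  have oAA := openI oA oA'.
  have sh : smooth_fun_on (A `&` A') (fun y => herm (X y) (Z y)).
    apply: (herm_smooth (rman_metric M) oAA _ _).1.
      by apply: smooth_sub sA => y [].
    by apply: smooth_sub sZ => y [].
  have suA : smooth_on (A `&` A') u.
    by apply: smooth_sub su => y [].
  have P := good_leibniz hV v oAA (conj Ax Ax') sh suA.
  rewrite E {}P conn_lift in L.
  have Er (Y : section TR) : lift_field S Y x = cplx S (Y x) by [].
  rewrite !Er Xx [X in _ = _ + X]tens_cplx herm_conn// Xx rmorphD scalerDl in L.
  rewrite add_lfunE !tens_cplx.
  by apply: (addIr (sinj S (herm (conn x v X) (Z x)) *: u x)); rewrite -L -addrA addrC.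
exists 1; split => // x Z u; rewrite mul1r /N2 /tens tens_op_herm cplx_herm sre_injM.
by [].
Qed.

Lemma tens_linear x (Z : TR x) : linear (@tens x Z).
Proof.
move=> a u w; apply: hom_cplx_ext => r.
rewrite add_lfunE scale_lfunE !tens_cplx scalerDr !scalerA; congr (_ *: _ + _).
exact: mulrC.
Qed.

Lemma ev_field_linear x (X : TR x) : linear (@ev_field x X).
Proof. by move=> a u w; rewrite /ev_field add_lfunE scale_lfunE. Qed.

End tangent_operations.

Section precomposition.
Variables (V W F : hbdata S M) (b : forall x : M, TR x -> V x -> W x).

(** The composite of the coefficient a with b(Z, -).  Taking the two together, rather
    than b(Z, -) as a section of Hom(V, W), avoids its Hilbert-Schmidt norm, which
    grows with the rank of V. *)
Definition precomp (x : M) (a : hom_bundle W F x) (Z : TR x) : hom_bundle V F x :=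
  linfun (fun u : V x => (a : 'Hom(W x, F x)) (b Z u)).

Hypotheses (hV : good_bundle V) (hW : good_bundle W) (hF : good_bundle F) (hb : parallel_bilinear b).
Hypothesis blin : forall x Z, linear (@b x Z).

Lemma precompE x a Z u :
  (precomp (x := x) a Z : 'Hom(V x, F x)) u = (a : 'Hom(W x, F x)) (b Z u).
Proof. by rewrite /precomp linfunE// => c u1 u2; rewrite blin linearP. Qed.

Lemma precomp_smooth A (a : section (hom_bundle W F)) (Z : section TR) : open A ->
  smooth_on A a -> smooth_on A Z ->
  smooth_on A ((fun x => precomp (a x) (Z x)) : section (hom_bundle V F)).
Proof.
move=> oA sa sZ; apply/(hom_smoothP hV hF _ oA) => i k.
have oAi : open (A `&` tdom V i) by exact: (opentd hV).
have sai : smooth_on (A `&` tdom V i) a.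
  by apply: smooth_sub sa => y [].
have sZi : smooth_on (A `&` tdom V i) Z.
  by apply: smooth_sub sZ => y [].
have sf : smooth_on (A `&` tdom V i) (frame (E := V) k).
  by apply: smooth_sub (smooth_frame hV k) => y [].
have := hom_apply_smooth hW hF oAi sai (pb_smooth hb oAi sZi sf).
by apply: (smooth_ext hF oAi) => x _; rewrite precompE.
Qed.

Lemma precomp_parallel :
  (forall x a Z, N2 (precomp (x := x) a Z) <= N2 a * N2 Z) ->
  parallel_bilinear (precomp).
Proof.
move=> bound; split.
- move=> x a u u' w; apply/lfunP => v.
  by rewrite add_lfunE scale_lfunE !precompE add_lfunE scale_lfunE.
- move=> x a u w w'; apply/lfunP => v.
  by rewrite add_lfunE scale_lfunE !precompE (pb_linl hb) linearP.
- exact: precomp_smooth.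
- move=> x v a Z ha hZ; apply/lfunP => u.
  have hu := smooth_near_const hV u; set ut := const_section u in hu.
  have ux : ut x = u by exact: (const_sectionE hV).
  have hc : smooth_near x ((fun y => precomp (a y) (Z y)) : section (hom_bundle V F)).
    have [A [oA Ax sA sZ]] := smooth_near2 ha hZ.
    by exists A; split => //; exact: precomp_smooth.
  have hbu := bil_smooth_near hb hZ hu.
  have L1 := hom_leibniz hW hF v ha hbu.
  have L := hom_leibniz hV hF v hc hu.
  have e : (fun y => (precomp (a y) (Z y) : 'Hom(V y, F y)) (ut y)) =
     (fun y => (a y : 'Hom(W y, F y)) (b (Z y) (ut y))).
    by apply: section_ext => y; rewrite precompE.
  rewrite e L1 (pb_conn hb)// linearD ux addrA [X in _ = _ + X]precompE in L.
  by rewrite add_lfunE !precompE; apply/esym; exact: (addIr _ L).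
by exists 1; split => // x a Z; rewrite mul1r.
Qed.

End precomposition.


Section instances.
Variables (V F : hbdata S M) (hV : good_bundle V) (hF : good_bundle F).

(** For an orthonormal basis (f_j) of V, the Z^flat (x) f_j are orthogonal of
    length |Z|, so that Bessel's inequality applies to a. *)
Lemma precomp_tens_parallel :
  parallel_bilinear (precomp (F := F) (@tens V)).
Proof.
have hW := cotensor_good hV.
apply: precomp_parallel => //; [exact: tens_parallel|exact: tens_linear|].
move=> x a Z; have ipT := tangent_ip S0 x; have ipV := good_ip hV x.
have ipF := good_ip hF x; have ipW := good_ip hW x.
have [J [f fo]] := onb_exists ipV.
have NE : N2 (precomp (@tens V) a Z : hom_bundle V F x) =
   \sum_j N2 ((a : 'Hom(cotensor V x, F x)) (tens Z (f j))).
  rewrite /N2 [X in sre X = _](hom_hermE ipV ipF _ _ fo) sre_sum.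
  by apply: eq_bigr => j _; rewrite precompE//; exact: tens_linear.
rewrite NE; have [Z0|Z0] := eqVneq Z 0.
  rewrite big1; first by apply: mulr_ge0; [exact: (ip_ge0 (good_ip (hom_good hW hF) x))|exact: (ip_ge0 ipT)].
  move=> j _; rewrite (_ : tens Z (f j) = 0); last first.
    by rewrite Z0; apply: hom_cplx_ext => r; rewrite tens_cplx (ip0r ipT) rmorph0 scale0r lfunE.
  by rewrite linear0 /N2 (ip0l ipF) sre0.
have p : 0 < N2 Z := ip_pos ipT Z0; set c := (Num.sqrt (N2 Z))^-1.
have c2 : c ^+ 2 * N2 Z = 1 by rewrite exprVn sqr_sqrtr ?mulVf ?gt_eqF// ltW.
have orth : orthonormal_family (@herm _ _ _ _ (cotensor V) x)
    (fun j => sinj S c *: tens Z (f j)).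
  move=> i j; rewrite (ipZl ipW) (ipZr ipW).
  have -> : herm (tens Z (f i)) (tens Z (f j)) = sinj S (N2 Z) * (i == j)%:R.
    rewrite [LHS](tens_op_herm hV); congr (_ * _); last exact: fo.1.
    exact: cplx_herm.
  by rewrite sconj_inj !mulrA -!rmorphM -expr2 c2 rmorph1 mul1r.
have := hom_bessel ipW ipF a orth.
under eq_bigr do rewrite linearZ /= (ip_normZ ipF) sre_inj sim_inj expr0n addr0.
rewrite -mulr_sumr => h; rewrite -[leLHS]mul1r -c2 [leRHS]mulrC [_ * N2 Z]mulrC -mulrA.
by rewrite ler_pM2l.
Qed.


(** Compute the norm in the orthonormal basis of the e_i^flat (x) f_j: such an
    element is sent to <Z, e_i> a(f_j), and the squares of the <Z, e_i> sum up to
    |Z|^2. *)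
Lemma precomp_ev_field_parallel :
  parallel_bilinear (precomp (F := F) (@ev_field V)).
Proof.
have hW := cotensor_good hV.
apply: precomp_parallel => //; [exact: ev_field_parallel|exact: ev_field_linear|].
move=> x a Z; have ipT := tangent_ip S x; have ipV := good_ip hV x.
have ipF := good_ip hF x; have ipW := good_ip hW x.
have [J [f fo]] := onb_exists ipV.
have [I [e eo]] := onb_exists ipT.
have orth : onb (@herm _ _ _ _ (cotensor V) x)
    (fun p : I * J => tens_op (e p.1) (f p.2) : cotensor V x).
  split.
    move=> [i j] [i' j']; rewrite [LHS]tens_op_herm// eo.1 fo.1 -natrM mulnb.
    by congr (_ %:R); rewrite xpair_eqE eq_sym.
  move=> c; apply/lfunP => v; rewrite sum_lfunE [in LHS](eo.2 v) linear_sum.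
  transitivity (\sum_i \sum_j herm v (e i) *: (herm ((c : 'Hom('rV[S]_n, V x)) (e i)) (f j) *: f j)).
    by apply: eq_bigr => i _; rewrite linearZ -scaler_sumr -(fo.2 _).
  rewrite pair_big; apply: eq_bigr => -[i j] _ /=; rewrite scale_lfunE tens_opE.
  rewrite !scalerA; congr (_ *: _); rewrite mulrC; congr (_ * _).
  rewrite [RHS](hom_hermE ipT ipV _ _ eo) (bigD1 i)//= tens_opE eo.1 eqxx scale1r.
  rewrite big1 ?addr0// => i' /negbTE ii'.
  by rewrite tens_opE eo.1 ii' scale0r (ip0r ipV).
rewrite {1}/N2 [X in sre X <= _](hom_hermE ipW ipF _ _ orth).
rewrite [X in _ <= X * _]/N2 [X in _ <= sre X * _](hom_hermE ipV ipF _ _ fo).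
rewrite -N2_cplx sre_sum -(pair_big xpredT xpredT (fun i j => sre (herm
  ((precomp (@ev_field V) a Z : 'Hom(cotensor V x, F x)) (tens_op (e i) (f j)))
  ((precomp (@ev_field V) a Z : 'Hom(cotensor V x, F x)) (tens_op (e i) (f j)))))) /=.
have NZ : N2 (cplx S Z : tangent M S x) =
   \sum_i (sre (herm (cplx S Z : tangent M S x) (e i)) ^+ 2 + sim (herm (cplx S Z : tangent M S x) (e i)) ^+ 2).
  rewrite /N2 {1}(eo.2 (cplx S Z)) (ip_suml ipT) sre_sum; apply: eq_bigr => i _.
  by rewrite (ipZl ipT) (ip_conj ipT (cplx S Z) (e i)) mul_conj sre_inj.
rewrite NZ mulrC mulr_suml; apply: ler_sum => i _; rewrite sre_sum mulr_sumr.
apply: ler_sum => j _.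
have -> : (precomp (@ev_field V) a Z : 'Hom(cotensor V x, F x)) (tens_op (e i) (f j)) =
    herm (cplx S Z : tangent M S x) (e i) *: (a : 'Hom(V x, F x)) (f j).
  apply: etrans (precompE (@ev_field_linear V) a Z _) _.
  apply: etrans (congr1 (a : 'Hom(V x, F x)) (tens_opE (e i) (f j) (cplx S Z))) _.
  exact: linearZ.
by rewrite (ip_normZ ipF).
Qed.

End instances.
End tensor_operations.

(** * The Frechet system of generators *)

Section smooth_matrices.
Local Open Scope ring_scope.
Variables (R : realType) (n : nat) (S : scalars R) (M : manifold R n).

Lemma smooth_det m (A : set M) (G : M -> 'M[S]_m) : open A ->
  (forall i j, smooth_scal_on A (fun x => G x i j)) ->
  smooth_scal_on A (fun x => \det (G x)).
Proof.
move=> oA sG.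
apply: (smooth_scal_sum (index_enum _) oA) => s.
apply: smooth_scalM => //; first exact: smooth_scal_cst.
exact: (smooth_scal_prod (index_enum _) oA).
Qed.

Lemma smooth_scalV (A : set M) (f : M -> S) : open A -> (forall x, A x -> f x != 0) ->
  smooth_scal_on A f -> smooth_scal_on A (fun x => (f x)^-1).
Proof.
move=> oA f0 [s1 s2].
have sN : smooth_fun_on A (fun x => (sre (f x) * sre (f x) + sim (f x) * sim (f x))^-1).
  apply: smooth_funV => // [x Ax|]; last by apply: smooth_funD => //; exact: smooth_funM.
  rewrite -!expr2 paddr_eq0 ?sqr_ge0// !sqrf_eq0.
  apply: contra (f0 x Ax) => /andP[/eqP e1 /eqP e2]; apply/eqP/scal_eq.
    by rewrite e1 sre0.
  by rewrite e2 sim0.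
have sc : smooth_scal_on A (fun x => sconj (f x)).
  split; first by apply: smooth_fun_ext s1 => // x _; rewrite sre_conj.
  by apply: smooth_fun_ext (smooth_funN oA s2) => // x _; rewrite sim_conj.
apply: smooth_scal_ext (smooth_scalM oA sc (smooth_scal_inj S oA sN)) => // x Ax.
apply: (mulfI (f0 x Ax)); rewrite mulfV ?f0// mulrA mul_conj -rmorphM -!expr2.
rewrite mulfV ?rmorph1//; apply: contra_neq (f0 x Ax) => /eqP.
rewrite paddr_eq0 ?sqr_ge0// !sqrf_eq0 => /andP[/eqP e1 /eqP e2]; apply: scal_eq.
  by rewrite e1 sre0.
by rewrite e2 sim0.
Qed.

(** Cramer's rule. *)
Lemma smooth_invmx m (A : set M) (G : M -> 'M[S]_m) : open A ->
  (forall x, A x -> G x \in unitmx) ->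
  (forall i j, smooth_scal_on A (fun x => G x i j)) ->
  forall i j, smooth_scal_on A (fun x => invmx (G x) i j).
Proof.
move=> oA Gu sG i j.
have sd : smooth_scal_on A (fun x => (\det (G x))^-1).
  apply: smooth_scalV => // [x /Gu|]; last exact: smooth_det.
  by rewrite unitmxE unitfE.
have sa : smooth_scal_on A (fun x => \adj (G x) i j).
  suff H : smooth_scal_on A (fun x => (-1) ^+ (j + i) * \det (row' j (col' i (G x)))).
    by apply: smooth_scal_ext H => // x _; rewrite mxE.
  apply: smooth_scalM => //; first exact: smooth_scal_cst.
  apply: smooth_det => // k l.
  by apply: smooth_scal_ext (sG (lift j k) (lift i l)) => // x _; rewrite !mxE.
apply: smooth_scal_ext (smooth_scalM oA sd sa) => // x Ax.
by rewrite /invmx Gu// [RHS]mxE.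
Qed.

End smooth_matrices.

Section transpose.
Local Open Scope ring_scope.
Variables (R : realType) (n : nat) (M : riemannian R n) (N : nat).
Let S0 := real_scalars R.
Local Notation TR := (tangent M S0).
Local Notation RN := (trivial_bundle S0 M N).
Let hT := tangent_good M S0.
Let hN := trivial_good M S0 N.
Let hTN := hom_good hT hN.

Lemma ip_ext (S : scalars R) (V : vectType S) (h : V -> V -> S) (w w' : V) :
  is_ip h -> (forall v, h w v = h w' v) -> w = w'.
Proof.
move=> ih e; apply/subr0_eq/(ip_eq0 ih).
by rewrite (ipDl ih) -scaleN1r (ipZl ih) e mulN1r subrr sre0.
Qed.

Lemma gram_unit (x : M) : gram x \in unitmx.
Proof.
rewrite unitmxE unitfE; apply/det0P => -[v v0 vg].
have := ip_pos (tangent_ip S0 x) v0.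
by rewrite tangent_real_herm vg mul0mx mxE ltxx.
Qed.

(** P^T t, the vector with g(P^T t, v) = <P v, t> for all v. *)
Definition transp (x : M) (P : hom_bundle TR RN x) (t : RN x) : TR x :=
  (\row_l \sum_k (P : 'Hom('rV[R]_n, 'rV[R]_N)) (delta_mx 0 l) 0 k * (t : 'rV[R]_N) 0 k)
    *m invmx (gram x).

Lemma RN_herm (x : M) (u v : 'rV[R]_N) :
  herm (u : RN x) (v : RN x) = \sum_k u 0 k * v 0 k.
Proof. by apply: eq_bigr => k _; rewrite sconj_real. Qed.

Lemma transpE x P t v :
  herm (transp (x := x) P t) v = herm ((P : 'Hom(TR x, RN x)) v : RN x) t.
Proof.
rewrite tangent_real_herm RN_herm /transp mulmxKV ?gram_unit// mxE.
transitivity (\sum_j \sum_k (P : 'Hom('rV[R]_n, 'rV[R]_N)) (delta_mx 0 j) 0 k *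
    (t : 'rV[R]_N) 0 k * (v : 'rV[R]_n) 0 j).
  by apply: eq_bigr => j _; rewrite !mxE mulr_suml.
have e k : ((P : 'Hom('rV[R]_n, 'rV[R]_N)) v) 0 k =
    \sum_j (v : 'rV[R]_n) 0 j * (P : 'Hom('rV[R]_n, 'rV[R]_N)) (delta_mx 0 j) 0 k.
  rewrite {1}[v : 'rV[R]_n]row_sum_delta linear_sum summxE.
  by apply: eq_bigr => j _; rewrite linearZ mxE.
rewrite exchange_big /=; apply: eq_bigr => k _.
transitivity ((\sum_j (v : 'rV[R]_n) 0 j * (P : 'Hom('rV[R]_n, 'rV[R]_N)) (delta_mx 0 j) 0 k)
    * (t : 'rV[R]_N) 0 k).
  by rewrite mulr_suml; apply: eq_bigr => j _; rewrite [LHS]mulrC mulrA.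
by congr (_ * _); rewrite -e.
Qed.

Lemma RN_conn x v (s t : section RN) : smooth_near x s -> smooth_near x t ->
  dfun x v (fun y => herm (s y) (t y)) =
  herm (conn x v s) (t x) + herm (s x) (conn x v t).
Proof.
move=> hs ht; have [A [oA Ax sA tA]] := smooth_near2 hs ht.
have sk := (trivial_smoothP A s).1 sA; have tk := (trivial_smoothP A t).1 tA.
transitivity (dscal x v (fun y => \sum_k (s y : 'rV[R]_N) 0 k * (t y : 'rV[R]_N) 0 k : S0)).
  rewrite -[LHS](dscal_inj S0).
  by apply: (congr1 (@dscal _ _ M S0 x v)); apply/funext => y; exact: RN_herm.
rewrite (dscal_sum oA Ax); last by move=> k; exact: smooth_scalM.
rewrite !RN_herm -big_split /=; apply: eq_bigr => k _.
by rewrite (dscalM oA Ax)// !mxE addrC; congr (_ + _); exact: mulrC.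
Qed.

(** The coordinates of P^T t in a local frame of TM solve a linear system whose
    matrix is the Gram matrix of the frame. *)
Lemma transp_smooth A (P : section (hom_bundle TR RN)) (t : section RN) : open A ->
  smooth_on A P -> smooth_on A t ->
  smooth_on A ((fun x => transp (P x) (t x)) : section TR).
Proof.
move=> oA sP st i m.
pose C := A `&` @cdom _ _ M i.
have oC : open C by apply: openI => //; exact: cdom_open.
pose e (l : 'I_n) : section TR := @frame _ _ _ _ (tangent_vb S0 M) i l.
have se l : smooth_on C (e l) by apply: smooth_sub (smooth_frame hT l) => y [].
have sPC : smooth_on C P by apply: smooth_sub sP => y [].
have stC : smooth_on C t by apply: smooth_sub st => y [].
pose G x : 'M[S0]_n := \matrix_(k, l) herm (e k x) (e l x).
have sG k l : smooth_scal_on C (fun x => G x k l).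
  have := herm_smooth (rman_metric M) oC (se k) (se l).
  by apply: smooth_scal_ext => // x _; rewrite mxE.
have sc l : smooth_scal_on C (fun x => herm ((P x : 'Hom(TR x, RN x)) (e l x) : RN x) (t x)).
  have /trivial_smoothP s1 := hom_apply_smooth hT hN oC sPC (se l).
  have /trivial_smoothP s2 := stC.
  have H k : smooth_scal_on C (fun x => ((P x : 'Hom(TR x, RN x)) (e l x) : 'rV[R]_N) 0 k
      * (t x : 'rV[R]_N) 0 k : S0) by exact: smooth_scalM.
  apply: smooth_scal_ext (smooth_scal_sum (index_enum _) oC H) => // x _.
  by rewrite RN_herm.
have co x (w : TR x) l : C x ->
    herm w (e l x) = (triv TR i x w *m G x) 0 l.
  move=> [_ dx]; rewrite {1}(frame_decomp hT w dx) (ip_suml (tangent_ip S0 x)) mxE.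
  by apply: eq_bigr => k _; rewrite (ipZl (tangent_ip S0 x)) [X in _ = _ * X]mxE.
have Gu x : C x -> G x \in unitmx.
  move=> Cx; rewrite unitmxE unitfE; apply/det0P => -[v v0 vg].
  have dx : tdom TR i x by case: Cx.
  pose w : TR x := trivV TR i x v.
  have wv : triv TR i x w = v by exact: (trivVK hT dx).
  case/eqP: v0; rewrite -wv; suff -> : w = 0 by exact: (triv0 hT dx).
  apply: (ip_eq0 (tangent_ip S0 x)).
  rewrite {2}(frame_decomp hT w dx) (ip_sumr (tangent_ip S0 x)) big1 ?sre0// => k _.
  by rewrite (ipZr (tangent_ip S0 x)) [X in _ * X](co x w k Cx) wv vg mxE mulr0.
have sI := smooth_invmx oC Gu sG.
have H l : smooth_scal_on C (fun x =>
   herm ((P x : 'Hom(TR x, RN x)) (e l x) : RN x) (t x) * invmx (G x) l m).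
  exact: smooth_scalM.
apply: smooth_scal_ext (smooth_scal_sum (index_enum _) oC H) => // x Cx.
rewrite -[triv TR i x _](mulmxK (Gu x Cx)) mxE; apply: eq_bigr => l _.
by rewrite -co// transpE.
Qed.

(** For w = P^T t one has |w|^2 = <P w, t>; expand | P w - |P|^2 t |^2 >= 0 and use
    |P w| <= |P| |w|. *)
Lemma transp_bound x P t : N2 (transp (x := x) P t) <= N2 P * N2 t.
Proof.
have ipT := tangent_ip S0 x; have ipN := good_ip hN x.
have ipP := good_ip hTN x.
set w := transp P t; set c : R := N2 P.
have c0 : 0 <= c by exact: (ip_ge0 ipP).
have hw : herm ((P : 'Hom(TR x, RN x)) w : RN x) t = N2 w by rewrite -transpE.
have hw' : herm t ((P : 'Hom(TR x, RN x)) w : RN x) = N2 w.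
  by rewrite (ip_conj ipN) hw sconj_real.
have b1 : N2 ((P : 'Hom(TR x, RN x)) w : RN x) <= c * N2 w.
  exact: (hom_apply_bound ipT ipN).
have [cz|cn] := eqVneq c 0.
  rewrite cz mul0r -hw (_ : (P : 'Hom(TR x, RN x)) w = 0); first by rewrite (ip0l ipN).
  by apply: (ip_eq0 ipN); apply/eqP; rewrite eq_le (ip_ge0 ipN) andbT; apply: le_trans b1 _; rewrite cz mul0r.
have cp : 0 < c by rewrite lt_neqAle eq_sym cn.
have := ip_ge0 ipN ((P : 'Hom(TR x, RN x)) w + (- c) *: t).
rewrite !(ipDl ipN, ipDr ipN, ipZl ipN, ipZr ipN) sconj_real hw hw'.
rewrite [sre _](_ : _ = N2 ((P : 'Hom(TR x, RN x)) w : RN x) + - c * N2 w + - c * (N2 w + - c * N2 t)); last first.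
  rewrite /N2 /=; ring.
move=> h; rewrite -(ler_pM2l cp); nra.
Qed.

(** Differentiate g(P^T t, v) = <P v, t>, both metrics being parallel. *)
Lemma transp_parallel : parallel_bilinear transp.
Proof.
have ipT (x : M) := tangent_ip S0 x; have ipN (x : M) := good_ip hN x.
split.
- move=> x a u u' w; apply: (ip_ext (ipT x)) => v.
  rewrite (ipDl (ipT x)) (ipZl (ipT x)) !transpE add_lfunE scale_lfunE.
  by rewrite (ipDl (ipN x)) (ipZl (ipN x)).
- move=> x a u w w'; apply: (ip_ext (ipT x)) => v.
  rewrite (ipDl (ipT x)) (ipZl (ipT x)) !transpE.
  by rewrite (ipDr (ipN x)) (ipZr (ipN x)) sconj_real.
- exact: transp_smooth.
- move=> x v P t hP ht; apply: (ip_ext (ipT x)) => u.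
  have [X [Xx sX _]] := const_lift (u : TR x) S0.
  have [A [oA Ax sP st]] := smooth_near2 hP ht.
  have hw : smooth_near x ((fun y => transp (P y) (t y)) : section TR).
    by exists A; split => //; exact: transp_smooth.
  have hPX := hom_apply_smooth_near hT hN hP sX.
  have L1 := herm_conn v hw sX.
  have L2 := RN_conn v hPX ht.
  have E : (fun y => herm (transp (P y) (t y)) (X y)) =
     (fun y => herm ((P y : 'Hom(TR y, RN y)) (X y) : RN y) (t y)).
    by apply/funext => y; exact: transpE.
  rewrite E {}L2 [X in herm X (t x)](hom_leibniz hT hN v hP sX) in L1.
  rewrite (ipDl (ipN x)) !transpE Xx in L1.
  rewrite (ipDl (ipT x)) !transpE.
  apply: (addIr (herm ((P x : 'Hom(TR x, RN x)) (conn x v X) : RN x) (t x))).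
  by rewrite -[LHS]L1 addrAC.
by exists 1; split => // x P t; rewrite mul1r; exact: transp_bound.
Qed.

(** Z_j is the transpose of the embedding applied to the parallel section e_j. *)
Lemma frechet_W_b (Z : 'I_N -> vector_field M) : frechet_system Z ->
  forall j, W_b (Z j).
Proof.
move=> [P [[cP _] hZ]] j.
pose ej : section RN := fun=> delta_mx 0 j.
have ce : Cb_inf ej.
  apply: (Cb_inf_parallel hN).
  - by apply/trivial_smoothP => k; apply: smooth_scal_cst; exact: openT.
  - by exists 1 => x; rewrite /N2 RN_herm (bigD1 j)//= big1 ?addr0 ?mxE ?eqxx ?mulr1// => k kj; rewrite mxE (negbTE kj) andbF mulr0.
  - move=> x v; apply/rowP => k; rewrite mxE [RHS]mxE; exact: (dscal_cst x v ((delta_mx 0 j : 'rV[R]_N) 0 k : S0)).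
have -> : Z j = fun x => transp (P x) (ej x).
  apply: section_ext => x; apply: (ip_ext (tangent_ip S0 x)) => v.
  rewrite transpE tangent_real_herm RN_herm (hZ j x v) (bigD1 j)//= big1.
    by rewrite mxE !eqxx mulr1 addr0.
  by move=> k kj; rewrite mxE (negbTE kj) andbF mulr0.
exact: (Cb_inf_bil hTN hN hT transp_parallel).
Qed.

(** The embedding Phi is isometric, that is Phi^T Phi = id. *)
Lemma frechet_decomp (Z : 'I_N -> vector_field M) : frechet_system Z ->
  forall (x : M) (v : TR x), v = \sum_k herm v (Z k x) *: Z k x.
Proof.
move=> [P [[_ hP] hZ]] x v; have ipT := tangent_ip S0 x.
have e k (u : TR x) : herm (Z k x) u = (P x : 'Hom('rV[R]_n, 'rV[R]_N)) u 0 k.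
  by rewrite tangent_real_herm; exact: hZ.
apply: (ip_ext ipT) => u.
rewrite (ip_suml ipT) [LHS]tangent_real_herm -[LHS]hP; apply: eq_bigr => k _.
by rewrite (ipZl ipT) (ip_conj ipT) sconj_real !e.
Qed.

Lemma nabla_frechet (S : scalars R) (V : hbdata S M) (Z : 'I_N -> vector_field M)
    (s : section V) x : good_bundle V -> frechet_system Z -> smooth_near x s ->
  nabla s x = \sum_k tens (Z k x) (conn x (Z k x) s).
Proof.
move=> hV hZ hs; apply: hom_cplx_ext => r; rewrite (nabla_cplx hV)// sum_lfunE.
have cD (u w : 'rV[R]_n) : conn x (u + w) s = conn x u s + conn x w s.
  by have := good_linearl hV 1 u w hs; rewrite !scale1r rmorph1 scale1r.
have c0 : conn x 0 s = 0.
  by apply: (addrI (conn x 0 s)); rewrite -cD !addr0.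
rewrite {1}(frechet_decomp hZ (r : TR x)).
rewrite (big_morph (fun u : 'rV[R]_n => conn x u s) cD c0).
apply: eq_bigr => k _; rewrite tens_cplx.
by have := good_linearl hV (herm (r : TR x) (Z k x)) (Z k x) 0 hs; rewrite !addr0 c0 addr0.
Qed.

End transpose.

(** * Differential operators *)

Section differential_operators.
Local Open Scope ring_scope.
Variables (R : realType) (n : nat) (M : riemannian R n).
Let S := complex_scalars R.
Let S0 := real_scalars R.
Local Notation TR := (tangent M S0).
Implicit Types (E F G : hermitian_bundle M) (X : vector_field M).

Lemma hermitian_good E : good_bundle E.
Proof.
have [h1 h2 h3 _] := hb_herm E; have [c1 c2 c3 c4 c5 _] := hb_conn E.
split => //; first exact: hb_vb.
by move=> x; split => //; exact: h3.
Qed.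

Let hT := tangent_good M S0.

Section derivations.
Variables (V : hbdata S M) (hV : good_bundle V).

Definition cov (X : vector_field M) (s : section V) : section V :=
  fun x => conn x (X x) s.

Lemma smooth_nearT (W : hbdata S M) (s : section W) x : smooth s -> smooth_near x s.
Proof. by move=> ss; exists setT; split => //; exact: openT. Qed.

Lemma cov_smooth X s : smooth X -> smooth s -> smooth (cov X s).
Proof. by move=> sX ss; exact: (good_smooth hV openT sX ss). Qed.

Lemma cov_ev_field X s : smooth s ->
  cov X s = fun x => ev_field (X x) (nabla s x).
Proof.
move=> ss; apply: section_ext => x; rewrite /ev_field /cov.
by rewrite (nabla_cplx hV)//; exact: smooth_nearT.
Qed.

Lemma covD X s t x : smooth s -> smooth t ->
  cov X (fun y => s y + t y) x = cov X s x + cov X t x.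
Proof. by move=> ss st; apply: (connD hV); exact: smooth_nearT. Qed.

Lemma cov_Cb X s : W_b X -> Cb_inf s -> Cb_inf (cov X s).
Proof.
move=> hX hs; have [ss bs] := (Cb_infP s hV).1 hs.
rewrite cov_ev_field//; apply: (Cb_inf_bil hT (cotensor_good hV) hV (ev_field_parallel hV) hX).
apply/(Cb_infP _ (cotensor_good hV)); split; first exact: (nabla_smooth hV openT ss).
by move=> k; have [] := bs k.+1.
Qed.

End derivations.

Definition hom_app (V W : hbdata S M) (a : section (hom_bundle V W)) (s : section V) :
    section W := fun x => (a x : 'Hom(V x, W x)) (s x).

Lemma cov_app (V W : hbdata S M) X (a : section (hom_bundle V W)) (s : section V) x :
  good_bundle V -> good_bundle W -> smooth a -> smooth s ->
  cov X (hom_app a s) x = hom_app (cov X a) s x + hom_app a (cov X s) x.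
Proof.
move=> hV hW sa ss.
exact: (hom_leibniz hV hW (X x) (smooth_nearT x sa) (smooth_nearT x ss)).
Qed.

Definition covs (V : hbdata S M) (Xs : seq (vector_field M)) (s : section V) :=
  foldr (@cov V) s Xs.

Definition fields_in (Q : set (vector_field M)) (Xs : seq (vector_field M)) : bool :=
  all (fun X => `[< Q X >]) Xs.

Lemma covs_smooth E Xs (s : section E) : fields_in (@W_b _ _ M) Xs ->
  smooth s -> smooth (covs Xs s).
Proof.
elim: Xs => //= X Xs IH /andP[/asboolP[sX _] hXs] ss.
by apply: (cov_smooth (hermitian_good E)) => //; exact: IH.
Qed.

Lemma cov_zero E X (s : section E) (U : set M) : smooth X -> open U -> smooth s ->
  (forall x, U x -> s x = 0) -> forall x, U x -> cov X s x = 0.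
Proof.
move=> sX oU ss s0 x Ux; have hE := hermitian_good E.
rewrite /cov (@good_local _ _ _ _ _ hE x (X x) s (fun y => 0 : E y)).
- exact: (conn0 hE).
- exact: smooth_nearT.
- have : \forall y \near x, U y by exact: open_nbhs_nbhs.
  by apply: filterS => y /s0.
Qed.

(** Locality of the connection. *)
Lemma covs_zero E Xs (s : section E) (U : set M) : fields_in (@W_b _ _ M) Xs ->
  open U -> smooth s -> (forall x, U x -> s x = 0) ->
  forall x, U x -> covs Xs s x = 0.
Proof.
move=> + oU ss s0; elim: Xs => //= X Xs IH /andP[/asboolP[sX hX] hXs] x Ux.
by apply: (cov_zero sX oU _ (IH hXs)) => //; exact: covs_smooth.
Qed.

Section combinations.
Variables (E F : hermitian_bundle M).
Let hE := hermitian_good E.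
Let hF := hermitian_good F.
Let hH := hom_good hE hF.
Implicit Types (f g : csection E -> section F) (Q : set (vector_field M)).

(** Membership in the span of the monomials with fields in Q, for functions that
    produce sections: nothing is asked of the supports of these sections, and
    closure properties are checked on one monomial at a time.  The scalars of the
    linear combination are absorbed in the coefficients a. *)
Inductive monomial_sum Q (mu : nat) : (csection E -> section F) -> Prop :=
| monomial_sum0 : monomial_sum Q mu (fun _ _ => 0)
| monomial_sumD a Xs f : Cb_inf a -> (size Xs <= mu)%N -> fields_in Q Xs ->
    monomial_sum Q mu f ->
    monomial_sum Q mu (fun u x => hom_app a (covs Xs (csec u)) x + f u x).

Lemma op_ext f g : (forall u x, f u x = g u x) -> f = g.
Proof. by move=> fg; apply/funext => u; apply: section_ext => x. Qed.

Lemma monomial_sum_ext Q mu f g : (forall u x, f u x = g u x) ->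
  monomial_sum Q mu f -> monomial_sum Q mu g.
Proof. by move=> /op_ext ->. Qed.

Lemma monomial_sum1 Q mu a Xs : Cb_inf a -> (size Xs <= mu)%N -> fields_in Q Xs ->
  monomial_sum Q mu (fun u => hom_app a (covs Xs (csec u))).
Proof.
move=> ha hs hX; have := monomial_sumD ha hs hX (monomial_sum0 Q mu).
by apply: monomial_sum_ext => u x; rewrite addr0.
Qed.

Lemma monomial_sum_add Q mu f g : monomial_sum Q mu f -> monomial_sum Q mu g ->
  monomial_sum Q mu (fun u x => f u x + g u x).
Proof.
move=> hf hg; elim: hf => [|a Xs f' ha hs hX _ IH].
  by apply: monomial_sum_ext hg => u x; rewrite add0r.
have := monomial_sumD ha hs hX IH.
by apply: monomial_sum_ext => u x; rewrite addrA.
Qed.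

Lemma monomial_sum_leq Q mu nu f : (mu <= nu)%N -> monomial_sum Q mu f ->
  monomial_sum Q nu f.
Proof.
move=> mn; elim=> [|a Xs f' ha hs hX _ IH]; first exact: monomial_sum0.
by apply: monomial_sumD => //; exact: leq_trans hs mn.
Qed.

Lemma fields_in_sub Q Q' Xs : Q `<=` Q' -> fields_in Q Xs -> fields_in Q' Xs.
Proof. by move=> QQ; apply: sub_all => X /asboolP/QQ ?; apply/asboolP. Qed.

Lemma monomial_sum_sub Q Q' mu f : Q `<=` Q' -> monomial_sum Q mu f ->
  monomial_sum Q' mu f.
Proof.
move=> QQ; elim=> [|a Xs f' ha hs hX _ IH]; first exact: monomial_sum0.
by apply: monomial_sumD => //; exact: fields_in_sub hX.
Qed.

Lemma monomial_sum_scale Q mu (c : S) f : monomial_sum Q mu f ->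
  monomial_sum Q mu (fun u x => c *: f u x).
Proof.
elim=> [|a Xs f' ha hs hX _ IH].
  by apply: monomial_sum_ext (monomial_sum0 _ _) => u x; rewrite scaler0.
have := monomial_sumD (Cb_infZ hH c ha) hs hX IH.
by apply: monomial_sum_ext => u x; rewrite scalerDr /hom_app scale_lfunE.
Qed.

Lemma monomial_sum_big Q mu m (f : 'I_m -> csection E -> section F) :
  (forall i, monomial_sum Q mu (f i)) ->
  monomial_sum Q mu (fun u x => \sum_i f i u x).
Proof.
move=> hf; elim: (index_enum 'I_m) => [|i r IH].
  by apply: monomial_sum_ext (monomial_sum0 _ _) => u x; rewrite big_nil.
have := monomial_sum_add (hf i) IH.
by apply: monomial_sum_ext => u x; rewrite big_cons.
Qed.

Lemma hom_app_smooth (V : hbdata S M) (a : section (hom_bundle V F)) s :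
  good_bundle V -> smooth a -> smooth s -> smooth (hom_app a s).
Proof. by move=> hV sa ss; exact: (hom_apply_smooth hV hF openT sa ss). Qed.

Lemma monomial_sum_smooth Q mu f u : Q `<=` @W_b _ _ M -> monomial_sum Q mu f -> smooth (f u).
Proof.
move=> QW; elim=> [|a Xs f' [sa _] hs hX _ IH]; first exact: (smooth0 hF openT).
apply: (smoothD hF openT) => //; apply: hom_app_smooth => //.
apply: covs_smooth; first exact: fields_in_sub hX.
exact: csec_smooth.
Qed.

(** Each monomial a w splits by nabla_X (a w) = (nabla_X a) w + a (nabla_X w). *)
Lemma monomial_sum_cov Q mu f X : Q `<=` @W_b _ _ M -> Q X -> monomial_sum Q mu f ->
  monomial_sum Q mu.+1 (fun u => cov X (f u)).
Proof.
move=> QW QX; elim=> [|a Xs f' ha hs hX hf IH].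
  by apply: monomial_sum_ext (monomial_sum0 _ _) => u x; exact/esym/(conn0 hF).
have sX := QW _ QX.
have h1 := monomial_sum1 (cov_Cb hH sX ha) (leqW hs) hX.
have hXX : fields_in Q (X :: Xs) by apply/andP; split => //; apply/asboolP.
have h2 := @monomial_sum1 Q mu.+1 a (X :: Xs) ha hs hXX.
have := monomial_sum_add (monomial_sum_add h1 h2) IH.
apply: monomial_sum_ext => u x.
have sw : smooth (covs Xs (csec u)).
  by apply: covs_smooth; [exact: fields_in_sub hX|exact: csec_smooth].
have [sa _] := ha.
rewrite (covD hF X x (hom_app_smooth hE sa sw) (monomial_sum_smooth u QW hf)).
by rewrite (cov_app X x hE hF).
Qed.

Lemma monomial_sum_covs Q mu f Xs : Q `<=` @W_b _ _ M -> fields_in Q Xs ->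
  monomial_sum Q mu f -> monomial_sum Q (mu + size Xs)%N (fun u => covs Xs (f u)).
Proof.
move=> QW + hf; elim: Xs => [|X Xs IH] /=; first by rewrite addn0.
by move=> /andP[/asboolP QX hXs]; rewrite addnS; apply: monomial_sum_cov => //; exact: IH.
Qed.

(** The same for the operators sum_j a_j nabla^j; a list of terms, unlike a family
    of coefficients in bundles depending on j, is extended by one term without
    transporting coefficients between bundles. *)
Inductive jet_sum (mu : nat) : (csection E -> section F) -> Prop :=
| jet_sum0 : jet_sum mu (fun _ _ => 0)
| jet_sumD j (a : section (hom_bundle (cotensor_iter j E) F)) f :
    (j <= mu)%N -> Cb_inf a -> jet_sum mu f ->
    jet_sum mu (fun u x => hom_app a (nabla_iter j (csec u)) x + f u x).

Lemma jet_sum_ext mu f g : (forall u x, f u x = g u x) -> jet_sum mu f -> jet_sum mu g.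
Proof. by move=> /op_ext ->. Qed.

Lemma jet_sum1 mu j (a : section (hom_bundle (cotensor_iter j E) F)) :
  (j <= mu)%N -> Cb_inf a -> jet_sum mu (fun u => hom_app a (nabla_iter j (csec u))).
Proof.
move=> hj ha; have := jet_sumD hj ha (jet_sum0 mu).
by apply: jet_sum_ext => u x; rewrite addr0.
Qed.

Lemma jet_sum_add mu f g : jet_sum mu f -> jet_sum mu g ->
  jet_sum mu (fun u x => f u x + g u x).
Proof.
move=> hf hg; elim: hf => [|j a f' hj ha _ IH].
  by apply: jet_sum_ext hg => u x; rewrite add0r.
have := jet_sumD hj ha IH.
by apply: jet_sum_ext => u x; rewrite addrA.
Qed.

Lemma jet_sum_leq mu nu f : (mu <= nu)%N -> jet_sum mu f -> jet_sum nu f.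
Proof.
move=> mn; elim=> [|j a f' hj ha _ IH]; first exact: jet_sum0.
by apply: jet_sumD => //; exact: leq_trans hj mn.
Qed.

Lemma jet_sum_opp mu f : jet_sum mu f -> jet_sum mu (fun u x => - f u x).
Proof.
elim=> [|j a f' hj ha _ IH].
  by apply: jet_sum_ext (jet_sum0 _) => u x; rewrite oppr0.
have hHj := hom_good (iter_cotensor_good j hE) hF.
have := jet_sumD hj (Cb_infZ hHj (-1) ha) IH.
by apply: jet_sum_ext => u x; rewrite opprD /hom_app scale_lfunE scaleN1r.
Qed.

Lemma nabla_iter_smooth (u : csection E) j : smooth (nabla_iter j (csec u)).
Proof.
elim: j => [|j IH] /=; first exact: csec_smooth.
exact: (nabla_smooth (iter_cotensor_good j hE) openT IH).
Qed.

Lemma jet_sum_smooth mu f u : jet_sum mu f -> smooth (f u).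
Proof.
elim=> [|j a f' _ [sa _] _ IH]; first exact: (smooth0 hF openT).
apply: (smoothD hF openT) => //; apply: hom_app_smooth => //.
  exact: iter_cotensor_good.
exact: nabla_iter_smooth.
Qed.

(** Termwise, nabla_X (a nabla^j) = (nabla_X a) nabla^j + (a o ev_X) nabla^(j+1). *)
Lemma jet_sum_cov mu f X : W_b X -> jet_sum mu f ->
  jet_sum mu.+1 (fun u => cov X (f u)).
Proof.
move=> hX; elim=> [|j a f' hj ha hf IH].
  by apply: jet_sum_ext (jet_sum0 _) => u x; exact/esym/(conn0 hF).
have hEj := iter_cotensor_good j hE.
have hHj := hom_good hEj hF.
have [sa _] := ha.
have h1 := jet_sum1 (leqW hj) (cov_Cb hHj hX ha).
pose b : section (hom_bundle (cotensor_iter j.+1 E) F) :=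
  fun x => precomp (@ev_field _ _ _ _ (cotensor_iter j E)) (a x) (X x).
have hb : Cb_inf b.
  exact: (Cb_inf_bil hHj hT (hom_good (cotensor_good hEj) hF)
    (precomp_ev_field_parallel hEj hF) ha hX).
have h2 := @jet_sum1 mu.+1 j.+1 b hj hb.
have := jet_sum_add (jet_sum_add h1 h2) IH.
apply: jet_sum_ext => u x.
have sw : smooth (nabla_iter j (csec u)) by exact: nabla_iter_smooth.
rewrite (covD hF X x (hom_app_smooth hEj sa sw) (jet_sum_smooth u hf)).
rewrite (cov_app X x hEj hF)//; congr (_ + _ + _).
rewrite (cov_ev_field hEj)//.
exact: (precompE (@ev_field_linear _ _ _ _ (cotensor_iter j E))).
Qed.

(** Induction on the number of fields, through
    a nabla_X w = nabla_X (a w) - (nabla_X a) w. *)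
Lemma covs_jet_sum Xs a : fields_in (@W_b _ _ M) Xs -> Cb_inf a ->
  jet_sum (size Xs) (fun u => hom_app a (covs Xs (csec u))).
Proof.
elim: Xs a => [|X Xs IH] a; first by move=> _ ha; exact: (@jet_sum1 0 0 a _ ha).
move=> /andP[/asboolP hX hXs] ha.
have h1 := jet_sum_cov hX (IH a hXs ha).
have h2 := jet_sum_opp (jet_sum_leq (leqnSn _) (IH _ hXs (cov_Cb hH hX ha))).
have := jet_sum_add h1 h2; apply: jet_sum_ext => u x.
have [sa _] := ha.
have sw : smooth (covs Xs (csec u)) by apply: covs_smooth => //; exact: csec_smooth.
by rewrite (cov_app X x hE hF)// addrAC subrr add0r.
Qed.

Lemma monomial_jet_sum mu f : monomial_sum (@W_b _ _ M) mu f -> jet_sum mu f.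
Proof.
elim=> [|a Xs f' ha hs hX _ IH]; first exact: jet_sum0.
by apply: jet_sum_add IH; apply: jet_sum_leq hs _; exact: covs_jet_sum.
Qed.

Section frechet.
Variables (N : nat) (Z : 'I_N -> vector_field M) (hZ : frechet_system Z).

Definition frechet_fields : set (vector_field M) := [set X | exists k, X = Z k].

Lemma frechet_fieldsW : frechet_fields `<=` @W_b _ _ M.
Proof. by move=> _ [k ->]; exact: (frechet_W_b hZ). Qed.

(** Since nabla w = sum_k Z_k^flat (x) nabla_(Z_k) w, the operator
    a nabla^(j+1) is a sum of operators b nabla_(Z_k) nabla^j, and
    b nabla_Z w = nabla_Z (b w) - (nabla_Z b) w. *)
Lemma nabla_iter_monomial_sum j (a : section (hom_bundle (cotensor_iter j E) F)) :
  Cb_inf a -> monomial_sum frechet_fields j (fun u => hom_app a (nabla_iter j (csec u))).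
Proof.
elim: j a => [|j IH] a ha; first exact: (@monomial_sum1 _ 0 a [::] ha).
have hEj := iter_cotensor_good j hE.
have hHj := hom_good hEj hF.
pose b k : section (hom_bundle (cotensor_iter j E) F) :=
  fun x => precomp (@tens _ _ _ _ (cotensor_iter j E)) (a x) (Z k x).
have hb k : Cb_inf (b k).
  exact: (Cb_inf_bil (hom_good (cotensor_good hEj) hF) hT hHj
    (precomp_tens_parallel hEj hF) ha (frechet_W_b hZ k)).
have h1 k : monomial_sum frechet_fields j.+1
    (fun u => cov (Z k) (hom_app (b k) (nabla_iter j (csec u)))).
  by apply: monomial_sum_cov (IH _ (hb k)); [exact: frechet_fieldsW|exists k].
have h2 k := monomial_sum_scale (-1) (monomial_sum_leq (leqnSn _)
  (IH _ (cov_Cb hHj (frechet_W_b hZ k) (hb k)))).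
have := monomial_sum_big (fun k => monomial_sum_add (h1 k) (h2 k)).
apply: monomial_sum_ext => u x.
have sw : smooth (nabla_iter j (csec u)) by exact: nabla_iter_smooth.
rewrite /hom_app [nabla_iter j.+1 _ x](nabla_frechet hEj hZ (smooth_nearT x sw)).
rewrite linear_sum; apply: eq_bigr => k _.
rewrite (cov_app (Z k) x hEj hF (hb k).1 sw) scaleN1r addrAC subrr add0r.
exact: (precompE (@tens_linear _ _ _ _ (cotensor_iter j E))).
Qed.

Lemma jet_monomial_sum mu f : jet_sum mu f -> monomial_sum frechet_fields mu f.
Proof.
elim=> [|j a f' hj ha _ IH]; first exact: monomial_sum0.
apply: monomial_sum_add IH; apply: monomial_sum_leq hj _.
exact: nabla_iter_monomial_sum.
Qed.

End frechet.

(** Covariant derivatives do not enlarge supports, so the values of a monomial are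
    again smooth and compactly supported. *)
Lemma monomial_operator a Xs : Cb_inf a -> fields_in (@W_b _ _ M) Xs ->
  exists P : operator E F, forall u x, csec (P u) x = hom_app a (covs Xs (csec u)) x.
Proof.
move=> [sa _] hX.
have sm u : smooth (hom_app a (covs Xs (csec u))).
  by apply: hom_app_smooth => //; apply: covs_smooth => //; exact: csec_smooth.
have cm (u : csection E) : compact (closure [set x | hom_app a (covs Xs (csec u)) x != 0]).
  apply: subclosed_compact (csec_compact (c := u)) _; first exact: closed_closure.
  rewrite [X in _ `<=` X](closure_id _).1; last exact: closed_closure.
  apply: closure_subset => x; apply: contraPP => Nx /eqP; apply.
  pose U : set M := ~` closure [set x | csec u x != 0].
  have oU : open U by apply: closed_openC; exact: closed_closure.
  have u0 y : U y -> csec u y = 0.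
    by move=> Uy; apply/eqP/negP => /negP uy; apply: Uy; exact: subset_closure.
  by rewrite /hom_app (covs_zero hX oU (csec_smooth u) u0 Nx) linear0.
by exists (fun u => CSection (sm u) (cm u)).
Qed.

Definition monomials Q mu : set (operator E F) :=
  [set P : operator E F | exists (r : nat) (a : section (hom_bundle E F))
     (X : 'I_r -> vector_field M),
     [/\ (r <= mu)%N, Cb_inf a, (forall i, Q (X i)) & is_monomial a X P]].

Lemma foldr_covs r (X : 'I_r -> vector_field M) (s : section E) :
  foldr (fun i s => nabla_dir (X i) s) s (enum 'I_r) = covs (map X (enum 'I_r)) s.
Proof. by rewrite /covs foldr_map. Qed.

Lemma span_monomials Q mu (P : operator E F) : Q `<=` @W_b _ _ M ->
  linear_span (monomials Q mu) P <-> monomial_sum Q mu (fun u => csec (P u)).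
Proof.
move=> QW; split=> [[m [c [Ps [hPs PE]]]]|].
  have h i := @monomial_sum_scale Q mu (c i) (fun u => csec (Ps i u)).
  have hi i : monomial_sum Q mu (fun u => csec (Ps i u)).
    have [r [a [X [hr ha hX hm]]]] := hPs i.
    have hXs : fields_in Q (map X (enum 'I_r)).
      by rewrite /fields_in all_map; apply/allP => j _ /=; apply/asboolP.
    have := @monomial_sum1 Q mu a (map X (enum 'I_r)) ha _ hXs.
    rewrite size_map size_enum_ord => /(_ hr).
    apply: monomial_sum_ext => u x.
    by rewrite (hm u x) foldr_covs.
  have := monomial_sum_big (fun i => h i (hi i)).
  by apply: monomial_sum_ext => u x; rewrite PE.
suff H f : monomial_sum Q mu f -> exists (m : nat) (c : 'I_m -> S) (Ps : 'I_m -> operator E F),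
     (forall i, monomials Q mu (Ps i)) /\
     forall u x, f u x = \sum_i c i *: csec (Ps i u) x.
  by move=> /H[m [c [Ps [h1 h2]]]]; exists m, c, Ps.
elim=> [|a Xs f' ha hs hX _ [m [c [Ps [h1 h2]]]]].
  exists 0%N, (fun=> 0), (fun=> P); split=> [[]|u x] //.
  by rewrite big_ord0.
have [P0 hP0] := monomial_operator ha (fields_in_sub QW hX).
exists m.+1, (fun i => if unlift ord0 i is Some j then c j else 1),
  (fun i => if unlift ord0 i is Some j then Ps j else P0); split.
  move=> i; case: unliftP => [j _|_]; first exact: h1.
  exists (size Xs), a, (tnth (in_tuple Xs)); split => //.
    move=> i'; apply/asboolP; move: hX => /(all_tnthP (t := in_tuple Xs)); exact.
  by move=> u x; rewrite hP0 foldr_covs map_tnth_enum.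
move=> u x; rewrite big_ord_recl unlift_none scale1r hP0 h2; congr (_ + _).
by apply: eq_bigr => j _; rewrite liftK.
Qed.

Lemma Diff_b_jet_sum mu (P : operator E F) :
  Diff_b mu P <-> jet_sum mu (fun u => csec (P u)).
Proof.
split=> [[a [ha PE]]|].
  suff H m : (m <= mu.+1)%N -> jet_sum mu (fun u x => \sum_(j < m) hom_app (a j) (nabla_iter j (csec u)) x).
    have := H mu.+1 (leqnn _).
    by apply: jet_sum_ext => u x; rewrite PE.
  elim: m => [|m IH] hm.
    by apply: jet_sum_ext (jet_sum0 _) => u x; rewrite big_ord0.
  have := jet_sum_add (IH (ltnW hm)) (jet_sum1 (hm : (m <= mu)%N) (ha m hm)).
  by apply: jet_sum_ext => u x; rewrite big_ord_recr.
suff H f : jet_sum mu f -> exists a : forall j, section (hom_bundle (cotensor_iter j E) F),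
    (forall j, Cb_inf (a j)) /\
    forall u x, f u x = \sum_(j < mu.+1) hom_app (a j) (nabla_iter j (csec u)) x.
  by move=> /H[a [h1 h2]]; exists a; split => // j _; exact: h1.
elim=> [|j b f' hj hb _ [a [ha f'E]]].
  exists (fun j x => 0); split.
    by move=> j; exact: (Cb_inf0 (hom_good (iter_cotensor_good j hE) hF)).
  by move=> u x; rewrite big1// => i _; rewrite /hom_app zero_lfunE.
exists (@eqtype.dfwith nat (fun j => section (hom_bundle (cotensor_iter j E) F)) a j
  ((fun x => b x + a j x) : section (hom_bundle (cotensor_iter j E) F))); split.
  move=> i; have [<-|ji] := eqVneq j i; last by rewrite eqtype.dfwith_out.
  rewrite eqtype.dfwith_in.
  by apply: (Cb_infD (hom_good (iter_cotensor_good j hE) hF) hb); exact: ha.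
move=> u x; rewrite f'E.
rewrite (bigD1 (Ordinal (hj : (j < mu.+1)%N)))//= [in RHS](bigD1 (Ordinal (hj : (j < mu.+1)%N)))//=.
rewrite eqtype.dfwith_in addrA; congr (_ + _); first by rewrite /hom_app add_lfunE.
apply: eq_bigr => i ij; rewrite eqtype.dfwith_out//.
by apply: contra ij => /eqP e; apply/eqP/val_inj.
Qed.

End combinations.

(** The coefficients are composed. *)
Lemma monomial_sum_app E F G Q mu (a : section (hom_bundle F G))
    (f : csection E -> section F) : Cb_inf a -> monomial_sum Q mu f ->
  monomial_sum Q mu (fun u => hom_app a (f u)).
Proof.
have hE := hermitian_good E; have hF := hermitian_good F; have hG := hermitian_good G.
move=> ha; elim=> [|b Xs f' hb hs hX _ IH].
  by apply: monomial_sum_ext (monomial_sum0 E G Q mu) => u x; rewrite /hom_app linear0.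
have hc := Cb_inf_bil (hom_good hF hG) (hom_good hE hF) (hom_good hE hG)
  (hom_comp_parallel hE hF hG) ha hb.
have := monomial_sumD hc hs hX IH.
by apply: monomial_sum_ext => u x; rewrite /hom_app hom_compE linearD.
Qed.

Lemma monomial_sum_comp E F G mu nu (P : operator F G) (Q : operator E F) :
  monomial_sum (@W_b _ _ M) nu (fun u => csec (P u)) ->
  monomial_sum (@W_b _ _ M) mu (fun u => csec (Q u)) ->
  monomial_sum (@W_b _ _ M) (mu + nu)%N (fun u => csec (P (Q u))).
Proof.
move=> + hQ.
suff H g : monomial_sum (E := F) (F := G) (@W_b _ _ M) nu g ->
    monomial_sum (@W_b _ _ M) (mu + nu)%N (fun u => g (Q u)) by exact: H.
elim=> [|a Xs g' ha hs hX _ IH]; first exact: monomial_sum0.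
apply: monomial_sum_add IH; apply: monomial_sum_app => //.
apply: (@monomial_sum_leq _ _ _ (mu + size Xs)); first by rewrite leq_add2l.
exact: (monomial_sum_covs (@subset_refl _ _) hX hQ).
Qed.

End differential_operators.

Theorem proposition3p13 (R : realType) (n : nat) (M : riemannian R n)
  (mu nu : nat) (E F G : hermitian_bundle M)
  (hFFC : FFC M)
  (N : nat) (Z : 'I_N -> vector_field M) (hZ : frechet_system Z) :
  [/\ forall (P : operator F G) (Q : operator E F),
        mixed_Diff_b nu P -> mixed_Diff_b mu Q -> mixed_Diff_b (mu + nu) (P \o Q),
      @mixed_Diff_b R n M mu E F = @Diff_b R n M mu E F
    & @Diff_b R n M mu E F =
      linear_span [set P : operator E F |
        exists (r : nat) (a : section (hom_bundle E F)) (k : 'I_r -> 'I_N),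
          [/\ (r <= mu)%N, Cb_inf a & is_monomial a (Z \o k) P]]].
Proof.
have mixedP (mu' : nat) (E' F' : hermitian_bundle M) (P : operator E' F') :
    mixed_Diff_b mu' P <-> monomial_sum (@W_b _ _ M) mu' (fun u => csec (P u)).
  exact: (span_monomials mu' P (@subset_refl _ _)).
have ZW := frechet_fieldsW hZ.
have zP (P : operator E F) :
    linear_span (monomials (frechet_fields Z) mu) P <->
    monomial_sum (frechet_fields Z) mu (fun u => csec (P u)).
  exact: span_monomials.
split.
- move=> P Q /mixedP hP /mixedP hQ; apply/mixedP; exact: (monomial_sum_comp hP hQ).
- apply/seteqP; split=> P.
    by move=> /mixedP /monomial_jet_sum /Diff_b_jet_sum.
  move=> /Diff_b_jet_sum /(jet_monomial_sum hZ) h; apply/mixedP.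
  exact: monomial_sum_sub ZW h.
have -> : [set P : operator E F |
        exists (r : nat) (a : section (hom_bundle E F)) (k : 'I_r -> 'I_N),
          [/\ (r <= mu)%N, Cb_inf a & is_monomial a (Z \o k) P]] =
    monomials (frechet_fields Z) mu.
  apply/seteqP; split=> P.
    move=> [r [a [k [hr ha hP]]]]; exists r, a, (Z \o k); split => // i.
    by exists (k i).
  move=> [r [a [X [hr ha hX hP]]]]; have [k kE] := choice hX.
  exists r, a, k; split => //.
  by rewrite (_ : Z \o k = X)//; apply/funext => i; rewrite kE.
apply/seteqP; split=> P.
  by move=> /Diff_b_jet_sum /(jet_monomial_sum hZ) /zP.
by move=> /zP /(monomial_sum_sub ZW) /monomial_jet_sum /Diff_b_jet_sum.
Qed.
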